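(* Let $d\ge 3$ and $\alpha\in(-1,1)$ be such that $2/(1-\alpha)$ is a positive integer, and suppose $$\frac{v_x}{v_y}\le\frac{d+2}{d(1+\alpha)}.$$ Then under $\alpha$-divergence loss the Bayesian predictive density with respect to the harmonic prior, $$\hat p_H(y\mid x;\alpha)=\frac{m_H^{1/\beta}(\gamma x+(1-\gamma)y,\,v_x\gamma)}{E_{Z_1}\!\left[m_H^{1/\beta}(x+\xi Z_1,\,v_x\gamma)\right]}\,\phi(y-x,v_y/\gamma),$$ satisfies $R_\alpha(\mu;\hat p_H)\le R_\alpha(\mu;\hat p_U)$ for every $\mu\in\mathbb{R}^d$, i.e. it dominates the best invariant predictive density $\hat p_U(y\mid x;\alpha)=\phi(y-x,v_y/\gamma)$.
   Context: $v_x,v_y>0$ known; $X\sim N_d(\mu,v_xI)$, $Y\sim N_d(\mu,v_yI)$ independent; $\phi(\cdot,\sigma^2)$ is the $N_d(0,\sigma^2I)$ density. $\beta=(1-\alpha)/2$, $\gamma=1/(1+\beta v_x/v_y)$, $\xi=(1-\gamma)(v_y/\gamma)^{1/2}$, $Z_1\sim N_d(0,I)$. $m_H(w,v)=\int\phi(w-\mu,v)\|\mu\|^{-(d-2)}d\mu$. The $\alpha$-divergence loss is $D_\alpha=\int f_\alpha\!\left(\hat p(y\mid x)/\phi(y-\mu,v_y)\right)\phi(y-\mu,v_y)\,dy$ with $f_\alpha(z)=\frac{4}{1-\alpha^2}(1-z^{(1+\alpha)/2})$, and the risk is $R_\alpha(\mu;\hat p)=\int D_\alpha\,\phi(x-\mu,v_x)\,dx$.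 *)

(* Defs.v *)
From HB Require Import structures.
From mathcomp Require Import all_boot all_order all_algebra.
From mathcomp Require Import all_classical all_reals all_analysis.
Set Implicit Arguments. Unset Strict Implicit. Unset Printing Implicit Defensive.
Import Order.TTheory GRing.Theory Num.Theory.
Local Open Scope ring_scope.
Local Open Scope ereal_scope.

Section defs.
Variable R : realType.

Definition sqnorm (d : nat) (z : 'rV[R]_d) : R := (\sum_(i < d) (z 0 i) ^+ 2)%R.
Definition enorm (d : nat) (z : 'rV[R]_d) : R := Num.sqrt (sqnorm z).

(* iterated one-dimensional Lebesgue integrals: integral over R^n of a
   function of the list of coordinates (first coordinate outermost) *)
Fixpoint iter_int (n : nat) (g : seq R -> \bar R) : \bar R :=
  match n with
  | 0%N => g [::]
  | n'.+1 => \int[@lebesgue_measure R]_x iter_int n' (fun s => g (x :: s))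
  end.

Definition intRd (d : nat) (f : 'rV[R]_d -> \bar R) : \bar R :=
  iter_int d (fun s => f (\row_(i < d) nth 0%R s i)).

Definition phi (d : nat) (s2 : R) (z : 'rV[R]_d) : R :=
  ((Num.sqrt (2 * pi * s2)) ^- d * expR (- sqnorm z / (2 * s2)))%R.

Definition mH (d : nat) (w : 'rV[R]_d) (v : R) : \bar R :=
  intRd (fun mu => (phi v (w - mu) * (enorm mu) ^- (d - 2))%:E).

Definition beta (alpha : R) : R := ((1 - alpha) / 2)%R.
Definition gamma (alpha vx vy : R) : R := (1 / (1 + beta alpha * vx / vy))%R.
Definition xi (alpha vx vy : R) : R :=
  ((1 - gamma alpha vx vy) * Num.sqrt (vy / gamma alpha vx vy))%R.

(* a predictive density: x |-> (y |-> phat y x) written phat x y *)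
Definition pred_density (d : nat) := 'rV[R]_d -> 'rV[R]_d -> R.

Definition pU (d : nat) (alpha vx vy : R) : pred_density d :=
  fun x y => phi (vy / gamma alpha vx vy) (y - x).

Definition mHpow (d : nat) (alpha : R) (w : 'rV[R]_d) (v : R) : R :=
  (fine (mH w v) `^ (1 / beta alpha))%R.

Definition pH_normalizer (d : nat) (alpha vx vy : R) (x : 'rV[R]_d) : R :=
  fine (intRd (fun z => (phi 1 z *
          mHpow alpha (x + xi alpha vx vy *: z) (vx * gamma alpha vx vy))%:E)).

Definition pH (d : nat) (alpha vx vy : R) : pred_density d :=
  fun x y =>
    let g := gamma alpha vx vy in
    (mHpow alpha (g *: x + (1 - g) *: y) (vx * g) / pH_normalizer alpha vx vy x
      * phi (vy / g) (y - x))%R.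

Definition f_alpha (alpha z : R) : R :=
  (4 / (1 - alpha ^+ 2) * (1 - z `^ ((1 + alpha) / 2)))%R.

Definition D_alpha (d : nat) (alpha vy : R) (mu : 'rV[R]_d) (ph : pred_density d)
    (x : 'rV[R]_d) : \bar R :=
  intRd (fun y => (f_alpha alpha (ph x y / phi vy (y - mu)) * phi vy (y - mu))%:E).

Definition risk_alpha (d : nat) (alpha vx vy : R) (mu : 'rV[R]_d)
    (ph : pred_density d) : \bar R :=
  intRd (fun x => D_alpha alpha vy mu ph x * (phi vx (x - mu))%:E).

End defs.

(* Main.v *)
(**
For [k = 2 / (1 - alpha)] the harmonic marginal is, up to a constant factor, the
radial Laplace mixture [m(|w|^2) = int_0^K eta^(d-3) exp(- eta^2 |w|^2 / 2) d eta]
with [K^2 = 1 / (vx gamma)]. Completing the square and exchanging the integrals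
in [x] and [y] turns the comparison of the two risks into the pointwise inequality
[m(|w|^2)^(-q k) <= E (F_s(w + xi Z)^(-q))] with [q = 1 - 1/k], [s = xi^2] and
[F_sg(x) = E m(|x + sqrt(sg) Z|^2)^k] the heat flow of [m^k].

The quantity [Phi(sg) = E F_sg(w + sqrt(sg) Z)^(-q)] interpolates between both
sides and is nondecreasing on [[0, s]] as soon as
[2 F Lap(F) <= (1 + q) |grad F|^2] there. All terms of this inequality are
mixtures of Gaussian kernels in the variable [sum_i eta_i^2]; it follows from
integration by parts in [eta], Chebyshev's inequality for the decreasing ratios
of the boundary term and of the moments of [m] to [m], and a tangent bound for
[u |-> u / (1 + sg u)] averaged over the mixture, which is where the condition on
[vx / vy] enters. The monotonicity of [Phi] is obtained by discrete time steps
with a uniform second-order error.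
*)

Require Import Defs.
From HB Require Import structures.
From mathcomp Require Import all_boot all_order all_algebra.
From mathcomp Require Import all_classical all_reals all_analysis.
From mathcomp Require Import measurable_realfun ring lra.
Set Implicit Arguments. Unset Strict Implicit. Unset Printing Implicit Defensive.
Import Order.TTheory GRing.Theory Num.Theory.
Import numFieldNormedType.Exports.
Local Open Scope classical_set_scope.
Local Open Scope ring_scope.

(** The exponent [k] must be an integer because [m^k] is then the Laplace transform of a [k]-fold
    convolution, so its heat flow is a mixture of explicit Gaussian kernels and every derivative of
    [F] is an explicit moment. The constant [1 + q] comes from a formal computation: with
    [V = F^(-q)] and [dF/dsg = Lap(F)/2], the integrand of [dPhi/dsg] is [Lap(V)/2 + dV/dsg = (q/2)
    F^(-q-2) ((1+q) |grad F|^2 - 2 F Lap(F))]. This derivative is never taken. The map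
    [y |-> y^(-q)] is bounded below by a tangent, whose Gaussian average is controlled by the value
    of [F] at one dilated point, and explicit kernel inequalities estimate that value. The obstacle
    is growth: [V] may grow like [exp(q k K^2 |x|^2 / 2)] and the step error grows a little faster,
    so its average up to time [s] is finite only if [s q k K^2] stays well below 1. The assumption
    on [vx / vy] gives at most 5/12, which leaves room for the error. *)

(** * Measurable structure and coordinates of row vectors *)

Section row_measurable.
Variables (R : realType) (n : nat).

Definition row_of_tuple (t : n.-tuple R) : 'rV[R]_n := \row_i tnth t i.

(** The sigma-algebra is transported from tuples, where the product structure lives, so that
    measurability of row-valued maps can be checked coordinatewise. *)
Definition row_measurable : set (set 'rV[R]_n) :=
  [set A | measurable (row_of_tuple @^-1` A)].

Let row_set0 : row_measurable set0.
Proof. by rewrite /row_measurable/= preimage_set0. Qed.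

Let row_setC A : row_measurable A -> row_measurable (~` A).
Proof. by rewrite /row_measurable/= preimage_setC => /measurableC. Qed.

Let row_bigcup (F : (set 'rV[R]_n)^nat) :
  (forall i, row_measurable (F i)) -> row_measurable (\bigcup_i F i).
Proof.
by move=> mF; rewrite /row_measurable/= preimage_bigcup; exact: bigcupT_measurable.
Qed.

HB.instance Definition _ := @isMeasurable.Build
  (measure_tuple_display (default_measure_display)) 'rV[R]_n row_measurable
  row_set0 row_setC row_bigcup.

End row_measurable.

Section row_measurable_fun.
Context (R : realType) (n : nat) d (T : measurableType d).

Lemma measurable_row_of_tuple :
  measurable_fun [set: n.-tuple R] (@row_of_tuple R n).
Proof. by move=> _ A mA; rewrite setTI. Qed.

Lemma measurable_coord (i : 'I_n) :
  measurable_fun [set: 'rV[R]_n] (fun r : 'rV[R]_n => r 0 i).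
Proof.
move=> _ A mA; rewrite setTI /measurable/= /row_measurable/=.
rewrite (_ : _ @^-1` _ = (@tnth n R ^~ i) @^-1` A); last first.
  by apply/funext => t /=; rewrite mxE.
by rewrite -[X in measurable X]setTI; exact: measurable_tnth.
Qed.

Lemma measurable_fun_rowP (f : T -> 'rV[R]_n) :
  (forall i, measurable_fun setT (fun t => f t 0 i)) ->
  measurable_fun setT f.
Proof.
move=> mf.
pose g (t : T) : n.-tuple R := [tuple f t 0 i | i < n].
have fg : f = @row_of_tuple R n \o g.
  by apply/funext => t; apply/rowP => i; rewrite /= mxE tnth_mktuple.
rewrite fg; apply: measurableT_comp; first exact: measurable_row_of_tuple.
apply/measurable_fun_tnthP => i.
rewrite (_ : _ \o g = fun t => f t 0 i)//.
by apply/funext => t /=; rewrite tnth_mktuple.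
Qed.

Lemma measurable_rowD (f g : T -> 'rV[R]_n) : measurable_fun setT f ->
  measurable_fun setT g -> measurable_fun setT (fun t => f t + g t).
Proof.
move=> mf mg; apply: measurable_fun_rowP => i.
under eq_fun do rewrite mxE.
exact: measurable_funD (measurableT_comp (measurable_coord i) mf)
  (measurableT_comp (measurable_coord i) mg).
Qed.

Lemma measurable_rowZ (a : T -> R) (f : T -> 'rV[R]_n) : measurable_fun setT a ->
  measurable_fun setT f -> measurable_fun setT (fun t => a t *: f t).
Proof.
move=> ma mf; apply: measurable_fun_rowP => i.
under eq_fun do rewrite mxE.
exact: measurable_funM ma (measurableT_comp (measurable_coord i) mf).
Qed.

Lemma measurable_sqnorm (f : T -> 'rV[R]_n) : measurable_fun setT f ->
  measurable_fun setT (fun t => sqnorm (f t)).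
Proof.
move=> mf; rewrite /sqnorm; apply: measurable_sum => i.
exact: measurable_funX (measurableT_comp (measurable_coord i) mf).
Qed.

End row_measurable_fun.

Section row_cons.
Variables (R : realType) (n : nat).

(** Splitting off coordinate 0 matches [iter_int], whose outermost integral runs over the first
    coordinate. *)
Definition row_cons (p : R * 'rV[R]_n) : 'rV[R]_n.+1 :=
  \row_i oapp (p.2 0) p.1 (unlift ord0 i).

Definition row_uncons (r : 'rV[R]_n.+1) : R * 'rV[R]_n :=
  (r 0 ord0, \row_i r 0 (lift ord0 i)).

Lemma row_cons0 p : row_cons p 0 ord0 = p.1.
Proof. by rewrite mxE unlift_none. Qed.

Lemma row_consS p i : row_cons p 0 (lift ord0 i) = p.2 0 i.
Proof. by rewrite mxE liftK. Qed.

Lemma row_consK : cancel row_cons row_uncons.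
Proof.
move=> [x r]; rewrite /row_uncons row_cons0; congr pair.
by apply/rowP => i; rewrite mxE row_consS.
Qed.

Lemma row_unconsK : cancel row_uncons row_cons.
Proof.
move=> r; apply/rowP => i; case: (unliftP ord0 i) => [j|] ->.
  by rewrite row_consS mxE.
by rewrite row_cons0.
Qed.

Lemma row_consD p1 p2 : row_cons p1 + row_cons p2 = row_cons (p1.1 + p2.1, p1.2 + p2.2).
Proof.
apply/rowP => i; rewrite mxE; case: (unliftP ord0 i) => [j|] ->.
  by rewrite !row_consS mxE.
by rewrite !row_cons0.
Qed.

Lemma row_consZ a p : a *: row_cons p = row_cons (a * p.1, a *: p.2).
Proof.
apply/rowP => i; rewrite mxE; case: (unliftP ord0 i) => [j|] ->.
  by rewrite !row_consS mxE.
by rewrite !row_cons0.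
Qed.

Lemma sqnorm_row_cons p : sqnorm (row_cons p) = p.1 ^+ 2 + sqnorm p.2.
Proof.
rewrite /sqnorm big_ord_recl row_cons0; congr (_ + _).
by apply: eq_bigr => i _; rewrite row_consS.
Qed.

Lemma measurable_row_cons : measurable_fun setT row_cons.
Proof.
apply: measurable_fun_rowP => i; case: (unliftP ord0 i) => [j|] ->.
  under eq_fun do rewrite row_consS.
  exact: measurableT_comp (measurable_coord j) measurable_snd.
under eq_fun do rewrite row_cons0.
exact: measurable_fst.
Qed.

Lemma measurable_row_uncons : measurable_fun setT row_uncons.
Proof.
apply: measurable_fun_pair; first exact: measurable_coord.
apply: measurable_fun_rowP => i /=.
under eq_fun do rewrite mxE.
exact: measurable_coord.
Qed.

End row_cons.

(** * Lebesgue measure on row vectors and changes of variables *)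

Section sigma_finite_prod.
Context (R : realType) d1 d2 (T1 : measurableType d1) (T2 : measurableType d2).
Variables (m1 : {sigma_finite_measure set T1 -> \bar R})
  (m2 : {sigma_finite_measure set T2 -> \bar R}).

Lemma sigma_finite_product_measure1 : sigma_finite setT (m1 \x m2)%E.
Proof.
by case: (lebesgue_integral_fubini.measure_function_Measure_isSigmaFinite__to__measure_function_isSigmaFinite m1 m2).
Qed.

(* Canonical inference on [m1 \x m2] only finds the instance for
   subprobabilities, hence this renaming. *)
Definition sigma_finite_prod : set (T1 * T2) -> \bar R := (m1 \x m2)%E.

HB.instance Definition _ := Measure.copy sigma_finite_prod
  (m1 \x m2 : {measure set (T1 * T2)%type -> \bar R})%E.

HB.instance Definition _ := @Measure_isSigmaFinite.Build _ _ _ sigma_finite_prod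
  sigma_finite_product_measure1.

End sigma_finite_prod.

Section row_lebesgue.
Variable R : realType.
Local Open Scope ereal_scope.

Section step.
Variables (n : nat) (m : {sigma_finite_measure set 'rV[R]_n -> \bar R}).

Definition row_lebesgueS : set 'rV[R]_n.+1 -> \bar R :=
  pushforward (@lebesgue_measure R \x m) (@row_cons R n).

HB.instance Definition _ := @isMeasure.Build _ _ _ row_lebesgueS
  (@measure0 _ _ _ (measure_function_pushforward__canonical__measure_function_Measure (@lebesgue_measure R \x m) (@measurable_row_cons R n)))
  (@measure_ge0 _ _ _ (measure_function_pushforward__canonical__measure_function_Measure (@lebesgue_measure R \x m) (@measurable_row_cons R n)))
  (@measure_semi_sigma_additive _ _ _ (measure_function_pushforward__canonical__measure_function_Measure (@lebesgue_measure R \x m) (@measurable_row_cons R n))).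

Let row_lebesgueS_sigma_finite : sigma_finite setT row_lebesgueS.
Proof.
have [F FT mF] := sigma_finite_product_measure1 (@lebesgue_measure R) m.
exists (fun i => @row_uncons R n @^-1` F i).
  by rewrite -preimage_bigcup -FT preimage_setT.
move=> i; have [mFi Foo] := mF i; split.
  by rewrite -[X in measurable X]setTI; exact: measurable_row_uncons.
rewrite /row_lebesgueS /pushforward -comp_preimage.
by rewrite (_ : _ \o _ = id)//; apply/funext => p /=; rewrite row_consK.
Qed.

HB.instance Definition _ := @Measure_isSigmaFinite.Build _ _ _ row_lebesgueS
  row_lebesgueS_sigma_finite.

End step.

(** The recursion follows [iter_int], so Tonelli identifies the two integrals; sigma-finiteness is
    carried along because each step of Tonelli uses it. *)
Fixpoint row_lebesgue (n : nat) : {sigma_finite_measure set 'rV[R]_n -> \bar R} :=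
  match n with
  | 0%N => @dirac _ 'rV[R]_0 0%R R
  | n'.+1 => row_lebesgueS (row_lebesgue n')
  end.


End row_lebesgue.

Section row_lebesgue_integral.
Variable R : realType.
Local Open Scope ereal_scope.

Lemma measurable_addrl (b : R) : measurable_fun [set: R] (fun x : R => (b + x)%R).
Proof. by apply: measurable_funD. Qed.

(** The image measure agrees with Lebesgue measure on half-open intervals, and uniqueness concludes;
    scaling is treated in the same way. *)
Lemma ge0_integral_shift (f : R -> \bar R) (b : R) :
  measurable_fun setT f -> (forall x, 0 <= f x) ->
  \int[@lebesgue_measure R]_x f (b + x)%R = \int[@lebesgue_measure R]_x f x.
Proof.
move=> mf f0.
pose phi : measurableTypeR R -> measurableTypeR R := fun x => (b + x)%R.
have mphi : measurable_fun setT phi by exact: measurable_addrl.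
rewrite [LHS](_ : _ = \int[pushforward (@lebesgue_measure R) phi]_x f x); last first.
  by rewrite (ge0_integral_pushforward mphi)//; apply: eq_integral.
apply: eq_measure_integral => A mA _; apply/esym/lebesgue_measure_unique => //.
move=> _ [[l u] _ <-] /=.
rewrite /pushforward (_ : _ @^-1` _ = `](l - b)%R, (u - b)%R]%classic); last first.
  by apply/seteqP; split => x /=; rewrite !in_itv/= /phi; lra.
by rewrite !lebesgue_measure_itv/= !lte_fin ltrD2r; case: ifP => //; rewrite -!EFinB; move=> _; congr EFin; ring.
Qed.

Lemma ge0_integral_scale (f : R -> \bar R) (a : R) : (0 < a)%R ->
  measurable_fun setT f -> (forall x, 0 <= f x) ->
  \int[@lebesgue_measure R]_x f x = a%:E * \int[@lebesgue_measure R]_x f (a * x)%R.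
Proof.
move=> a0 mf f0.
pose phi : measurableTypeR R -> measurableTypeR R := fun x => (a * x)%R.
have mphi : measurable_fun setT phi by exact: mulrl_measurable.
rewrite [X in _ = _ * X](_ : _ = \int[pushforward (@lebesgue_measure R) phi]_x f x); last first.
  by rewrite (ge0_integral_pushforward mphi)//; apply: eq_integral.
rewrite -(ge0_integral_mscale _ _ (NngNum (ltW a0)))//.
apply: eq_measure_integral => A mA _; apply: lebesgue_measure_unique => //.
move=> _ [[l u] _ <-] /=; rewrite /mscale/=.
rewrite /pushforward (_ : _ @^-1` _ = `](l / a)%R, (u / a)%R]%classic); last first.
  by apply/seteqP; split => x /=; rewrite !in_itv/= /phi ltr_pdivrMr// ler_pdivlMr// mulrC.
rewrite !lebesgue_measure_itv/= !lte_fin ltr_pM2r ?invr_gt0//.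
case: ifP => _; last by rewrite mule0.
by rewrite -!EFinB -EFinM; congr EFin; field; rewrite gt_eqF.
Qed.

Lemma ge0_integral_opp (f : R -> \bar R) :
  measurable_fun setT f -> (forall x, 0 <= f x) ->
  \int[@lebesgue_measure R]_x f x = \int[@lebesgue_measure R]_x f (- x)%R.
Proof.
move=> mf f0.
pose phi : measurableTypeR R -> measurableTypeR R := fun x => (- x)%R.
have mphi : measurable_fun setT phi by exact: oppr_measurable.
rewrite [RHS](_ : _ = \int[pushforward (@lebesgue_measure R) phi]_x f x); last first.
  by rewrite (ge0_integral_pushforward mphi)//; apply: eq_integral.
by apply: eq_measure_integral => A mA _; exact/esym/lebesgue_measureN.
Qed.

Lemma ge0_integral_affine (f : R -> \bar R) (a b : R) : a != 0%R ->
  measurable_fun setT f -> (forall x, 0 <= f x) ->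
  \int[@lebesgue_measure R]_x f x =
    `|a|%:E * \int[@lebesgue_measure R]_x f (b + a * x)%R.
Proof.
move=> a0 mf f0.
have mf' : measurable_fun setT (fun x => f (b + x)%R).
  exact: measurableT_comp mf (measurable_addrl b).
rewrite -(ge0_integral_shift b mf f0).
have [a_ge0|a_lt0] := leP 0%R a.
  by rewrite ger0_norm// (@ge0_integral_scale _ a)// lt0r a0.
rewrite ltr0_norm// ge0_integral_opp//.
rewrite (@ge0_integral_scale _ (- a)%R) ?oppr_gt0//.
  by congr (_ * _); apply: eq_integral => x _; rewrite mulNr opprK.
exact: measurableT_comp mf' (@oppr_measurable _ _).
Qed.

Lemma row_lebesgue0 (f : 'rV[R]_0 -> \bar R) : (forall x, 0 <= f x) ->
  \int[row_lebesgue R 0]_x f x = f 0%R.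
Proof.
move=> f0; rewrite integral_dirac// ?diracT ?mul1e//.
rewrite (_ : f = cst (f 0%R))//.
by apply/funext => x /=; congr f; apply/rowP => -[].
Qed.

Lemma ge0_row_lebesgueS n (f : 'rV[R]_n.+1 -> \bar R) :
  measurable_fun setT f -> (forall x, 0 <= f x) ->
  \int[row_lebesgue R n.+1]_x f x =
  \int[@lebesgue_measure R]_x \int[row_lebesgue R n]_r f (row_cons (x, r)).
Proof.
move=> mf f0.
have mcons : measurable_fun [set: measurableTypeR R * 'rV[R]_n] (@row_cons R n).
  exact: measurable_row_cons.
transitivity (\int[@lebesgue_measure R \x row_lebesgue R n]_p f (row_cons p)).
  exact: (ge0_integral_pushforward mcons (@lebesgue_measure R \x row_lebesgue R n)).
rewrite fubini_tonelli1//.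
exact: measurableT_comp mf (@measurable_row_cons R n).
Qed.

Lemma measurable_section d1 d2 (T1 : measurableType d1) (T2 : measurableType d2)
  d3 (T3 : measurableType d3) (f : T1 * T2 -> T3) x :
  measurable_fun setT f -> measurable_fun setT (fun y => f (x, y)).
Proof. by move=> mf; exact: measurableT_comp mf (measurable_pair1 x). Qed.

Lemma iter_intE n (g : seq R -> \bar R) (f : 'rV[R]_n -> \bar R) :
  measurable_fun setT f -> (forall x, 0 <= f x) ->
  (forall s, g s = f (\row_(i < n) nth 0%R s i)) ->
  iter_int n g = \int[row_lebesgue R n]_x f x.
Proof.
elim: n g f => [|n IH] g f mf f0 gf.
  by rewrite row_lebesgue0//= gf; congr f; apply/rowP => -[].
rewrite ge0_row_lebesgueS//=; apply: eq_integral => x _.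
apply: IH => //.
  exact: (measurable_section x (measurableT_comp mf (@measurable_row_cons R n))).
move=> s; rewrite gf; congr f; apply/rowP => i; rewrite mxE.
case: (unliftP ord0 i) => [j|] ->; first by rewrite row_consS mxE.
by rewrite row_cons0.
Qed.

Lemma intRdE n (f : 'rV[R]_n -> \bar R) :
  measurable_fun setT f -> (forall x, 0 <= f x) ->
  intRd f = \int[row_lebesgue R n]_x f x.
Proof. by move=> mf f0; exact: iter_intE. Qed.

Lemma ge0_row_lebesgue_affine n (f : 'rV[R]_n -> \bar R) (a : R) (b : 'rV[R]_n) :
  a != 0%R -> measurable_fun setT f -> (forall x, 0 <= f x) ->
  \int[row_lebesgue R n]_x f x =
    (`|a| ^+ n)%:E * \int[row_lebesgue R n]_x f (b + a *: x)%R.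
Proof.
move=> a0; elim: n f b => [|n IH] f b mf f0.
  by rewrite !row_lebesgue0// expr0 mul1e; congr f; apply/rowP => -[].
have mfa : measurable_fun [set: 'rV[R]_n.+1] (fun x : 'rV[R]_n.+1 => f (b + a *: x)%R).
  apply: (measurableT_comp mf); apply: measurable_rowD => //.
  exact: measurable_rowZ.
have mfc := measurableT_comp mf (@measurable_row_cons R n).
rewrite !ge0_row_lebesgueS// -(row_unconsK b).
have mF := @measurable_fun_fubini_tonelli_F _ _ _ _ _ (row_lebesgue R n) _ mfc (fun=> f0 _).
rewrite (@ge0_integral_affine (fubini_F (row_lebesgue R n) (f \o @row_cons R n)) a (row_uncons b).1 a0 mF); last first.
  by move=> x; apply: integral_ge0 => r _; exact: f0.
under eq_integral => x _.
  rewrite /fubini_F/= (IH _ (row_uncons b).2)//; last first.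
    exact: (measurable_section _ mfc).
  over.
rewrite /= ge0_integralZl//; last 2 first.
- apply: (@measurable_fun_fubini_tonelli_F _ _ _ _ _ (row_lebesgue R n)
    (fun p => f (row_cons (((row_uncons b).1 + a * p.1)%R, ((row_uncons b).2 + a *: p.2)%R)))) => //.
  apply: (measurableT_comp mfc); apply: measurable_fun_pair.
    by apply: measurable_funD => //; exact: measurable_funM.
  by apply: measurable_rowD => //; exact: measurable_rowZ.
- by move=> x _; apply: integral_ge0 => r _; exact: f0.
rewrite muleA -EFinM -exprS; congr (_ * _).
apply: eq_integral => x _; apply: eq_integral => r _.
by rewrite row_consZ row_consD.
Qed.

End row_lebesgue_integral.

(** * Gaussian integrals *)

Section gaussian.
Variable R : realType.
Implicit Types (n : nat) (A c : R).

Lemma sqnorm_ge0 n (x : 'rV[R]_n) : 0 <= sqnorm x.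
Proof. by apply: sumr_ge0 => i _; exact: sqr_ge0. Qed.

Lemma sqnormZ n a (x : 'rV[R]_n) : sqnorm (a *: x) = a ^+ 2 * sqnorm x.
Proof.
by rewrite /sqnorm mulr_sumr; apply: eq_bigr => i _; rewrite mxE exprMn.
Qed.

Lemma phi_ge0 n s2 (x : 'rV[R]_n) : 0 <= phi s2 x.
Proof. by rewrite mulr_ge0// ?expR_ge0// invr_ge0 exprn_ge0// sqrtr_ge0. Qed.

Lemma phi_gt0 n s2 (x : 'rV[R]_n) : 0 < s2 -> 0 < phi s2 x.
Proof.
move=> s0; rewrite mulr_gt0 ?expR_gt0// invr_gt0 exprn_gt0// sqrtr_gt0.
by rewrite !mulr_gt0 ?pi_gt0.
Qed.

Lemma measurable_phi n s2 d (T : measurableType d) (f : T -> 'rV[R]_n) :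
  measurable_fun setT f -> measurable_fun setT (fun t => phi s2 (f t)).
Proof.
move=> mf; apply: measurable_funM => //; apply: measurableT_comp => //.
apply: measurable_funM => //; apply: measurableT_comp => //.
exact: measurable_sqnorm.
Qed.

(** The value of [E exp(- A |x + c Z|^2 / 2)] at [r = |x|^2]. Negative [A] with [1 + c^2 A > 0] is
    meaningful and serves to average growing exponentials. *)
Definition gauss_kernel n A c (r : R) : R :=
  Num.sqrt (1 + c ^+ 2 * A) ^- n * expR (- (A * r) / (2 * (1 + c ^+ 2 * A))).

(** Completing the square writes the integrand as a constant times [gauss_fun (b + a * z)] with
    [a^2 = k / 2]; an affine substitution leaves the total Gaussian integral. *)
Lemma integral_gauss1 A c (x : R) : 0 < 1 + c ^+ 2 * A ->
  (\int[@lebesgue_measure R]_z ((Num.sqrt (2 * pi))^-1 * expR (- z ^+ 2 / 2) *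
     expR (- A * (x + c * z) ^+ 2 / 2))%:E)%E =
  ((Num.sqrt (1 + c ^+ 2 * A))^-1 * expR (- (A * x ^+ 2) / (2 * (1 + c ^+ 2 * A))))%:E.
Proof.
set k := 1 + _ => k0.
have k2 : 0 < k / 2 by rewrite divr_gt0.
have pi0 := pi_gt0 R.
pose a := Num.sqrt (k / 2); pose b := a * (A * c * x / k).
have a0 : 0 < a by rewrite sqrtr_gt0.
have aa : a ^+ 2 = k / 2 by rewrite sqr_sqrtr// ltW.
have aE : a * Num.sqrt 2 = Num.sqrt k.
  by rewrite /a -sqrtrM ?(ltW k2)// -mulrA mulVf ?mulr1// pnatr_eq0.
have mgf : measurable_fun [set: R] (fun z : R => (gauss_fun z)%:E).
  by apply/measurable_EFinP; exact: measurable_gauss_fun.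
have := @integralT_gauss R.
rewrite (@ge0_integral_affine _ _ a b) ?gt_eqF//; last first.
  by move=> z; rewrite lee_fin gauss_fun_ge0.
rewrite gtr0_norm// => intE.
have mg : measurable_fun setT (fun z : R => gauss_fun (b + a * z)).
  apply: measurableT_comp; first exact: measurable_gauss_fun.
  by apply: measurable_funD => //; exact: measurable_funM.
pose D := (Num.sqrt (2 * pi))^-1 * expR (- (A * x ^+ 2) / (2 * k)).
under eq_integral => z _.
  rewrite (_ : _ * _ * _ = D * gauss_fun (b + a * z)); last first.
    rewrite /D /gauss_fun -!mulrA -!expRD; congr (_ * expR _).
    rewrite -[b + _](_ : a * (A * c * x / k + z) = _); last by rewrite /b; ring.
    rewrite exprMn aa /k; field.
    by rewrite -/k gt_eqF.
  rewrite EFinM; over.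
rewrite ge0_integralZl//; last 3 first.
- exact/measurable_EFinP.
- by move=> z _; rewrite lee_fin gauss_fun_ge0.
- by rewrite lee_fin mulr_ge0 ?expR_ge0// invr_ge0 sqrtr_ge0.
have -> : (\int[@lebesgue_measure R]_z (gauss_fun (b + a * z))%:E)%E
    = (a^-1 * Num.sqrt pi)%:E.
  by rewrite EFinM -intE muleA -EFinM mulVf ?gt_eqF// mul1e.
rewrite -EFinM /D -aE sqrtrM//; congr EFin; field.
by rewrite !gt_eqF// sqrtr_gt0.
Qed.

Lemma phi_row_cons n s2 (p : R * 'rV[R]_n) :
  phi s2 (row_cons p) =
  (Num.sqrt (2 * pi * s2))^-1 * expR (- p.1 ^+ 2 / (2 * s2)) * phi s2 p.2.
Proof.
rewrite /phi sqnorm_row_cons exprS (invfM (Num.sqrt _)) opprD (mulrDl (- _)) expRD.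
by rewrite mulrACA.
Qed.

Lemma integral_gaussN n A c (x : 'rV[R]_n) : 0 < 1 + c ^+ 2 * A ->
  (\int[row_lebesgue R n]_z
    (phi 1 z * expR (- A * sqnorm (x + c *: z) / 2))%:E)%E =
  (gauss_kernel n A c (sqnorm x))%:E.
Proof.
move=> k0; rewrite /gauss_kernel.
have mint m (y : 'rV[R]_m) : measurable_fun setT
    (fun z : 'rV[R]_m => (phi 1 z * expR (- A * sqnorm (y + c *: z) / 2))%:E).
  apply/measurable_EFinP; apply: measurable_funM; first exact: measurable_phi.
  apply: measurableT_comp => //; apply: measurable_funM => //.
  apply: measurable_funM => //; apply: measurable_sqnorm.
  by apply: measurable_rowD => //; exact: measurable_rowZ.
have ge0 m (y z : 'rV[R]_m) :
    (0 <= (phi 1 z * expR (- A * sqnorm (y + c *: z) / 2))%:E)%E.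
  by rewrite lee_fin mulr_ge0 ?phi_ge0 ?expR_ge0.
elim: n x => [|n IH] x.
  rewrite row_lebesgue0//.
  have sq0 (y : 'rV[R]_0) : sqnorm y = 0 by rewrite /sqnorm big_ord0.
  by rewrite /phi !sq0 !expr0 !mulr0 oppr0 !mul0r expR0 invr1 !mul1r.
rewrite ge0_row_lebesgueS// -(row_unconsK x).
set x0 := (row_uncons x).1; set x1 := (row_uncons x).2.
have -> : row_uncons x = (x0, x1) by [].
pose W (z : R) := (Num.sqrt (2 * pi))^-1 * expR (- z ^+ 2 / 2) *
  expR (- A * (x0 + c * z) ^+ 2 / 2).
have W0 z : (0 <= (W z)%:E)%E.
  by rewrite lee_fin !mulr_ge0 ?expR_ge0// invr_ge0 sqrtr_ge0.
transitivity (\int[@lebesgue_measure R]_z ((W z)%:E *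
  (gauss_kernel n A c (sqnorm x1))%:E))%E.
  apply: eq_integral => z _; rewrite /gauss_kernel -IH.
  rewrite -(ge0_integralZl _ _ (mint n x1))//.
  apply: eq_integral => r _.
  rewrite row_consZ row_consD sqnorm_row_cons phi_row_cons mulr1/= (mulrDr (- A)).
  by rewrite (mulrDl (- A * _)) expRD mulrACA mulr1 EFinM.
have mW : measurable_fun [set: R] (fun z : R => (W z)%:E).
  apply/measurable_EFinP; apply: measurable_funM.
    apply: measurable_funM => //; apply: measurableT_comp => //.
    apply: measurable_funM => //; apply: measurableT_comp => //.
  apply: measurableT_comp => //; apply: measurable_funM => //.
  apply: measurable_funM => //; apply: measurable_funX.
  by apply: measurable_funD => //; exact: measurable_funM.
rewrite ge0_integralZr//; last first.
  by rewrite lee_fin mulr_ge0 ?expR_ge0// invr_ge0 exprn_ge0// sqrtr_ge0.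
rewrite integral_gauss1// -EFinM sqnorm_row_cons/=; congr EFin.
by rewrite /gauss_kernel [in RHS](exprS _ n) (invfM (Num.sqrt _)) (mulrDr A) opprD (mulrDl (- _)) expRD mulrACA.
Qed.

Lemma integral_phi1 n : (\int[row_lebesgue R n]_z (phi 1 z : R)%:E)%E = 1%E.
Proof.
have h : 0 < 1 + (0 : R) ^+ 2 * 0 by rewrite mulr0 addr0 ltr01.
transitivity (gauss_kernel n 0 0 (sqnorm (0 : 'rV[R]_n)))%:E; last first.
  by rewrite /gauss_kernel mulr0 addr0 sqrtr1 expr1n invr1 mul0r oppr0 mul0r expR0 mul1r.
rewrite -(integral_gaussN _ h); apply: eq_integral => z _.
by rewrite oppr0 !mul0r expR0 mulr1.
Qed.

Lemma phi_scale n s (z : 'rV[R]_n) : 0 < s ->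
  `|s| ^+ n * phi (s ^+ 2) (s *: z) = phi 1 z.
Proof.
move=> s0; rewrite /phi gtr0_norm// sqnormZ mulr1 mulrA; congr (_ * expR _).
  have -> : Num.sqrt (2 * pi * s ^+ 2) = s * Num.sqrt (2 * pi).
    by rewrite mulrC sqrtrM ?sqr_ge0// sqrtr_sqr gtr0_norm.
  rewrite exprMn invfM mulrA divff ?mul1r// expf_neq0//.
  by rewrite gt_eqF.
by field; rewrite gt_eqF.
Qed.

Lemma integral_phi n s2 (y : 'rV[R]_n) : 0 < s2 ->
  (\int[row_lebesgue R n]_z (phi s2 (z - y))%:E)%E = 1%E.
Proof.
move=> s0; pose s := Num.sqrt s2.
have sgt0 : 0 < s by rewrite sqrtr_gt0.
have -> : s2 = s ^+ 2 by rewrite sqr_sqrtr// ltW.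
rewrite (@ge0_row_lebesgue_affine _ _ _ s y) ?gt_eqF//; last 2 first.
- by apply/measurable_EFinP; apply: measurable_phi; exact: measurable_rowD.
- by move=> z; rewrite lee_fin phi_ge0.
have mp : measurable_fun setT (fun z : 'rV[R]_n => (phi (s ^+ 2) (y + s *: z - y))%:E).
  apply/measurable_EFinP; apply: measurable_phi; apply: measurable_rowD => //.
  by apply: measurable_rowD => //; exact: measurable_rowZ.
have p0 z : setT z -> (0 <= (phi (s ^+ 2) (y + s *: z - y))%:E)%E.
  by move=> _; rewrite lee_fin phi_ge0.
have sn : (0 <= (`|s| ^+ n)%:E)%E by rewrite lee_fin exprn_ge0.
rewrite -[LHS](ge0_integralZl _ measurableT mp p0 sn).
rewrite -(integral_phi1 n); apply: eq_integral => z _.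
by rewrite addrAC subrr add0r -EFinM phi_scale.
Qed.

End gaussian.

(** * The heat semigroup *)

Section heat.
Variables (R : realType) (n : nat).
Implicit Types (g : 'rV[R]_n -> \bar R) (x y z u : 'rV[R]_n).
Local Open Scope ereal_scope.
Notation mu := (row_lebesgue R n).

(** The semigroup of half the Laplacian at time [c^2], indexed by the standard deviation so that
    [xi] can be inserted directly. *)
Definition heat (c : R) g x : \bar R := \int[mu]_z ((phi 1 z)%:E * g (x + c *: z)%R).

Lemma measurable_phiE s2 d (T : measurableType d) (f : T -> 'rV[R]_n) :
  measurable_fun setT f -> measurable_fun setT (fun t => (phi s2 (f t))%:E).
Proof. by move=> mf; apply/measurable_EFinP; exact: measurable_phi. Qed.

Lemma phiE_ge0 s2 z : 0 <= (phi s2 z)%:E.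
Proof. by rewrite lee_fin phi_ge0. Qed.

Lemma measurable_rowDZ d (T : measurableType d) (f h : T -> 'rV[R]_n) (c : R) :
  measurable_fun setT f -> measurable_fun setT h ->
  measurable_fun setT (fun t => f t + c *: h t)%R.
Proof. by move=> mf mh; apply: measurable_rowD => //; exact: measurable_rowZ. Qed.

Lemma measurable_heat_integrand c g : measurable_fun setT g ->
  measurable_fun setT (fun p : 'rV[R]_n * 'rV[R]_n =>
    (phi 1 p.2)%:E * g (p.1 + c *: p.2)%R).
Proof.
move=> mg; apply: emeasurable_funM; first exact: measurable_phiE.
by apply: (measurableT_comp mg); exact: measurable_rowDZ.
Qed.

Lemma heat_integrand_ge0 c g x z : (forall y, 0 <= g y) ->
  0 <= (phi 1 z)%:E * g (x + c *: z)%R.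
Proof. by move=> g0; rewrite mule_ge0 ?phiE_ge0. Qed.

Lemma measurable_heat c g : measurable_fun setT g -> (forall y, 0 <= g y) ->
  measurable_fun setT (heat c g).
Proof.
move=> mg g0.
apply: (@measurable_fun_fubini_tonelli_F _ _ _ _ _ mu _
  (measurable_heat_integrand c mg)).
by move=> p; exact: heat_integrand_ge0.
Qed.

Lemma heat_ge0 c g x : (forall y, 0 <= g y) -> 0 <= heat c g x.
Proof. by move=> g0; apply: integral_ge0 => z _; exact: heat_integrand_ge0. Qed.

Lemma measurable_heat_section c g x : measurable_fun setT g ->
  measurable_fun setT (fun z => (phi 1 z)%:E * g (x + c *: z)%R).
Proof. by move=> mg; exact: (measurable_section x (measurable_heat_integrand c mg)). Qed.

Lemma le_heat c g1 g2 x : measurable_fun setT g1 -> measurable_fun setT g2 ->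
  (forall y, 0 <= g1 y) -> (forall y, g1 y <= g2 y) -> heat c g1 x <= heat c g2 x.
Proof.
move=> m1 m2 g10 g12; apply: ge0_le_integral => //.
- by move=> z _; exact: heat_integrand_ge0.
- exact: measurable_heat_section.
- exact: measurable_heat_section.
- by move=> z _; apply: lee_wpmul2l; rewrite ?phiE_ge0.
Qed.

Lemma heatD c g1 g2 x : measurable_fun setT g1 -> measurable_fun setT g2 ->
  (forall y, 0 <= g1 y) -> (forall y, 0 <= g2 y) ->
  heat c (fun y => g1 y + g2 y) x = heat c g1 x + heat c g2 x.
Proof.
move=> m1 m2 g10 g20; rewrite /heat -ge0_integralD//.
- by apply: eq_integral => z _; rewrite ge0_muleDr.
- by move=> z _; exact: heat_integrand_ge0.
- exact: measurable_heat_section.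
- by move=> z _; exact: heat_integrand_ge0.
- exact: measurable_heat_section.
Qed.

Lemma heatZ c k g x : measurable_fun setT g -> (forall y, 0 <= g y) -> 0 <= k ->
  heat c (fun y => k * g y) x = k * heat c g x.
Proof.
move=> mg g0 k0; rewrite /heat -ge0_integralZl//.
- by apply: eq_integral => z _; rewrite muleCA.
- exact: measurable_heat_section.
- by move=> z _; exact: heat_integrand_ge0.
Qed.

Lemma heat_cst c k x : 0 <= k -> heat c (fun=> k) x = k.
Proof.
move=> k0; rewrite /heat ge0_integralZr//; last first.
- by move=> z _; rewrite phiE_ge0.
- exact: measurable_phiE.
by rewrite integral_phi1 mul1e.
Qed.

Lemma heat0 g x : 0 <= g x -> heat 0 g x = g x.
Proof.
move=> g0; rewrite -[RHS](@heat_cst 0 (g x) x)//.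
by apply: eq_integral => z _; rewrite scale0r addr0.
Qed.

Lemma heat_densityE s g x y : (0 < s)%R -> measurable_fun setT g ->
  (forall y, 0 <= g y) ->
  \int[mu]_u ((phi (s ^+ 2) (u - y))%:E * g (x + u)%R) = heat s g (x + y)%R.
Proof.
move=> s0 mg g0.
have mi : measurable_fun setT (fun u : 'rV[R]_n => (phi (s ^+ 2) (u - y))%:E * g (x + u)%R).
  apply: emeasurable_funM; first by apply: measurable_phiE; exact: measurable_rowD.
  by apply: (measurableT_comp mg); exact: measurable_rowD.
have i0 u : 0 <= (phi (s ^+ 2) (u - y))%:E * g (x + u)%R.
  by rewrite mule_ge0 ?phiE_ge0.
rewrite (@ge0_row_lebesgue_affine _ _ _ s y _ mi i0) ?gt_eqF//.
have mi' : measurable_fun setT (fun u : 'rV[R]_n =>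
    (phi (s ^+ 2) (y + s *: u - y))%:E * g (x + (y + s *: u))%R).
  by apply: (measurableT_comp mi); exact: measurable_rowDZ.
rewrite /heat -[LHS](ge0_integralZl _ measurableT mi' _ _)//.
  by apply: eq_integral => z _; rewrite muleA -EFinM addrAC subrr add0r phi_scale// addrA.
Qed.

(** Up to its normalising constant, the density is [exp(- A |u - a z|^2 / 2)] with [A = b^(-2)], so
    [integral_gaussN] already evaluates the integral. *)
Lemma gauss_convolution a b u : (0 < b)%R ->
  \int[mu]_z ((phi 1 z)%:E * (phi (b ^+ 2) (u - a *: z))%:E) =
  (phi (a ^+ 2 + b ^+ 2) u)%:E.
Proof.
move=> b0.
have b2 : (0 < b ^+ 2)%R by rewrite exprn_gt0.
have k0 : (0 < 1 + (- a) ^+ 2 * (b ^+ 2)^-1)%R.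
  by rewrite ltr_pwDl// mulr_ge0// ?sqr_ge0// invr_ge0 ltW.
pose D := (Num.sqrt (2 * pi * b ^+ 2) ^- n)%R.
have D0 : 0 <= D%:E by rewrite lee_fin invr_ge0 exprn_ge0// sqrtr_ge0.
transitivity (D%:E * \int[mu]_z
   (phi 1 z * expR (- (b ^+ 2)^-1 * sqnorm (u + - a *: z) / 2))%:E).
  rewrite -ge0_integralZl//.
  - apply: eq_integral => z _; rewrite -!EFinM /phi -/D scaleNr; congr EFin.
    rewrite mulrCA; congr (_ * (_ * expR _))%R; field.
    by rewrite gt_eqF.
  - apply/measurable_EFinP; apply: measurable_funM; first exact: measurable_phi.
    apply: measurableT_comp => //; apply: measurable_funM => //.
    apply: measurable_funM => //; apply: measurable_sqnorm.
    exact: measurable_rowDZ.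
  - by move=> z _; rewrite lee_fin mulr_ge0 ?phi_ge0 ?expR_ge0.
rewrite (integral_gaussN _ k0) -EFinM /gauss_kernel /phi /D mulrA; congr (_ * expR _)%:E.
  rewrite -invfM -exprMn -sqrtrM; last by rewrite !mulr_ge0 ?pi_ge0// ltW.
  congr (Num.sqrt _ ^- n); field.
  by rewrite gt_eqF.
rewrite sqrrN; field.
rewrite !gt_eqF//= ltr_pwDr//.
by rewrite sqr_ge0.
Qed.

(** Only the inner average is rewritten with a density, hence [0 < b] while [a] may vanish; Tonelli
    then leaves a Gaussian convolution. *)
Lemma heat_heat a b g x : (0 < b)%R -> measurable_fun setT g ->
  (forall y, 0 <= g y) ->
  heat a (heat b g) x = heat (Num.sqrt (a ^+ 2 + b ^+ 2)) g x.
Proof.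
move=> b0 mg g0.
have ab0 : (0 < a ^+ 2 + b ^+ 2)%R by rewrite ltr_wpDl ?sqr_ge0// exprn_gt0.
rewrite -[in RHS](addr0 x) -heat_densityE ?sqrtr_gt0//.
rewrite sqr_sqrtr ?(ltW ab0)//.
pose K (p : 'rV[R]_n * 'rV[R]_n) := (phi 1 p.1)%:E *
  ((phi (b ^+ 2) (p.2 - a *: p.1))%:E * g (x + p.2)%R).
have mK : measurable_fun setT K.
  apply: emeasurable_funM; first exact: measurable_phiE.
  apply: emeasurable_funM; last first.
    by apply: (measurableT_comp mg); exact: measurable_rowD.
  apply: measurable_phiE; under eq_fun do rewrite -scaleNr.
  exact: measurable_rowDZ.
have K0 p : 0 <= K p by rewrite !mule_ge0 ?phiE_ge0.
transitivity (\int[mu]_z \int[mu]_u K (z, u)).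
  apply: eq_integral => z _; rewrite -heat_densityE//.
  rewrite -ge0_integralZl//.
  - apply: emeasurable_funM; last first.
      by apply: (measurableT_comp mg); exact: measurable_rowD.
    by apply: measurable_phiE; exact: measurable_rowD.
  - by move=> u _; rewrite mule_ge0 ?phiE_ge0.
  - exact: phiE_ge0.
rewrite (fubini_tonelli K mK K0); apply: eq_integral => u _.
rewrite subr0 -(gauss_convolution a u b0) -ge0_integralZr//.
- by apply: eq_integral => z _; rewrite /K/= muleA.
- apply: emeasurable_funM; first exact: measurable_phiE.
  apply: measurable_phiE; under eq_fun do rewrite -scaleNr.
  exact: measurable_rowDZ.
- by move=> z _; rewrite mule_ge0 ?phiE_ge0.
Qed.

Definition dotr x y : R := (\sum_(i < n) x ord0 i * y ord0 i)%R.

Lemma sqnormD x y : sqnorm (x + y) = (sqnorm x + 2 * dotr x y + sqnorm y)%R.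
Proof.
rewrite /sqnorm /dotr mulr_sumr -!big_split/=; apply: eq_bigr => i _.
by rewrite mxE; ring.
Qed.

Lemma dotrDr x y z : dotr x (y + z) = (dotr x y + dotr x z)%R.
Proof. by rewrite /dotr -big_split; apply: eq_bigr => i _; rewrite mxE mulrDr. Qed.

Lemma dotrZl a x y : dotr (a *: x) y = (a * dotr x y)%R.
Proof. by rewrite /dotr mulr_sumr; apply: eq_bigr => i _; rewrite mxE mulrA. Qed.

Lemma dotrZr a x y : dotr x (a *: y) = (a * dotr x y)%R.
Proof. by rewrite /dotr mulr_sumr; apply: eq_bigr => i _; rewrite mxE mulrCA. Qed.

Lemma dotrr x : dotr x x = sqnorm x.
Proof. by apply: eq_bigr => i _; rewrite expr2. Qed.

Lemma measurable_dotr x d (T : measurableType d) (f : T -> 'rV[R]_n) :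
  measurable_fun setT f -> measurable_fun setT (fun t => dotr x (f t)).
Proof.
move=> mf; apply: measurable_sum => i; apply: measurable_funM => //.
exact: measurableT_comp (measurable_coord i) mf.
Qed.

(** Cameron-Martin: translating [Z] by [b c x] absorbs the exponential weight. Since the tilt is
    along [x] itself, the translation only dilates the base point. *)
Lemma heat_tilt b c g x : measurable_fun setT g -> (forall y, 0 <= g y) ->
  heat c (fun y => (expR (b * dotr x (y - x)))%:E * g y) x =
  (expR (b ^+ 2 * c ^+ 2 * sqnorm x / 2))%:E * heat c g ((1 + b * c ^+ 2) *: x).
Proof.
move=> mg g0.
pose g' y := (expR (b * dotr x (y - x)))%:E * g y.
have mg' : measurable_fun setT g'.
  apply: emeasurable_funM => //; apply/measurable_EFinP.
  apply: measurableT_comp => //; apply: measurable_funM => //.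
  by apply: measurable_dotr; exact: measurable_rowD.
have g'0 y : 0 <= g' y by rewrite mule_ge0 ?lee_fin ?expR_ge0.
have mi := measurable_heat_section c x mg'.
have i0 z : 0 <= (phi 1 z)%:E * g' (x + c *: z)%R by exact: heat_integrand_ge0.
rewrite [LHS](@ge0_row_lebesgue_affine _ _ _ 1 ((b * c) *: x) _ mi i0) ?oner_eq0//.
rewrite normr1 expr1n mul1e /heat -ge0_integralZl//; last 2 first.
- exact: measurable_heat_section.
- by move=> z _; exact: heat_integrand_ge0.
apply: eq_integral => z _; rewrite /g' scale1r.
have -> : (x + c *: ((b * c) *: x + z) = (1 + b * c ^+ 2) *: x + c *: z)%R.
  rewrite scalerDr scalerA addrA scalerDl scale1r; congr (_ + _ *: _ + _)%R; ring.
rewrite !muleA -!EFinM; congr (_%:E * _); rewrite /phi mulrAC [in RHS]mulrCA -!mulrA.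
rewrite -!expRD; congr (_ * expR _)%R.
have -> : ((1 + b * c ^+ 2) *: x + c *: z - x = (b * c ^+ 2) *: x + c *: z)%R.
  by apply/rowP => i; rewrite !mxE; ring.
by rewrite sqnormD !dotrDr !dotrZr dotrr dotrZl sqnormZ; field.
Qed.

End heat.

(** * Signed integrands under Gaussian domination *)

Section dominated.
Variable R : realType.
Local Open Scope ereal_scope.

Lemma integrable_gaussian_dominated n (f : 'rV[R]_n -> R) (C eps : R) : (0 < eps)%R ->
  measurable_fun setT f ->
  (forall r, `|f r| <= C * expR (- eps * sqnorm r))%R ->
  (row_lebesgue R n).-integrable setT (EFin \o f).
Proof.
move=> e0 mf fC.
pose s2 := ((2 * eps)^-1)%R; have s0 : (0 < s2)%R by rewrite invr_gt0 mulr_gt0.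
pose D := (C * Num.sqrt (2 * pi * s2) ^+ n)%R.
have q0 : (0 < Num.sqrt (2 * pi * s2))%R by rewrite sqrtr_gt0 !mulr_gt0// pi_gt0.
have ip : (row_lebesgue R n).-integrable setT (EFin \o fun r : 'rV[R]_n => D * phi s2 r)%R.
  rewrite (_ : EFin \o _ = fun r : 'rV[R]_n => D%:E * (phi s2 r)%:E); last first.
    by apply/funext => r; rewrite /= EFinM.
  apply: integrableZl => //; apply/integrableP; split; first exact: measurable_phiE.
  rewrite (_ : \int[_]_x _ = 1) ?ltry// -(@integral_phi _ n s2 0%R)//.
  by apply: eq_integral => r _; rewrite subr0 gee0_abs// phiE_ge0.
apply: le_integrable ip => //; first exact/measurable_EFinP.
move=> r _; rewrite /= !lee_fin (le_trans (fC r))// (le_trans _ (ler_norm _))//.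
rewrite /D /phi -mulrA mulVKf ?expf_neq0 ?gt_eqF//.
rewrite (_ : (- eps * sqnorm r)%R = (- sqnorm r / (2 * s2))%R)// /s2.
by field; rewrite gt_eqF.
Qed.

(** The integrand of [D_alpha] changes sign, so Tonelli is replaced by Fubini. A Gaussian bound is
    inherited by every section, with constant [C exp(- eps x^2)], which lets the induction run. *)
Lemma iter_int_gaussian_dominated n (g : seq R -> \bar R) (f : 'rV[R]_n -> R)
    (C eps : R) : (0 < eps)%R -> measurable_fun setT f ->
  (forall r, `|f r| <= C * expR (- eps * sqnorm r))%R ->
  (forall s, g s = (f (\row_(i < n) nth 0%R s i))%:E) ->
  iter_int n g = \int[row_lebesgue R n]_x (f x)%:E.
Proof.
move=> e0; elim: n g f C => [|n IH] g f C mf fC gf.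
  rewrite /= gf integral_dirac// ?diracT ?mul1e//; last exact/measurable_EFinP.
  by congr (f _)%:E; apply/rowP => -[].
have mcons : measurable_fun [set: measurableTypeR R * 'rV[R]_n] (@row_cons R n).
  exact: measurable_row_cons.
have mfc : measurable_fun [set: measurableTypeR R * 'rV[R]_n] (EFin \o f \o @row_cons R n).
  by apply: measurableT_comp mcons; exact/measurable_EFinP.
have int1 := integrable_gaussian_dominated e0 mf fC.
have int2 : (@lebesgue_measure R \x row_lebesgue R n).-integrable setT
    (EFin \o f \o @row_cons R n).
  apply/integrable12ltyP => //.
  move/integrableP : int1 => [_]; rewrite ge0_row_lebesgueS//.
  by apply: measurableT_comp => //; exact/measurable_EFinP.
transitivity (\int[@lebesgue_measure R \x row_lebesgue R n]_p (f (row_cons p))%:E); last first.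
  apply/esym; apply: (integral_pushforward mcons _ int2) => //.
  exact/measurable_EFinP.
rewrite -(integral12_prod_meas1 int2)/=; apply: eq_integral => x _.
rewrite /fubini_F/=; apply: (IH _ (fun r => f (row_cons (x, r))) (C * expR (- eps * x ^+ 2))%R).
- exact: (measurable_section x (measurableT_comp mf (@measurable_row_cons R n))).
- move=> r; rewrite (le_trans (fC _))// sqnorm_row_cons -mulrA -expRD.
  by rewrite mulrDr.
- move=> s; rewrite gf; congr (f _)%:E; apply/rowP => i; rewrite mxE.
  case: (unliftP ord0 i) => [j|] ->; first by rewrite row_consS mxE.
  by rewrite row_cons0.
Qed.

End dominated.

(* A finite measure on the line carried by D, given as the image under [law_var]
   of the measure with density [law_weight] with respect to [law_base]. *)
Record law (R : realType) (D : set R) := Law {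
  law_disp : measure_display;
  law_type : measurableType law_disp;
  law_base : {sigma_finite_measure set law_type -> \bar R};
  law_weight : law_type -> R;
  law_var : law_type -> R;
  measurable_law_weight : measurable_fun setT law_weight;
  measurable_law_var : measurable_fun setT law_var;
  law_weight_ge0 : forall t, 0 <= law_weight t;
  law_varP : forall t, law_weight t != 0 -> D (law_var t);
  integrable_law_weight : law_base.-integrable setT (EFin \o law_weight) }.

Arguments law_weight {R D} l t : rename.
Arguments law_var {R D} l t : rename.
Arguments law_weight_ge0 {R D} l t : rename.
Arguments law_varP {R D l} t _ : rename.
Arguments measurable_law_weight {R D} l : rename.
Arguments measurable_law_var {R D} l : rename.
Arguments integrable_law_weight {R D} l : rename.

Definition ev (R : realType) (D : set R) (l : law D) (h : R -> R) : R :=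
  (\int[law_base l]_t (law_weight l t * h (law_var l t)))%R.

(** The bound is required on the support [D] only: decaying exponentials, for instance, are
    unbounded on the whole line. *)
Definition bounded_test (R : realType) (D : set R) (h : R -> R) :=
  measurable_fun setT h /\ exists C, forall x, D x -> `|h x| <= C.

(** * Calculus of expectations of bounded test functions *)

Section bounded_test.
Variables (R : realType) (D : set R).
Implicit Types h : R -> R.

Lemma bounded_test_cst (a : R) : bounded_test D (fun=> a).
Proof. by split; [exact: measurable_cst|exists `|a|]. Qed.

Lemma bounded_testD h1 h2 : bounded_test D h1 -> bounded_test D h2 ->
  bounded_test D (fun x => h1 x + h2 x).
Proof.
move=> [m1 [C1 b1]] [m2 [C2 b2]]; split; first exact: measurable_funD.
exists (C1 + C2) => x Dx; rewrite (le_trans (ler_normD _ _))// lerD//; [exact: b1|exact: b2].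
Qed.

Lemma bounded_testM h1 h2 : bounded_test D h1 -> bounded_test D h2 ->
  bounded_test D (fun x => h1 x * h2 x).
Proof.
move=> [m1 [C1 b1]] [m2 [C2 b2]]; split; first exact: measurable_funM.
by exists (C1 * C2) => x Dx; rewrite normrM ler_pM ?normr_ge0//; [exact: b1|exact: b2].
Qed.

Lemma bounded_testZ (a : R) h : bounded_test D h -> bounded_test D (fun x => a * h x).
Proof. by apply: bounded_testM; exact: bounded_test_cst. Qed.

Lemma bounded_testB h1 h2 : bounded_test D h1 -> bounded_test D h2 ->
  bounded_test D (fun x => h1 x - h2 x).
Proof.
move=> t1 /(bounded_testZ (-1)) t2.
rewrite (_ : (fun _ => _) = (fun x => h1 x + -1 * h2 x)); first exact: bounded_testD.
by apply/funext => x; rewrite mulN1r.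
Qed.

Lemma bounded_testX h k : bounded_test D h -> bounded_test D (fun x => h x ^+ k).
Proof.
move=> t; elim: k => [|k IH].
  by under eq_fun do rewrite expr0; exact: bounded_test_cst.
by under eq_fun do rewrite exprS; exact: bounded_testM.
Qed.

Lemma bounded_test_ge0 h C : measurable_fun setT h ->
  (forall x, D x -> 0 <= h x <= C) -> bounded_test D h.
Proof.
by move=> mh hC; split => //; exists C => x Dx; have /andP[? ?] := hC x Dx; rewrite ger0_norm.
Qed.

End bounded_test.

Ltac btest := repeat first [ assumption | exact: bounded_test_cst
  | apply: bounded_testX | apply: bounded_testM | apply: bounded_testB
  | apply: bounded_testD ].

Section ev.
Variables (R : realType) (D : set R) (l : law D).
Implicit Types h : R -> R.

Lemma ev_measurable h : measurable_fun setT h ->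
  measurable_fun setT (fun t => law_weight l t * h (law_var l t)).
Proof.
move=> mh; apply: measurable_funM; first exact: measurable_law_weight.
exact: (measurableT_comp mh (measurable_law_var l)).
Qed.

Lemma ev_bound h C t : (forall x, D x -> `|h x| <= C) ->
  `|law_weight l t * h (law_var l t)| <= C * law_weight l t.
Proof.
move=> hC; rewrite normrM (ger0_norm (law_weight_ge0 l t)) mulrC.
have [->|w0] := eqVneq (law_weight l t) 0; first by rewrite !mulr0.
rewrite ler_wpM2r ?law_weight_ge0//; apply: hC; exact: law_varP.
Qed.

Lemma ev_integrable h : bounded_test D h ->
  (law_base l).-integrable setT (EFin \o fun t => law_weight l t * h (law_var l t)).
Proof.
move=> [mh [C hC]].
have i : (law_base l).-integrable setT (EFin \o fun t => C * law_weight l t).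
  rewrite (_ : EFin \o _ = fun t => (C%:E * (law_weight l t)%:E)%E).
    exact: integrableZl (integrable_law_weight l).
  by apply/funext => t; rewrite /= EFinM.
apply: le_integrable i => //; first by apply/measurable_EFinP; exact: ev_measurable.
move=> t _; rewrite /= lee_fin (le_trans (ev_bound t hC))//.
exact: ler_norm.
Qed.

Lemma EFin_ev h : bounded_test D h ->
  (ev l h)%:E = (\int[law_base l]_t (law_weight l t * h (law_var l t))%:E)%E.
Proof. by move=> th; rewrite fineK//; apply: integrable_fin_num => //; exact: ev_integrable. Qed.

Lemma evD h1 h2 : bounded_test D h1 -> bounded_test D h2 ->
  ev l (fun x => h1 x + h2 x) = ev l h1 + ev l h2.
Proof.
move=> t1 t2; rewrite /ev -RintegralD//; [|exact: ev_integrable|exact: ev_integrable].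
by apply: eq_Rintegral => t _; rewrite mulrDr.
Qed.

Lemma evZ (a : R) h : bounded_test D h -> ev l (fun x => a * h x) = a * ev l h.
Proof.
move=> t; rewrite /ev -RintegralZl//; last exact: ev_integrable.
by apply: eq_Rintegral => x _; rewrite mulrCA.
Qed.

Lemma evZr (a : R) h : bounded_test D h -> ev l (fun x => h x * a) = ev l h * a.
Proof. by move=> t; under eq_fun do rewrite mulrC; rewrite evZ// mulrC. Qed.

Lemma evB h1 h2 : bounded_test D h1 -> bounded_test D h2 ->
  ev l (fun x => h1 x - h2 x) = ev l h1 - ev l h2.
Proof.
move=> t1 t2; rewrite /ev -RintegralB//; [|exact: ev_integrable|exact: ev_integrable].
by apply: eq_Rintegral => t _; rewrite mulrBr.
Qed.

Lemma eq_ev h1 h2 : (forall x, D x -> h1 x = h2 x) -> ev l h1 = ev l h2.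
Proof.
move=> h12; apply: eq_Rintegral => t _.
have [->|w0] := eqVneq (law_weight l t) 0; first by rewrite !mul0r.
by rewrite h12//; exact: law_varP.
Qed.

Lemma le_ev h1 h2 : bounded_test D h1 -> bounded_test D h2 ->
  (forall x, D x -> h1 x <= h2 x) -> ev l h1 <= ev l h2.
Proof.
move=> t1 t2 h12; apply: le_Rintegral => //; [exact: ev_integrable|exact: ev_integrable|].
move=> t _; have [->|w0] := eqVneq (law_weight l t) 0; first by rewrite !mul0r.
by rewrite ler_wpM2l ?law_weight_ge0// h12//; exact: law_varP.
Qed.

Lemma ev_ge0 h : (forall x, D x -> 0 <= h x) -> 0 <= ev l h.
Proof.
move=> h0; apply: Rintegral_ge0 => t _.
have [->|w0] := eqVneq (law_weight l t) 0; first by rewrite !mul0r.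
by rewrite mulr_ge0 ?law_weight_ge0// h0//; exact: law_varP.
Qed.

(** Symmetrisation: the double average of [p(x) p(y) (u(x) - u(y)) (v(x) - v(y))] is nonnegative and
    expands to twice the difference of the two sides. *)
Lemma ev_chebyshev p u v : bounded_test D p -> bounded_test D u -> bounded_test D v ->
  (forall x, D x -> 0 <= p x) ->
  (forall x y, D x -> D y -> 0 <= (u x - u y) * (v x - v y)) ->
  ev l (fun x => p x * u x) * ev l (fun x => p x * v x) <=
  ev l p * ev l (fun x => p x * (u x * v x)).
Proof.
move=> tp tu tv p0 uv.
have tpu := bounded_testM tp tu; have tpv := bounded_testM tp tv.
have tpuv := bounded_testM tp (bounded_testM tu tv).
set a := ev l (fun x => p x * u x); set b := ev l (fun x => p x * v x).
set c := ev l p; set e := ev l (fun x => p x * (u x * v x)).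
have inner x : ev l (fun y => p x * (p y * ((u x - u y) * (v x - v y)))) =
    c * (p x * (u x * v x)) - b * (p x * u x) - a * (p x * v x) + e * p x.
  have -> : ev l (fun y => p x * (p y * ((u x - u y) * (v x - v y)))) =
     ev l (fun y => p x * (u x * v x) * p y + (- (p x * u x)) * (p y * v y)
       + (- (p x * v x)) * (p y * u y) + p x * (p y * (u y * v y))).
    by apply: eq_ev => y _; ring.
  by rewrite !evD ?evZ//; [rewrite -/a -/b -/c -/e; ring|..]; btest.
have outer : 0 <= ev l (fun x => c * (p x * (u x * v x)) - b * (p x * u x)
    - a * (p x * v x) + e * p x).
  apply: ev_ge0 => x Dx; rewrite -inner; apply: ev_ge0 => y Dy.
  by rewrite mulr_ge0 ?p0// mulr_ge0 ?p0//; exact: uv.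
move: outer; rewrite evD ?evB ?evB ?evZ//; try by btest.
rewrite -/a -/b -/c -/e => h; lra.
Qed.

End ev.

Lemma measurable_fun2 (R : realType) d (T : measurableType d) (h : R -> R -> R)
    (f g : T -> R) : measurable_fun setT (fun p : R * R => h p.1 p.2) ->
  measurable_fun setT f -> measurable_fun setT g ->
  measurable_fun setT (fun t => h (f t) (g t)).
Proof.
move=> mh mf mg.
exact: (measurableT_comp mh (measurable_fun_pair mf mg)).
Qed.

Section ev_swap.
Variables (R : realType) (D1 D2 : set R) (l1 : law D1) (l2 : law D2).
Variables (h : R -> R -> R) (C : R).
Hypothesis mh : measurable_fun setT (fun p : R * R => h p.1 p.2).
Hypothesis hC : forall x y, D1 x -> D2 y -> `|h x y| <= C.

Let K (p : law_type l1 * law_type l2) : R :=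
  law_weight l1 p.1 * (law_weight l2 p.2 * h (law_var l1 p.1) (law_var l2 p.2)).

Let mK : measurable_fun setT K.
Proof.
apply: measurable_funM.
  exact: measurableT_comp (measurable_law_weight l1) measurable_fst.
apply: measurable_funM.
  exact: measurableT_comp (measurable_law_weight l2) measurable_snd.
apply: (measurable_fun2 mh).
  exact: measurableT_comp (measurable_law_var l1) measurable_fst.
exact: measurableT_comp (measurable_law_var l2) measurable_snd.
Qed.

Lemma bounded_test_section1 x : D1 x -> bounded_test D2 (h x).
Proof.
move=> Dx; split; first by apply: (measurable_fun2 mh).
by exists C => y Dy; exact: hC.
Qed.

Lemma ev_prod_integrable : (law_base l1 \x law_base l2)%E.-integrable setT (EFin \o K).
Proof.
apply/integrable12ltyP; first exact/measurable_EFinP.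
pose B (p : law_type l1 * law_type l2) :=
  ((`|C| * law_weight l1 p.1)%:E * (law_weight l2 p.2)%:E)%E.
have mw1 : measurable_fun setT (fun t => (law_weight l1 t)%:E).
  by apply/measurable_EFinP; exact: measurable_law_weight.
have mw2 : measurable_fun setT (fun t => (law_weight l2 t)%:E).
  by apply/measurable_EFinP; exact: measurable_law_weight.
have mB : measurable_fun setT B.
  apply: emeasurable_funM; last first.
    exact: measurableT_comp mw2 measurable_snd.
  apply/measurable_EFinP; apply: measurable_funM => //.
  exact: measurableT_comp (measurable_law_weight l1) measurable_fst.
have B0 p : (0 <= B p)%E by rewrite mule_ge0// lee_fin ?mulr_ge0 ?law_weight_ge0.
have KB p : (`|(EFin \o K) p| <= B p)%E.
  rewrite /B -EFinM /= lee_fin /K normrM (ger0_norm (law_weight_ge0 l1 _)).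
  have [->|w1] := eqVneq (law_weight l1 p.1) 0; first by rewrite !mul0r !mulr0 mul0r.
  rewrite (mulrC `|C|) -mulrA ler_wpM2l ?law_weight_ge0//.
  apply: (@ev_bound _ _ l2 (h (law_var l1 p.1)) `|C| p.2) => y Dy.
  by rewrite (le_trans _ (ler_norm C))//; apply: hC => //; exact: law_varP.
have mF1 := @measurable_fun_fubini_tonelli_F _ _ _ _ _ (law_base l2) (abse \o (EFin \o K))
  (measurableT_comp (@abse_measurable R _) ((measurable_EFinP _ _).2 mK)) (fun=> abse_ge0 _).
have mF2 := @measurable_fun_fubini_tonelli_F _ _ _ _ _ (law_base l2) B mB B0.
have le1 : (\int[law_base l1]_x \int[law_base l2]_y `|(EFin \o K) (x, y)| <=
    \int[law_base l1]_x \int[law_base l2]_y B (x, y))%E.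
  apply: ge0_le_integral => //.
  - by move=> x _; exact: integral_ge0.
  - move=> x _; apply: ge0_le_integral => //.
    + exact: (measurable_section x (measurableT_comp (@abse_measurable R _) ((measurable_EFinP _ _).2 mK))).
    + exact: (measurable_section x mB).
apply: le_lt_trans le1 _.
have I1 := integrable_law_weight l1; have I2 := integrable_law_weight l2.
have fin1 : (\int[law_base l1]_x (law_weight l1 x)%:E)%E \is a fin_num.
  exact: integrable_fin_num I1.
have fin2 : (\int[law_base l2]_x (law_weight l2 x)%:E)%E \is a fin_num.
  exact: integrable_fin_num I2.
rewrite (_ : (\int[_]_x _)%E = ((`|C|)%:E * (\int[law_base l1]_x (law_weight l1 x)%:E) *
    \int[law_base l2]_x (law_weight l2 x)%:E)%E).
  by rewrite -(fineK fin1) -(fineK fin2) -!EFinM ltry.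
have w10 t : setT t -> (0 <= (law_weight l1 t)%:E)%E by rewrite lee_fin law_weight_ge0.
have w20 t : setT t -> (0 <= (law_weight l2 t)%:E)%E by rewrite lee_fin law_weight_ge0.
have c0 : (0 <= (`|C|)%:E)%E by rewrite lee_fin.
rewrite -(ge0_integralZl _ measurableT mw1 w10 c0) -ge0_integralZr//.
- apply: eq_integral => x _; rewrite -(ge0_integralZl _ measurableT mw2 w20)//.
  by rewrite mule_ge0 ?w10.
- exact: measurable_funeM.
- by move=> x _; rewrite mule_ge0 ?w10.
- by apply: integral_ge0 => x _; exact: w20.
Qed.

Lemma EFin_ev_ev1 : (ev l1 (fun x => ev l2 (h x)))%:E =
  (\int[law_base l1]_x \int[law_base l2]_y (K (x, y))%:E)%E.
Proof.
have iF := integrable_fubini_F ev_prod_integrable.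
have inner x : (law_weight l1 x * ev l2 (h (law_var l1 x)))%:E =
    (\int[law_base l2]_y (K (x, y))%:E)%E.
  have [w0|w0] := eqVneq (law_weight l1 x) 0.
    rewrite w0 mul0r integral0_eq// => y _.
    by rewrite /K/= w0 mul0r.
  have t : bounded_test D2 (h (law_var l1 x)).
    by apply: bounded_test_section1; exact: law_varP.
  rewrite EFinM EFin_ev// -[LHS](integralZl measurableT (ev_integrable l2 t)).
  by apply: eq_integral => y _; rewrite -EFinM.
have E : (\int[law_base l1]_x (law_weight l1 x * ev l2 (h (law_var l1 x)))%:E =
    \int[law_base l1]_x \int[law_base l2]_y (K (x, y))%:E)%E.
  by congr integral; apply/funext => x; exact: inner.
rewrite -E -[X in X%:E]/(fine (\int[law_base l1]_x
  (law_weight l1 x * ev l2 (h (law_var l1 x)))%:E)) fineK// E.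
exact: integrable_fin_num iF.
Qed.

End ev_swap.

Lemma ev_swap (R : realType) (D1 D2 : set R) (l1 : law D1) (l2 : law D2)
    (h : R -> R -> R) (C : R) :
  measurable_fun setT (fun p : R * R => h p.1 p.2) ->
  (forall x y, D1 x -> D2 y -> `|h x y| <= C) ->
  ev l1 (fun x => ev l2 (h x)) = ev l2 (fun y => ev l1 (h ^~ y)).
Proof.
move=> mh hC; apply: EFin_inj; rewrite (EFin_ev_ev1 _ _ mh hC).
have mh' : measurable_fun setT (fun p : R * R => h p.2 p.1).
  by apply: (measurable_fun2 mh).
rewrite (@EFin_ev_ev1 _ _ _ l2 l1 (fun y x => h x y) C mh'); last first.
  by move=> y x Dy Dx; exact: hC.
rewrite (Fubini (ev_prod_integrable l1 l2 mh hC)).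
by apply: eq_integral => y _; apply: eq_integral => x _; rewrite /= mulrCA.
Qed.

(** * Squared norm of a shifted Gaussian vector *)

Section gauss_law.
Variables (R : realType) (n : nat) (c : R) (x : 'rV[R]_n).

Let mvar : measurable_fun setT (fun z : 'rV[R]_n => sqnorm (x + c *: z)).
Proof. by apply: measurable_sqnorm; exact: measurable_rowDZ. Qed.

Let intw : (row_lebesgue R n).-integrable setT (EFin \o @phi R n 1).
Proof.
apply/integrableP; split; first exact: measurable_phiE.
rewrite (_ : (\int[_]_z _)%E = 1%E) ?ltry// -(@integral_phi1 R n).
by apply: eq_integral => z _; rewrite gee0_abs// phiE_ge0.
Qed.

Definition gauss_law : law [set r : R | 0 <= r] :=
  @Law R _ _ _ (row_lebesgue R n) (@phi R n 1) (fun z => sqnorm (x + c *: z))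
  (measurable_phi 1 (@measurable_id _ _ _)) mvar (@phi_ge0 R n 1)
  (fun z _ => sqnorm_ge0 (x + c *: z)) intw.

Lemma heat_ev (h : R -> R) : bounded_test [set r : R | 0 <= r] h ->
  heat c (fun y => (h (sqnorm y))%:E) x = (ev gauss_law h)%:E.
Proof.
by move=> th; rewrite EFin_ev//; apply: eq_integral => z _; rewrite -EFinM.
Qed.

Lemma bounded_test_exp (A : R) : 0 <= A ->
  bounded_test [set r : R | 0 <= r] (fun r => expR (- A * r / 2)).
Proof.
move=> A0; apply: (@bounded_test_ge0 _ _ _ 1).
  apply: measurableT_comp => //; apply: measurable_funM => //.
move=> r /= r0; rewrite expR_ge0 -[leRHS]expR0 ler_expR mulNr mulNr oppr_le0.
by rewrite divr_ge0// mulr_ge0.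
Qed.

Lemma ev_gauss_exp (A : R) : 0 <= A ->
  ev gauss_law (fun r => expR (- A * r / 2)) = gauss_kernel n A c (sqnorm x).
Proof.
move=> A0; apply: EFin_inj; rewrite -heat_ev; last exact: bounded_test_exp.
rewrite -integral_gaussN; last by rewrite ltr_pwDl// mulr_ge0 ?sqr_ge0.
by apply: eq_integral => z _; rewrite -EFinM.
Qed.

End gauss_law.

(** One arbitrarily small increment, of either sign, is enough since the derivative is already known
    to exist; chords from the left and from the right will give the two opposite bounds. *)
Lemma derive_bound (R : realType) (g : R -> R) (A g' s : R) : is_derive A 1 g g' ->
  (forall e, 0 < e -> exists2 h, 0 < `|h| < e & s <= (g (h + A) - g A) / h) -> s <= g'.
Proof.
move=> [dg <-] H; apply/ler_addgt0Pr => e e0.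
have := dg; rewrite /derivable => /cvgrPdist_lt/(_ _ e0).
rewrite /at_right /nbhs/= => -[d /= d0 dP].
have [h /andP[h0 hd] sh] := H _ d0.
have := dP h; rewrite /= sub0r normrN hd => /(_ isT).
rewrite -normr_gt0 => /(_ h0).
rewrite -[lim _]/('D_1 g A) /= ltr_distl => /andP[+ _].
by rewrite /GRing.scale/= mulr1 mulrC; move: sh; lra.
Qed.

Section gauss_second_moment.
Variables (R : realType) (n : nat) (c : R) (x : 'rV[R]_n).
Notation sg := (c ^+ 2).
Notation r := (sqnorm x).

(** With [v = 1 / (1 + sg A)] the kernel is [sqrt(v)^n exp(- r A v / 2)]; the product and chain
    rules apply to this form. *)
Lemma is_derive_gauss_kernel (A : R) : 0 < 1 + sg * A ->
  is_derive A 1 (fun B => gauss_kernel n B c r)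
    (- (gauss_kernel n A c r * (n%:R * sg / (1 + sg * A) + r / (1 + sg * A) ^+ 2)) / 2).
Proof.
move=> k0; set u := 1 + sg * A in k0 *.
pose v (B : R) : R := (1 + sg * B)^-1.
have v0 : 0 < v A by rewrite invr_gt0.
have gE : (fun B => gauss_kernel n B c r) =
    ((Num.sqrt \o v) ^+ n) * (expR \o (fun B => (- r / 2) * (B * v B))).
  apply/funext => B; rewrite /gauss_kernel !fctE /= /v -exprVn.
  congr (_ ^+ n * expR _); last by rewrite invfM; ring.
  have [?|?] := leP 0 (1 + sg * B); first by rewrite sqrtrV.
  by rewrite !ler0_sqrtr ?invr0// ?invr_le0 ltW.
have du : is_derive A 1 (fun B : R => 1 + sg * B) sg.
  have -> : (fun B : R => 1 + sg * B) = cst 1 + sg \*: id by [].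
  by apply: is_derive_eq; rewrite add0r /GRing.scale/= mulr1.
have dv : is_derive A 1 v (- (u ^+ 2)^-1 * sg).
  have [d1 d2] := du.
  have u0 : (fun B : R => 1 + sg * B) A != 0 by rewrite gt_eqF.
  split; first exact: derivableV.
  by rewrite deriveV// d2.
have ds : is_derive A 1 (Num.sqrt \o v) ((2 * Num.sqrt (v A))^-1 * (- (u ^+ 2)^-1 * sg)).
  exact: is_derive1_comp (is_derive1_sqrt v0) dv.
have dX := is_deriveX n ds.
have di : is_derive A 1 (fun B => (- r / 2) * (B * v B))
    ((- r / 2) * (A * (- (u ^+ 2)^-1 * sg) + v A)).
  have -> : (fun B => (- r / 2) * (B * v B)) = (- r / 2) \*: (id * v) by [].
  by apply: is_derive_eq; rewrite /GRing.scale/= mulr1.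
have de := is_derive1_comp (is_derive_expR _) di.
have dM := is_deriveM dX de.
rewrite gE; apply: (is_derive_eq dM).
rewrite exprfctE /GRing.scale/= -/(v A).
have s0 : Num.sqrt (v A) != 0 by rewrite gt_eqF// sqrtr_gt0.
have uv : v A = u^-1 by [].
have un0 : u != 0 by rewrite gt_eqF.
have gA : gauss_kernel n A c r = Num.sqrt (v A) ^+ n * expR (- r / 2 * (A * v A)).
  by have := congr1 (fun f : R -> R => f A) gE; rewrite !fctE.
rewrite gA; set E := expR _.
have n0 : n%:R * Num.sqrt (v A) ^+ n.-1 * (2 * Num.sqrt (v A))^-1 =
    Num.sqrt (v A) ^+ n * n%:R / (2 * v A).
  have -> : v A = Num.sqrt (v A) ^+ 2 by rewrite sqr_sqrtr// ltW.
  rewrite !sqrtr_sqr (ger0_norm (sqrtr_ge0 _)).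
  case: n => [|m]; first by rewrite !mul0r mulr0 mul0r.
  by rewrite /= exprS; field.
rewrite (_ : n%:R * Num.sqrt (v A) ^+ n.-1 * _ = n%:R * Num.sqrt (v A) ^+ n.-1 *
  (2 * Num.sqrt (v A))^-1 * (- (u ^+ 2)^-1 * sg)); last by ring.
rewrite n0 uv.
have AE : 1 = u - sg * A by rewrite /u; ring.
have -> : A * (- (u ^+ 2)^-1 * sg) + u^-1 = (u ^+ 2)^-1.
  by rewrite -[RHS]mul1r {1}AE; field.
by field.
Qed.

Lemma bounded_test_id_exp (A : R) : 0 < A ->
  bounded_test [set r : R | 0 <= r] (fun r => r * expR (- A * r / 2)).
Proof.
move=> A0; apply: (@bounded_test_ge0 _ _ _ (2 / A)).
  apply: measurable_funM => //; apply: measurableT_comp => //.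
  by apply: measurable_funM.
move=> s /= s0; rewrite mulr_ge0 ?expR_ge0//=.
have := expR_ge1Dx (A * s / 2) => h.
rewrite !mulNr expRN ler_pdivrMr ?expR_gt0//.
rewrite (le_trans _ (ler_wpM2l _ h)) ?divr_ge0 ?(ltW A0)//.
rewrite (_ : 2 / A * (1 + A * s / 2) = 2 / A + s); last by field; rewrite gt_eqF.
by rewrite lerDr divr_ge0 ?ltW.
Qed.

(* Convexity of [A |-> e^(- A s / 2)] sandwiches the moment between difference
   quotients of the Gaussian kernel. *)
Lemma ev_gauss_id_exp (A : R) : 0 < A ->
  ev (gauss_law c x) (fun s => s * expR (- A * s / 2)) =
  gauss_kernel n A c r * (n%:R * sg / (1 + sg * A) + r / (1 + sg * A) ^+ 2).
Proof.
move=> A0; set S := ev _ _; set G := RHS.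
have k0 : 0 < 1 + sg * A by rewrite ltr_pwDl// mulr_ge0 ?sqr_ge0// ltW.
have dg := is_derive_gauss_kernel k0.
have tS := bounded_test_id_exp A0.
have chord h : - A < h -> h * (- S / 2) <=
    gauss_kernel n (h + A) c r - gauss_kernel n A c r.
  move=> hA; have hA0 : 0 <= h + A by lra.
  rewrite -!ev_gauss_exp ?(ltW A0)// -evB; try exact: bounded_test_exp; last exact/bounded_test_exp/ltW.
  rewrite (_ : h * (- S / 2) = (- h / 2) * S); last by ring.
  rewrite -evZ//; apply: le_ev.
  - exact: bounded_testZ.
  - by apply: bounded_testB; apply: bounded_test_exp => //; exact: ltW.
  - move=> s _ /=.
    have -> : - (h + A) * s / 2 = - A * s / 2 + (- h * s / 2) by field.
    rewrite expRD; have := expR_ge1Dx (- h * s / 2); have := expR_gt0 (- A * s / 2).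
    set e := expR (- A * s / 2); set e' := expR (- h * s / 2) => e0 he.
    have -> : - h / 2 * (s * e) = e * (- h * s / 2) by ring.
    have -> : e * e' - e = e * (e' - 1) by ring.
    by rewrite ler_pM2l//; lra.
apply/eqP; rewrite eq_le; apply/andP; split.
- have : S / 2 <= G / 2; last by lra.
  rewrite (_ : G / 2 = - (- G / 2)); last by ring.
  apply: (derive_bound (is_deriveN dg)) => e e0.
  pose h := - (Num.min e A / 2); have m0 : 0 < Num.min e A by rewrite lt_min e0.
  have me : Num.min e A <= e by rewrite ge_min lexx.
  have mA : Num.min e A <= A by rewrite ge_min lexx orbT.
  have hn : h < 0 by rewrite /h; lra.
  have hA : - A < h by rewrite /h; lra.
  exists h; first by rewrite ltr0_norm// /h; apply/andP; split; lra.
  have := chord _ hA; rewrite ler_ndivlMr// !fctE; lra.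
- have : - S / 2 <= - G / 2; last by lra.
  apply: (derive_bound dg) => e e0; exists (e / 2).
    by rewrite ger0_norm ?divr_ge0 ?ltW// divr_gt0//= ltr_pdivrMr// ltr_pMr// ltr1n.
  have h0 : 0 < e / 2 by rewrite divr_gt0.
  rewrite ler_pdivlMr// mulrC; apply: chord.
  by apply: lt_trans h0; rewrite oppr_lt0.
Qed.

End gauss_second_moment.

(** The power with exponent -1 is the inverse on nonnegative reals, hence the detour through [x^2];
    at 0 both sides vanish by convention. *)
Lemma measurable_invr (R : realType) : measurable_fun setT (fun x : R => x^-1).
Proof.
have -> : (fun x : R => x^-1) = (fun x => x * (x ^+ 2) `^ (- 1)).
  apply/funext => x; rewrite powR_inv1 ?sqr_ge0//.
  have [->|x0] := eqVneq x 0; first by rewrite invr0 mul0r.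
  by rewrite expr2 invfM mulVKf.
apply: measurable_funM => //.
by apply: (measurableT_comp (measurable_powR _)); exact: measurable_funX.
Qed.

Lemma measurable_sqrtr (R : realType) : measurable_fun setT (fun x : R => Num.sqrt x).
Proof. by apply: nondecreasing_measurable => // x y xy; exact: ler_wsqrtr. Qed.

Lemma measurable_gauss_kernel (R : realType) n (c r : R) :
  measurable_fun setT (fun u => gauss_kernel n u c r).
Proof.
have mu : measurable_fun setT (fun u : R => 1 + c ^+ 2 * u) by exact: measurable_funD.
apply: measurable_funM.
  apply: (measurableT_comp (@measurable_invr R)); apply: measurable_funX.
  exact: (measurableT_comp (@measurable_sqrtr R)).
apply: measurableT_comp => //; apply: measurable_funM.
  by apply: measurableT_comp => //; exact: measurable_funM.
apply: (measurableT_comp (@measurable_invr R)).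
exact: measurable_funM.
Qed.

(** * Convolution powers of a law and their moments *)

Section sum_law.
Variables (R : realType) (D1 D2 D : set R) (l1 : law D1) (l2 : law D2).
Hypothesis DD : forall x y, D1 x -> D2 y -> D (x + y).
Notation T := (law_type l1 * law_type l2)%type.

Let w (p : T) := law_weight l1 p.1 * law_weight l2 p.2.
Let X (p : T) := law_var l1 p.1 + law_var l2 p.2.

Let mw : measurable_fun setT w.
Proof.
apply: measurable_funM.
  exact: measurableT_comp (measurable_law_weight l1) measurable_fst.
exact: measurableT_comp (measurable_law_weight l2) measurable_snd.
Qed.

Let mX : measurable_fun setT X.
Proof.
apply: measurable_funD.
  exact: measurableT_comp (measurable_law_var l1) measurable_fst.
exact: measurableT_comp (measurable_law_var l2) measurable_snd.
Qed.

Let w0 p : 0 <= w p. Proof. by rewrite mulr_ge0 ?law_weight_ge0. Qed.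

Let wD p : w p != 0 -> D (X p).
Proof. by rewrite mulf_eq0 negb_or => /andP[? ?]; apply: DD; exact: law_varP. Qed.

Let iw : (sigma_finite_prod (law_base l1) (law_base l2)).-integrable setT (EFin \o w).
Proof.
have := @ev_prod_integrable R D1 D2 l1 l2 (fun _ _ => 1) 1 (measurable_cst _).
rewrite (_ : (EFin \o _) = EFin \o w); last first.
  by apply/funext => p; rewrite /= mulr1.
by apply => x y _ _; rewrite normr1.
Qed.

(** The convolution of the two laws, realised as the sum of independent variables on the product
    space. *)
Definition sum_law : law D := Law mw mX w0 wD iw.

Lemma ev_sum_law (h : R -> R) C : measurable_fun setT h -> (forall x, D x -> `|h x| <= C) ->
  ev sum_law h = ev l1 (fun x => ev l2 (fun y => h (x + y))).
Proof.
move=> mh hC.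
have mh2 : measurable_fun setT (fun p : R * R => h (p.1 + p.2)).
  by apply: (measurableT_comp mh); exact: measurable_funD.
have hC2 x y : D1 x -> D2 y -> `|h (x + y)| <= C by move=> ? ?; exact/hC/DD.
apply: EFin_inj; rewrite (@EFin_ev_ev1 _ _ _ _ _ (fun x y => h (x + y)) C mh2 hC2).
rewrite EFin_ev; last by split => //; exists C.
have I := ev_prod_integrable l1 l2 mh2 hC2.
rewrite (integral12_prod_meas1 I).
by apply: eq_integral => p _; rewrite /= mulrA.
Qed.

End sum_law.

Section zero_law.
Variable (R : realType) (D : set R) (D0 : D 0).

Let i0 : (@dirac _ 'rV[R]_0 0 R).-integrable setT (EFin \o (fun _ : 'rV[R]_0 => 1 : R)).
Proof. by apply: finite_measure_integrable_cst. Qed.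

Definition zero_law : law D := @Law R D _ 'rV[R]_0 (@dirac _ 'rV[R]_0 0 R)
  (fun=> 1) (fun=> 0) (measurable_cst _) (measurable_cst _) (fun=> ler01) (fun _ _ => D0) i0.

Lemma ev_zero_law h : ev zero_law h = h 0.
Proof.
by rewrite /ev /Rintegral integral_dirac//= indicE in_setT !mul1r.
Qed.

End zero_law.

Section pow_law.
Variables (R : realType) (B : R).
Hypothesis B0 : 0 <= B.
Notation seg b := [set u : R | 0 <= u <= b].
Variable l : law (seg B).

Lemma bounded_test_pow_exp b j (r : R) : 0 <= b ->
  bounded_test (seg b) (fun u => u ^+ j * expR (- u * r / 2)).
Proof.
move=> b0; apply: (@bounded_test_ge0 _ _ _ (b ^+ j * expR (b * `|r| / 2))).
  apply: measurable_funM => //; apply: measurableT_comp => //.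
  apply: measurable_funM => //; apply: measurable_funM => //.
move=> u /= /andP[u0 ub]; rewrite mulr_ge0 ?expR_ge0 ?exprn_ge0//=.
apply: ler_pM; rewrite ?exprn_ge0 ?expR_ge0//; first by rewrite lerXn2r ?nnegrE.
rewrite ler_expR ler_pM2r ?invr_gt0// (le_trans (ler_norm _))// normrM normrN.
by rewrite (ger0_norm u0) ler_wpM2r.
Qed.

Let segD k x y : seg B x -> seg (k%:R * B) y -> seg (k.+1%:R * B) (x + y).
Proof.
move=> /= /andP[x0 xB] /andP[y0 yB]; rewrite addr_ge0//=.
by rewrite -natr1 mulrDl mul1r addrC lerD.
Qed.

Let seg0 : seg (0%:R * B) 0. Proof. by rewrite /= mul0r lexx. Qed.

(** The [k]-fold convolution, whose Laplace transform is the [k]-th power of that of [l]. The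
    integrality of [2 / (1 - alpha)] is exploited here. *)
Fixpoint pow_law k : law (seg (k%:R * B)) :=
  match k with
  | 0%N => zero_law seg0
  | k'.+1 => sum_law l (pow_law k') (@segD k')
  end.

(** Formally [(-2 d/dr)^j] of the Laplace transform [mom 0]. *)
Definition mom j (r : R) := ev l (fun u => u ^+ j * expR (- u * r / 2)).

Lemma ev_pow_lawS k j r :
  ev (pow_law k.+1) (fun u => u ^+ j * expR (- u * r / 2)) =
  ev l (fun x => expR (- x * r / 2) *
    ev (pow_law k) (fun y => (x + y) ^+ j * expR (- y * r / 2))).
Proof.
have [m [C hC]] := @bounded_test_pow_exp (k.+1%:R * B) j r (mulr_ge0 (ler0n _ _) B0).
rewrite /= (ev_sum_law l (pow_law k) (@segD k) m hC); apply: eq_ev => x /= /andP[x0 xB].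
have kB0 : 0 <= k%:R * B by rewrite mulr_ge0.
rewrite -evZ; first by apply: eq_ev => y _; rewrite mulrCA -expRD; congr (_ * expR _); field.
apply: bounded_testM; last first.
  have := @bounded_test_pow_exp (k%:R * B) 0 r kB0.
  rewrite (_ : (fun u : R => u ^+ 0 * _) = fun u => expR (- u * r / 2))//.
  by apply/funext => u; rewrite expr0 mul1r.
apply: bounded_testX; apply: bounded_testD; first exact: bounded_test_cst.
by apply: (@bounded_test_ge0 _ _ _ (k%:R * B)).
Qed.

Let tk k j r : bounded_test (seg (k%:R * B)) (fun u => u ^+ j * expR (- u * r / 2)).
Proof. by apply: bounded_test_pow_exp; rewrite mulr_ge0. Qed.

Let tl j r : bounded_test (seg B) (fun u => u ^+ j * expR (- u * r / 2)).
Proof. exact: bounded_test_pow_exp. Qed.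

Lemma ev_pow_law0 k r :
  ev (pow_law k) (fun u => u ^+ 0 * expR (- u * r / 2)) = mom 0 r ^+ k.
Proof.
elim: k => [|k IH]; first by rewrite ev_zero_law expr0 mul1r oppr0 !mul0r expR0.
rewrite ev_pow_lawS exprS -IH /mom -evZr//.
by apply: eq_ev => x _; rewrite expr0 mul1r.
Qed.

(** This is [-2 d/dr] of [mom 0 r ^+ k], obtained without differentiation by splitting one summand
    off the convolution. The truncated [k.-1] is harmless because the factor [k] vanishes at 0. *)
Lemma ev_pow_law1 k r :
  ev (pow_law k) (fun u => u ^+ 1 * expR (- u * r / 2)) =
  k%:R * mom 0 r ^+ k.-1 * mom 1 r.
Proof.
elim: k => [|k IH]; first by rewrite ev_zero_law !mul0r.
rewrite ev_pow_lawS.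
have inner x : ev (pow_law k) (fun y => (x + y) ^+ 1 * expR (- y * r / 2)) =
    x * mom 0 r ^+ k + k%:R * mom 0 r ^+ k.-1 * mom 1 r.
  rewrite -IH -ev_pow_law0 -evZ// -evD//; last exact: bounded_testZ.
  by apply: eq_ev => y _; rewrite expr0; ring.
have -> : ev l (fun x => expR (- x * r / 2) * ev (pow_law k)
      (fun y => (x + y) ^+ 1 * expR (- y * r / 2))) =
    ev l (fun x => mom 0 r ^+ k * (x ^+ 1 * expR (- x * r / 2)) +
      (k%:R * mom 0 r ^+ k.-1 * mom 1 r) * (x ^+ 0 * expR (- x * r / 2))).
  by apply: eq_ev => x _; rewrite inner expr0 expr1; ring.
rewrite evD; [|exact: bounded_testZ|exact: bounded_testZ].
rewrite (evZ l _ (tl 1 r)) (evZ l _ (tl 0 r)).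
rewrite -/(mom 1 r) -/(mom 0 r) -natr1 /=.
by case: k {IH inner} => [|k]; rewrite ?mul0r ?expr0 /= ?exprS; ring.
Qed.

(** The second derivative of the same power, from expanding [(x + y)^2]; the factor [k (k - 1)]
    hides the truncation of [k.-2]. *)
Lemma ev_pow_law2 k r :
  ev (pow_law k) (fun u => u ^+ 2 * expR (- u * r / 2)) =
  k%:R * mom 0 r ^+ k.-1 * mom 2 r + k%:R * (k%:R - 1) * mom 0 r ^+ k.-2 * mom 1 r ^+ 2.
Proof.
elim: k => [|k IH]; first by rewrite ev_zero_law expr0n/= !mul0r addr0.
rewrite ev_pow_lawS.
set f2 := _ + _ in IH.
have inner x : ev (pow_law k) (fun y => (x + y) ^+ 2 * expR (- y * r / 2)) =
    x ^+ 2 * mom 0 r ^+ k + x * 2 * (k%:R * mom 0 r ^+ k.-1 * mom 1 r) + f2.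
  rewrite -IH -ev_pow_law0 -ev_pow_law1 -!evZ// -!evD//; try exact: bounded_testZ; last first.
    by apply: bounded_testD; exact: bounded_testZ.
  by apply: eq_ev => y _; rewrite expr0; ring.
have -> : ev l (fun x => expR (- x * r / 2) * ev (pow_law k)
      (fun y => (x + y) ^+ 2 * expR (- y * r / 2))) =
    ev l (fun x => mom 0 r ^+ k * (x ^+ 2 * expR (- x * r / 2)) +
      (2 * (k%:R * mom 0 r ^+ k.-1 * mom 1 r)) * (x ^+ 1 * expR (- x * r / 2)) +
      f2 * (x ^+ 0 * expR (- x * r / 2))).
  by apply: eq_ev => x _; rewrite inner expr0 expr1; ring.
rewrite !evD; try exact: bounded_testZ; last first.
  by apply: bounded_testD; exact: bounded_testZ.
rewrite (evZ l _ (tl 2 r)) (evZ l _ (tl 1 r)) (evZ l _ (tl 0 r)).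
rewrite -/(mom 2 r) -/(mom 1 r) -/(mom 0 r) /f2 -natr1 /=.
by case: k {IH inner f2} => [|[|k]]; rewrite ?mul0r ?expr0 /= ?exprS; ring.
Qed.

End pow_law.

(** * The radial law and the monotonicity of its moments *)

Section radial_law.
Variables (R : realType) (p : nat) (K : R).
Hypothesis K0 : 0 < K.
Notation seg b := [set u : R | 0 <= u <= b].
Notation leb := (@lebesgue_measure R).

Let w (x : R) : R := x ^+ p * \1_(`[0, K] : set R) x.

Let mw : measurable_fun setT w.
Proof. by apply: measurable_funM => //; exact: measurable_indic. Qed.

Let w0 x : 0 <= w x.
Proof.
rewrite /w indicE; have [/set_mem/=|] := boolP (_ \in _); last by rewrite mulr0.
by rewrite in_itv/= => /andP[x0 _]; rewrite mulr1 exprn_ge0.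
Qed.

Let wD x : w x != 0 -> seg (K ^+ 2) (x ^+ 2).
Proof.
rewrite /w indicE; have [/set_mem/=|] := boolP (_ \in _); last by rewrite mulr0 eqxx.
rewrite in_itv/= => /andP[x0 xK] _; rewrite sqr_ge0/= lerXn2r ?nnegrE//.
exact: ltW.
Qed.

Let iw : leb.-integrable setT (EFin \o w).
Proof.
rewrite (_ : EFin \o w = (EFin \o (fun x : R => x ^+ p)) \_ `[0, K]); last first.
  by rewrite restrict_EFin patch_indic.
apply: (integrable_mkcond _ _).1 => //.
apply: continuous_compact_integrable; first exact: segment_compact.
by apply: continuous_subspaceT; exact: exprn_continuous.
Qed.

(** Here [p] stands for [d - 3], and the variable is [eta^2], so that the Laplace transform is the
    function [m] of the overview. *)
Definition radial_law : law (seg (K ^+ 2)) :=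
  @Law R _ _ (measurableTypeR R) leb w (fun x => x ^+ 2) mw (@exprn_measurable R setT 2) w0 wD iw.

Lemma ev_radial (h : R -> R) : ev radial_law h =
  (\int[leb]_(x in `[0, K]) (x ^+ p * h (x ^+ 2)))%R.
Proof.
rewrite [RHS]Rintegral_mkcond; apply: eq_Rintegral => x _.
rewrite patchE /= /w indicE; case: ifP => _; last by rewrite mulr0 mul0r.
by rewrite mulr1.
Qed.

Definition radmom j r := mom radial_law j r.

Lemma radE j r : radmom j r = (\int[leb]_(x in `[0, K]) (x ^+ (p + j.*2) * expR (- x ^+ 2 * r / 2)))%R.
Proof.
rewrite /radmom /mom ev_radial; apply: eq_Rintegral => x _.
by rewrite exprD mulrA -mul2n exprM.
Qed.

(** The boundary term at [eta = K] in the integration by parts. *)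
Definition rad_edge r := K ^+ p.+1 * expR (- K ^+ 2 * r / 2).

Lemma cont_pow_exp q r : continuous (fun x : R => x ^+ q * expR (- x ^+ 2 * r / 2)).
Proof.
move=> x; apply: cvgM; first exact: exprn_continuous.
apply: (@continuous_comp _ _ _ (fun x : R => - x ^+ 2 * r / 2) expR); last exact: continuous_expR.
apply: cvgM; last exact: cvg_cst.
apply: cvgM; last exact: cvg_cst.
by apply: cvgN; exact: exprn_continuous.
Qed.

Lemma itv_integrable q r :
  leb.-integrable `[0, K] (EFin \o fun x : R => x ^+ q * expR (- x ^+ 2 * r / 2)).
Proof.
apply: continuous_compact_integrable; first exact: segment_compact.
by apply: continuous_subspaceT; exact: cont_pow_exp.
Qed.

Lemma itv_integrableZ a q r :
  leb.-integrable `[0, K] (EFin \o fun x : R => a * (x ^+ q * expR (- x ^+ 2 * r / 2))).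
Proof.
apply: continuous_compact_integrable; first exact: segment_compact.
apply: continuous_subspaceT => x.
by apply: cvgM; [exact: cvg_cst|exact: cont_pow_exp].
Qed.

Lemma is_derive_pow_exp q r (x : R) :
  is_derive x 1 (fun x : R => x ^+ q.+1 * expR (- x ^+ 2 * r / 2))
  (q.+1%:R * (x ^+ q * expR (- x ^+ 2 * r / 2)) - r * (x ^+ q.+2 * expR (- x ^+ 2 * r / 2))).
Proof.
have dX : is_derive x 1 (fun x : R => x ^+ q.+1) (q.+1%:R * x ^+ q).
  have := @is_deriveX _ _ (@id R) q.+1 x 1 1 (@is_derive_id _ _ _ _).
  by rewrite exprfctE /GRing.scale/= mulr1.
have d2 : is_derive x 1 (fun x : R => - x ^+ 2 * r / 2) (- x * r).
  have e : is_derive x 1 ((- r / 2) \*: (fun x : R => x ^+ 2)) ((- r / 2) *: (2 * x)).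
    apply: is_deriveZ; have := @is_deriveX _ _ (@id R) 2 x 1 1 (@is_derive_id _ _ _ _).
    by rewrite exprfctE /GRing.scale/= mulr1 expr1.
  have -> : (fun x : R => - x ^+ 2 * r / 2) = (- r / 2) \*: (fun x : R => x ^+ 2).
    by apply/funext => y; rewrite -[RHS]/(_ * _); ring.
  by apply: (is_derive_eq e); rewrite /GRing.scale/=; field.
have de := is_derive1_comp (is_derive_expR _) d2.
have dM := is_deriveM dX de.
by apply: (is_derive_eq dM); rewrite /GRing.scale/= !exprS; ring.
Qed.

(** The fundamental theorem applied to [eta^(q+1) exp(- eta^2 r / 2)] with [q = p + 2 j]; the
    contribution at [eta = 0] vanishes. *)
Lemma rad_rec j r :
  r * radmom j.+1 r = (p.+1 + j.*2)%:R * radmom j r - (K ^+ 2) ^+ j * rad_edge r.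
Proof.
set q := (p + j.*2)%N.
have F0 : continuous (fun x : R => x ^+ q.+1 * expR (- x ^+ 2 * r / 2)) by exact: cont_pow_exp.
have := @continuous_FTC2 R
  (fun x => q.+1%:R * (x ^+ q * expR (- x ^+ 2 * r / 2)) - r * (x ^+ q.+2 * expR (- x ^+ 2 * r / 2)))
  (fun x => x ^+ q.+1 * expR (- x ^+ 2 * r / 2)) 0 K K0.
move=> H.
have {}H : (\int[leb]_(x in `[0, K]) (q.+1%:R * (x ^+ q * expR (- x ^+ 2 * r / 2)) -
    r * (x ^+ q.+2 * expR (- x ^+ 2 * r / 2))))%R = K ^+ q.+1 * expR (- K ^+ 2 * r / 2).
  rewrite /Rintegral H; first by rewrite -EFinB/= expr0n/= mul0r subr0.
  - apply: continuous_subspaceT => x; apply: cvgB.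
      by apply: cvgM; [exact: cvg_cst|exact: cont_pow_exp].
    by apply: cvgM; [exact: cvg_cst|exact: cont_pow_exp].
  - split.
    + by move=> x _; have [] := is_derive_pow_exp q r x.
    + by apply: cvg_at_right_filter; exact: F0.
    + by apply: cvg_at_left_filter; exact: F0.
  - by move=> x _; rewrite derive1E; have [_ ->] := is_derive_pow_exp q r x.
move: H.
have i1 := itv_integrable q r; have i2 := itv_integrable q.+2 r.
have i1' := itv_integrableZ q.+1%:R q r; have i2' := itv_integrableZ r q.+2 r.
rewrite RintegralB// !RintegralZl// !radE (_ : (p + j.+1.*2)%N = q.+2); last first.
  by rewrite doubleS !addnS.
rewrite -/q /rad_edge -exprM mulrA -exprD mul2n => H.
rewrite addSn -/q (_ : (j.*2 + p.+1)%N = q.+1) ?[in RHS]addnC; last by rewrite addnS addnC.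
by rewrite addrC -H; ring.
Qed.

End radial_law.

Section rad_theory.
Variables (R : realType) (p : nat) (K : R).
Hypothesis K0 : 0 < K.
Notation B := (K ^+ 2).
Notation seg b := [set u : R | 0 <= u <= b].
Notation nneg := [set r : R | 0 <= r].
Notation rad := (radmom p K0).
Notation edge := (rad_edge p K).

Let B0 : 0 < B. Proof. by rewrite exprn_gt0. Qed.

Lemma bounded_test_rad j r : bounded_test (seg B) (fun u => u ^+ j * expR (- u * r / 2)).
Proof. by apply: bounded_test_pow_exp; exact: ltW. Qed.

Lemma rad_ge0 j r : 0 <= rad j r.
Proof. by apply: ev_ge0 => u /= /andP[u0 _]; rewrite mulr_ge0 ?exprn_ge0 ?expR_ge0. Qed.

Lemma edge_gt0 r : 0 < edge r.
Proof. by rewrite mulr_gt0 ?expR_gt0 ?exprn_gt0. Qed.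

Lemma rad_nonincreasing j : nonincreasing_fun (rad j).
Proof.
move=> r s rs; apply: le_ev; [exact: bounded_test_rad|exact: bounded_test_rad|].
move=> u /= /andP[u0 _]; rewrite ler_wpM2l ?exprn_ge0// ler_expR ler_pM2r ?invr_gt0//.
by rewrite ler_wnM2l// oppr_le0.
Qed.

Lemma radS_le j r : rad j.+1 r <= B * rad j r.
Proof.
rewrite -evZ; last exact: bounded_test_rad.
apply: le_ev; [exact: bounded_test_rad|exact/bounded_testZ/bounded_test_rad|].
move=> u /= /andP[u0 uB]; rewrite exprS -mulrA ler_wpM2r//.
by rewrite mulr_ge0 ?exprn_ge0 ?expR_ge0.
Qed.

(** Between [rad_rec] at [j], multiplied by [B], and at [j + 1] the edge terms cancel, leaving
    [r (B rad(j+1) - rad(j+2))], which is nonnegative. At [r = 0] this is an equality. *)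
Lemma radS_le_sharp j r : 0 <= r ->
  (p.+3 + j.*2)%:R * rad j.+1 r <= B * ((p.+1 + j.*2)%:R * rad j r).
Proof.
move=> r0; have h1 := rad_rec p K0 j r; have h2 := rad_rec p K0 j.+1 r.
have h3 : 0 <= r * (B * rad j.+1 r - rad j.+2 r).
  by rewrite mulr_ge0// subr_ge0 radS_le.
rewrite (_ : (p.+3 + j.*2)%N = (p.+1 + j.+1.*2)%N); last by rewrite doubleS !addnS !addSn.
rewrite exprS in h2.
have : B * ((p.+1 + j.*2)%:R * rad j r) - (p.+1 + j.+1.*2)%:R * rad j.+1 r =
    r * (B * rad j.+1 r - rad j.+2 r).
  rewrite [in RHS]mulrBr (mulrCA r B) h1 h2; ring.
by move=> E; rewrite -subr_ge0 E.
Qed.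

Lemma rad0_gt0 r : 0 <= r -> 0 < rad 0 r.
Proof.
move=> r0.
(* At [r = 0] the recursion reads [(p + 1) rad 0 0 = edge 0], which is positive; other [r] follow by
   comparing exponentials on the bounded support. *)
have h0 : 0 < rad 0 0.
  have := rad_rec p K0 0 0; rewrite mul0r addn0 expr0 mul1r => /eqP.
  rewrite eq_sym subr_eq add0r => /eqP h.
  rewrite -(@pmulr_rgt0 _ (p.+1%:R)) ?ltr0n// h; exact: edge_gt0.
apply: (@lt_le_trans _ _ (expR (- B * r / 2) * rad 0 0)).
  by rewrite mulr_gt0 ?expR_gt0.
rewrite -evZ; last exact: bounded_test_rad.
apply: le_ev; [exact/bounded_testZ/bounded_test_rad|exact: bounded_test_rad|].
move=> u /= /andP[u0 uB]; rewrite !expr0 !mul1r mulr0 mul0r expR0 mulr1.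
by rewrite ler_expR ler_pM2r ?invr_gt0// ler_wpM2r// lerN2.
Qed.

(** The edge sits at the largest value [B] of the variable, hence decays at the fastest rate in the
    mixture. *)
Lemma edge_rad0_le r s : r <= s -> edge s * rad 0 r <= edge r * rad 0 s.
Proof.
move=> rs; pose E := expR (B * (s - r) / 2).
have -> : edge r = edge s * E.
  by rewrite /rad_edge /E -[in RHS]mulrA -expRD; congr (_ * expR _); field.
rewrite -mulrA ler_pM2l ?edge_gt0// -evZ; last exact: bounded_test_rad.
apply: le_ev; [exact: bounded_test_rad|exact/bounded_testZ/bounded_test_rad|].
move=> u /= /andP[u0 uB]; rewrite !expr0 !mul1r /E -expRD ler_expR.
have : u * (s - r) <= B * (s - r) by rewrite ler_wpM2r// subr_ge0.
lra.
Qed.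

(** The ratio [rad 1 / rad 0] is the mean of the exponentially tilted law, which decreases as the
    tilt grows. *)
Lemma rad1_rad0_le r s : 0 <= r -> r <= s -> rad 1 s * rad 0 r <= rad 1 r * rad 0 s.
Proof.
move=> r0 rs; have m0 := rad0_gt0 (le_trans r0 rs).
(* As [t] is the tilted mean at [s], subtracting [E] times the average of [u - t] at [s] changes
   nothing and makes the integrand a product of two factors of equal sign. *)
pose t := rad 1 s / rad 0 s; pose E := expR (t * (s - r) / 2).
have tE : rad 1 s = t * rad 0 s by rewrite /t divfK// gt_eqF.
have key : 0 <= ev (radial_law p K0) (fun u => (u ^+ 1 * expR (- u * r / 2) - t * (u ^+ 0 * expR (- u * r / 2)))
    - E * (u ^+ 1 * expR (- u * s / 2) - t * (u ^+ 0 * expR (- u * s / 2)))).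
  apply: ev_ge0 => u /= /andP[u0 uB].
  have -> : expR (- u * r / 2) = expR (- u * s / 2) * expR (u * (s - r) / 2).
    by rewrite -expRD; congr expR; field.
  rewrite expr1 expr0 !mul1r (_ : _ - _ = expR (- u * s / 2) *
    ((u - t) * (expR (u * (s - r) / 2) - E))); last by ring.
  rewrite mulr_ge0 ?expR_ge0//.
  have [ut|ut] := leP t u.
    rewrite mulr_ge0 ?subr_ge0// ler_expR ler_pM2r ?invr_gt0// ler_wpM2r//.
    by rewrite subr_ge0.
  rewrite mulr_le0// ?subr_le0 ?(ltW ut)// ler_expR ler_pM2r ?invr_gt0// ler_wpM2r ?subr_ge0//.
  exact: ltW.
have T j q := @bounded_test_rad j q.
have TZ a j q := bounded_testZ a (T j q).
move: key; rewrite evB; [|by apply: bounded_testB|by apply: bounded_testZ; apply: bounded_testB].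
rewrite (evZ _ E (bounded_testB (T 1%N s) (TZ t 0%N s))).
rewrite (evB _ (T 1%N r) (TZ t 0%N r)) (evB _ (T 1%N s) (TZ t 0%N s)).
rewrite (evZ _ t (T 0%N r)) (evZ _ t (T 0%N s)).
rewrite -/(rad 1 r) -/(rad 0 r) -/(rad 1 s) -/(rad 0 s).
have -> : rad 1 s - t * rad 0 s = 0 by rewrite -tE subrr.
rewrite mulr0 subr0 subr_ge0 => h.
by rewrite {1}tE mulrAC ler_wpM2r// ltW.
Qed.

Lemma test_rad j : bounded_test nneg (rad j).
Proof.
apply: (@bounded_test_ge0 _ _ _ (rad j 0)).
  by apply: nonincreasing_measurable => //; exact: rad_nonincreasing.
by move=> r r0; rewrite rad_ge0 rad_nonincreasing.
Qed.

Lemma test_edge : bounded_test nneg edge.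
Proof. by apply: bounded_testZ; apply: bounded_test_exp; exact: ltW. Qed.

Lemma test_div_rad0 (g : R -> R) : measurable_fun setT g -> (forall r, 0 <= g r) ->
  (forall r s, 0 <= r -> r <= s -> g s * rad 0 r <= g r * rad 0 s) ->
  bounded_test nneg (fun r => g r / rad 0 r).
Proof.
move=> mg g0 gm; apply: (@bounded_test_ge0 _ _ _ (g 0 / rad 0 0)).
  apply: measurable_funM => //; apply: (measurableT_comp (@measurable_invr R)).
  by have [] := test_rad 0.
move=> r /= r0; rewrite divr_ge0 ?rad_ge0//=.
by rewrite ler_pdivrMr ?rad0_gt0// mulrAC ler_pdivlMr ?rad0_gt0// gm.
Qed.

Lemma div_rad0_nonincreasing (g : R -> R) r s :
  (forall r s, 0 <= r -> r <= s -> g s * rad 0 r <= g r * rad 0 s) ->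
  0 <= r -> r <= s -> g s / rad 0 s <= g r / rad 0 r.
Proof.
move=> gm r0 rs.
rewrite ler_pdivrMr ?rad0_gt0 ?(le_trans r0)// mulrAC ler_pdivlMr ?rad0_gt0//.
exact: gm.
Qed.

(* Both [edge / rad 0] and [rad 1 / rad 0] decrease, so Chebyshev's inequality applies. *)
Lemma ev_rad_chebyshev (G : law nneg) k :
  ev G (fun r => rad 0 r ^+ k.+1 * edge r) * ev G (fun r => rad 0 r ^+ k.+1 * rad 1 r) <=
  ev G (fun r => rad 0 r ^+ k.+2) * ev G (fun r => rad 0 r ^+ k * (edge r * rad 1 r)).
Proof.
have e2 r s : 0 <= r -> r <= s -> edge s * rad 0 r <= edge r * rad 0 s.
  by move=> _; exact: edge_rad0_le.
have n2 := rad1_rad0_le.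
have te : bounded_test nneg (fun r => edge r / rad 0 r).
  apply: test_div_rad0 => //; last by move=> r; exact/ltW/edge_gt0.
  by have [] := test_edge.
have tn : bounded_test nneg (fun r => rad 1 r / rad 0 r).
  apply: test_div_rad0 => //; last by move=> r; exact: rad_ge0.
  by have [] := test_rad 1.
have tp := bounded_testX k.+2 (test_rad 0).
have := @ev_chebyshev _ _ G _ _ _ tp te tn.
rewrite (@eq_ev _ _ G (fun r => rad 0 r ^+ k.+2 * (edge r / rad 0 r))
  (fun r => rad 0 r ^+ k.+1 * edge r)); last first.
  by move=> r r0; rewrite exprS; field; rewrite gt_eqF// rad0_gt0.
rewrite (@eq_ev _ _ G (fun r => rad 0 r ^+ k.+2 * (rad 1 r / rad 0 r))
  (fun r => rad 0 r ^+ k.+1 * rad 1 r)); last first.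
  by move=> r r0; rewrite exprS; field; rewrite gt_eqF// rad0_gt0.
rewrite (@eq_ev _ _ G (fun r => rad 0 r ^+ k.+2 * (edge r / rad 0 r * (rad 1 r / rad 0 r)))
  (fun r => rad 0 r ^+ k * (edge r * rad 1 r))); last first.
  by move=> r r0; rewrite !exprS; field; rewrite gt_eqF// rad0_gt0.
apply; first by move=> r _; rewrite exprn_ge0 ?rad_ge0.
move=> r s /= r0 s0; have [rs|/ltW sr] := leP r s.
  by rewrite mulr_ge0// subr_ge0; apply: div_rad0_nonincreasing.
by rewrite mulr_le0// subr_le0; apply: div_rad0_nonincreasing.
Qed.

End rad_theory.

(** * The superharmonicity inequality *)

Section kernel_bounds.
Variables (R : realType) (n : nat) (c r : R).
Notation sg := (c ^+ 2).
Hypothesis r0 : 0 <= r.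

Let sg0 : 0 <= sg. Proof. exact: sqr_ge0. Qed.

Lemma kernel_den_ge1 (u : R) : 0 <= u -> 1 <= 1 + sg * u.
Proof. by move=> u0; rewrite lerDl mulr_ge0. Qed.

Lemma gauss_kernel_ge0 (u : R) : 0 <= gauss_kernel n u c r.
Proof. by rewrite mulr_ge0 ?expR_ge0// invr_ge0 exprn_ge0// sqrtr_ge0. Qed.

Lemma gauss_kernel_le1 (u : R) : 0 <= u -> gauss_kernel n u c r <= 1.
Proof.
move=> u0; have k1 := kernel_den_ge1 u0.
rewrite -[leRHS]mul1r; apply: ler_pM; rewrite ?expR_ge0 ?invr_ge0 ?exprn_ge0 ?sqrtr_ge0//.
  rewrite invf_le1 ?exprn_ege1 ?exprn_gt0 ?sqrtr_gt0 ?(lt_le_trans ltr01)//.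
  by rewrite -[leLHS]sqrtr1 ler_wsqrtr.
rewrite -[leRHS]expR0 ler_expR mulNr oppr_le0 divr_ge0 ?mulr_ge0//.
by rewrite (le_trans ler01).
Qed.

Lemma test_gauss_kernel b : bounded_test [set u : R | 0 <= u <= b] (fun u => gauss_kernel n u c r).
Proof.
apply: (@bounded_test_ge0 _ _ _ 1); first exact: measurable_gauss_kernel.
by move=> u /= /andP[u0 _]; rewrite gauss_kernel_ge0 gauss_kernel_le1.
Qed.

(** The gradient in [x] of the kernel with parameter [u] is [- damped u] times the kernel times
    [x]. *)
Definition damped (u : R) : R := u / (1 + sg * u).

Lemma damped_ge0 u : 0 <= u -> 0 <= damped u.
Proof. by move=> u0; rewrite divr_ge0// (le_trans ler01)// kernel_den_ge1. Qed.

Lemma damped_le u : 0 <= u -> damped u <= u.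
Proof.
move=> u0; have k1 := kernel_den_ge1 u0.
by rewrite ler_pdivrMr ?(lt_le_trans ltr01)// ler_peMr.
Qed.

Lemma test_damped b : bounded_test [set u : R | 0 <= u <= b] damped.
Proof.
apply: (@bounded_test_ge0 _ _ _ b).
  apply: measurable_funM => //; apply: (measurableT_comp (@measurable_invr R)).
  exact: measurable_funD.
by move=> u /= /andP[u0 ub]; rewrite damped_ge0// (le_trans (damped_le u0)).
Qed.

Lemma test_id b : bounded_test [set u : R | 0 <= u <= b] (fun u => u).
Proof. exact: (@bounded_test_ge0 _ _ _ b). Qed.

End kernel_bounds.

(** With [X = (k-1) D F - k E] and [Y = D F - E], Chebyshev gives [F L <= T X <= (k-1) T Y]. For
    [L > 0] the first recursion gives [k Y <= r F1]. Smallness then turns [T <= (1 + sg q) F1] into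
    [2 (k-1) T <= (2k-1) F1], and multiplying the bounds concludes. *)
Lemma superharmonic_algebra (R : realType) (k D B sg q r F F1 L T E E2 : R) :
  2 <= k -> 0 <= r -> 0 <= sg -> 0 <= F -> 0 <= F1 -> 0 <= T -> 0 <= E ->
  E2 <= B * E -> E * T <= k * (F * E2) ->
  L = (k - 1) * D * T - k * (B * E + (k - 1) * E2) ->
  r * F1 - sg * L = k * (D * F - E) ->
  T <= (1 + sg * q) * F1 -> sg * q * (2 * (k - 1)) <= 1 ->
  2 * (F * L) <= (2 * k - 1) / k * (r * F1 ^+ 2).
Proof.
move=> k2 r0 sg0 F0 F10 T0 E0 E2E cheb LE GR1 F1_ge small.
have k0 : 0 < k by lra.
have c0 : 0 <= (2 * k - 1) / k by rewrite divr_ge0 ?(ltW k0)//; lra.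
have rhs0 : 0 <= (2 * k - 1) / k * (r * F1 ^+ 2).
  exact: mulr_ge0 c0 (mulr_ge0 r0 (sqr_ge0 _)).
(* For [L <= 0] the left side is nonpositive; positivity of [L] is what allows the term [sg L] to be
   dropped below. *)
have [L0|L0] := leP L 0.
  by apply: le_trans rhs0; rewrite mulr_ge0_le0// mulr_ge0_le0.
have [F00|Fn0] := eqVneq F 0; first by rewrite F00 mul0r mulr0.
have {Fn0}Fp : 0 < F by rewrite lt0r Fn0.
pose X := (k - 1) * (D * F) - k * E.
have FL : F * L <= T * X.
  rewrite LE /X.
  have : k * F * (k * E2) <= k * F * (B * E + (k - 1) * E2).
    by apply: ler_wpM2l; [exact: mulr_ge0 (ltW k0) F0|lra].
  have : k * (E * T) <= k * (k * (F * E2)) by rewrite ler_pM2l.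
  lra.
have Xp : 0 < X.
  have : 0 < T * X by apply: lt_le_trans FL; rewrite mulr_gt0.
  have [//|X0] := ltP 0 X.
  by rewrite ltNge mulr_ge0_le0.
pose Y := D * F - E.
have XY : X <= (k - 1) * Y by rewrite /X /Y; lra.
have rF1 : k * Y <= r * F1.
  have h : r * F1 - sg * L = k * Y by [].
  have : 0 <= sg * L by rewrite mulr_ge0// ltW.
  lra.
have Y0 : 0 <= Y.
  have : 0 < (k - 1) * Y by exact: lt_le_trans XY.
  by rewrite pmulr_rgt0; [exact: ltW|lra].
have step1 : (2 * k - 1) * (F1 * Y) <= (2 * k - 1) / k * (r * F1 ^+ 2).
  rewrite -[leRHS]mulrA; apply: ler_wpM2l; first by lra.
  rewrite ler_pdivlMl//.
  have -> : r * F1 ^+ 2 = F1 * (r * F1) by ring.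
  by rewrite mulrCA; apply: ler_wpM2l.
apply: le_trans step1.
(* Exactly here [2 (k-1) (1 + sg q) <= 2 (k-1) + 1] is spent. *)
have step2 : 2 * (k - 1) * T <= (2 * k - 1) * F1.
  have : 2 * (k - 1) * T <= 2 * (k - 1) * ((1 + sg * q) * F1).
    by apply: ler_wpM2l => //; lra.
  have : sg * q * (2 * (k - 1)) * F1 <= 1 * F1 by apply: ler_wpM2r.
  lra.
have : 2 * (k - 1) * T * Y <= (2 * k - 1) * F1 * Y by apply: ler_wpM2r.
have : T * X <= T * ((k - 1) * Y) by apply: ler_wpM2l.
lra.
Qed.

Section superharmonic.
Variables (R : realType) (p k : nat) (K c : R) (x : 'rV[R]_p.+3).
Hypothesis K0 : 0 < K.
Notation B := (K ^+ 2).
Notation sg := (c ^+ 2).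
Notation r := (sqnorm x).
Notation d := (p.+3%:R).
Notation kk := (k.+2%:R).
Notation seg b := [set u : R | 0 <= u <= b].
Notation nneg := [set s : R | 0 <= s].
Notation rad := (radmom p K0).
Notation edge := (rad_edge p K).
Notation l := (radial_law p K0).
Notation mix := (pow_law l k.+2).
Notation G := (gauss_law c x).
Notation Gk := (fun u => gauss_kernel p.+3 u c r).
Notation a := (damped c).

Let B0 : 0 <= B. Proof. exact: sqr_ge0. Qed.
Let b0 : 0 <= kk * B. Proof. by rewrite mulr_ge0. Qed.
Let r0 : 0 <= r. Proof. exact: sqnorm_ge0. Qed.
Let sg0 : 0 <= sg. Proof. exact: sqr_ge0. Qed.

Let tGk : bounded_test (seg (kk * B)) Gk. Proof. exact: test_gauss_kernel. Qed.
Let ta : bounded_test (seg (kk * B)) a. Proof. exact: test_damped. Qed.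
Let tid : bounded_test (seg (kk * B)) (fun u => u). Proof. exact: test_id. Qed.

Lemma measurable_exp_prod :
  measurable_fun setT (fun q : R * R => expR (- q.2 * q.1 / 2)).
Proof.
apply: measurableT_comp => //; apply: measurable_funM => //.
by apply: measurable_funM => //; apply: measurableT_comp.
Qed.

Lemma ev_gauss_pow_law j :
  ev G (fun s => ev mix (fun u => u ^+ j * expR (- u * s / 2))) =
  ev mix (fun u => u ^+ j * Gk u).
Proof.
rewrite (@ev_swap _ _ _ G mix (fun s u => u ^+ j * expR (- u * s / 2)) ((kk * B) ^+ j)).
- apply: eq_ev => u /= /andP[u0 _].
  by rewrite evZ ?ev_gauss_exp//; exact: bounded_test_exp.
- apply: measurable_funM; first by apply: measurable_funX.
  exact: measurable_exp_prod.
- move=> s u /= s0 /andP[u0 ub]; rewrite normrM !ger0_norm ?exprn_ge0 ?expR_ge0//.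
  rewrite -[leRHS]mulr1 ler_pM ?exprn_ge0 ?expR_ge0//.
    by rewrite lerXn2r ?nnegrE// (le_trans u0).
  by rewrite -[leRHS]expR0 ler_expR mulNr mulNr oppr_le0 divr_ge0 ?mulr_ge0.
Qed.

(** The power [j.+1] supplies a factor [u] that keeps [u s exp(- u s / 2)] below 2, although [s] is
    unbounded, so that the averages may be swapped. *)
Lemma ev_gauss_pow_law_id j :
  ev G (fun s => s * ev mix (fun u => u ^+ j.+1 * expR (- u * s / 2))) =
  ev mix (fun u => u ^+ j.+1 * (Gk u *
    (d * sg / (1 + sg * u) + r / (1 + sg * u) ^+ 2))).
Proof.
transitivity (ev G (fun s => ev mix (fun u => u ^+ j.+1 * (s * expR (- u * s / 2))))).
  apply: eq_ev => s _; rewrite -evZ; last exact: bounded_test_pow_exp.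
  by apply: eq_ev => u _; rewrite mulrCA.
rewrite (@ev_swap _ _ _ G mix (fun s u => u ^+ j.+1 * (s * expR (- u * s / 2)))
  ((kk * B) ^+ j * 2)).
- apply: eq_ev => u /= /andP[u0 _].
  (* The moment formula [ev_gauss_id_exp] needs a positive parameter; at [u = 0] both sides
     vanish. *)
  have [->|un0] := eqVneq u 0.
    rewrite exprS !mul0r; transitivity (ev G (fun=> 0 * 0)); last first.
      by rewrite evZ ?mul0r//; exact: bounded_test_cst.
    by apply: eq_ev => s _; rewrite !mul0r.
  have up : 0 < u by rewrite lt0r un0.
  by rewrite evZ ?ev_gauss_id_exp//; exact: bounded_test_id_exp.
- apply: measurable_funM; first by apply: measurable_funX.
  by apply: measurable_funM => //; exact: measurable_exp_prod.
- move=> s u /= s0 /andP[u0 ub].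
  rewrite ger0_norm; last by rewrite !mulr_ge0 ?exprn_ge0 ?expR_ge0.
  rewrite exprSr -mulrA ler_pM ?exprn_ge0 ?mulr_ge0 ?expR_ge0//.
    by rewrite lerXn2r ?nnegrE// (le_trans u0).
  have := expR_ge1Dx (u * s / 2).
  rewrite !mulNr expRN mulrA ler_pdivrMr ?expR_gt0//; lra.
Qed.

Let m := rad 0.
Let n := rad 1.
Let n2 := rad 2.

Let f0E s : ev mix (fun u => u ^+ 0 * expR (- u * s / 2)) = m s ^+ k.+2.
Proof. exact: ev_pow_law0. Qed.
Let f1E s : ev mix (fun u => u ^+ 1 * expR (- u * s / 2)) = kk * m s ^+ k.+1 * n s.
Proof. exact: ev_pow_law1. Qed.
Let f2E s : ev mix (fun u => u ^+ 2 * expR (- u * s / 2)) =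
  kk * m s ^+ k.+1 * n2 s + kk * (kk - 1) * m s ^+ k * n s ^+ 2.
Proof. exact: ev_pow_law2. Qed.

Let tm : bounded_test nneg m. Proof. exact: test_rad. Qed.
Let tn : bounded_test nneg n. Proof. exact: test_rad. Qed.
Let tn2 : bounded_test nneg n2. Proof. exact: test_rad. Qed.
Let te : bounded_test nneg edge. Proof. exact: test_edge. Qed.

Definition mixF := ev mix Gk.
Definition mixF1 := ev mix (fun u => Gk u * a u).
Definition mixL := ev mix (fun u => Gk u * (r * a u ^+ 2 - d * a u)).

Let F := mixF.
Let F1 := mixF1.
Let L := mixL.
Let T := ev mix (fun u => u ^+ 1 * Gk u).
Let T2 := ev mix (fun u => u ^+ 2 * Gk u).
Let E := ev G (fun s => m s ^+ k.+1 * edge s).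
Let E2 := ev G (fun s => m s ^+ k * (edge s * n s)).

Lemma mixFE : F = ev G (fun s => m s ^+ k.+2).
Proof.
transitivity (ev mix (fun u => u ^+ 0 * Gk u)).
  by apply: eq_ev => u _; rewrite expr0 mul1r.
by rewrite -ev_gauss_pow_law; apply: eq_ev => s _; rewrite f0E.
Qed.

Let TE : T = kk * ev G (fun s => m s ^+ k.+1 * n s).
Proof.
rewrite /T -ev_gauss_pow_law -evZ; last by btest.
by apply: eq_ev => s _; rewrite f1E mulrA.
Qed.

Let dE u : 0 <= u -> 1 + sg * u != 0.
Proof. by move=> u0; rewrite gt_eqF// (lt_le_trans ltr01)// kernel_den_ge1. Qed.

(** Both sides evaluate the Gaussian average of [s] times the first moment: the left through the
    moment of the kernel, the right through the integration by parts [rad_rec] at [j = 0]. *)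
Let GR1 : r * F1 - sg * L = kk * (p.+1%:R * F - E).
Proof.
have <- : ev G (fun s => s * ev mix (fun u => u ^+ 1 * expR (- u * s / 2))) =
    kk * (p.+1%:R * F - E).
  rewrite mixFE /E -evZ; last by btest.
  rewrite -evB; [|by btest|by btest]; rewrite -evZ; last by btest.
  apply: eq_ev => s _; rewrite f1E.
  have := rad_rec p K0 0 s; rewrite addn0 expr0 mul1r -/n -/m => h.
  rewrite (_ : s * _ = kk * m s ^+ k.+1 * (s * n s)); last by ring.
  by rewrite h [m s ^+ k.+2]exprS; ring.
rewrite ev_gauss_pow_law_id /F1 /L /mixF1 /mixL -evZ; last by btest.
rewrite -evZ; last by btest.
rewrite -evB; [|by btest|by btest].
by apply: eq_ev => u /= /andP[u0 _]; rewrite /damped; field; exact: dE.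
Qed.

(** The same double evaluation with the second moment, using [rad_rec] at [j = 0] and [j = 1]; the
    kernel side equals [L + d T]. *)
Let LE : L = (kk - 1) * p.+1%:R * T - kk * (B * E + (kk - 1) * E2).
Proof.
have h2 : ev G (fun s => s * ev mix (fun u => u ^+ 2 * expR (- u * s / 2))) = L + d * T.
  rewrite ev_gauss_pow_law_id /L /mixL /T -evZ; last by btest.
  rewrite -evD; [|by btest|by btest].
  by apply: eq_ev => u /= /andP[u0 _]; rewrite /damped; field; exact: dE.
have : L + d * T = d * T + (kk - 1) * p.+1%:R * T - kk * (B * E + (kk - 1) * E2); last by lra.
rewrite -h2 TE /E /E2.
have tmn : bounded_test nneg (fun s => m s ^+ k.+1 * n s) by btest.
have tme : bounded_test nneg (fun s => m s ^+ k.+1 * edge s) by btest.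
have tmen : bounded_test nneg (fun s => m s ^+ k * (edge s * n s)) by btest.
transitivity (ev G (fun s => (d + (kk - 1) * p.+1%:R) * kk * (m s ^+ k.+1 * n s)
   - (kk * B * (m s ^+ k.+1 * edge s) + kk * (kk - 1) * (m s ^+ k * (edge s * n s))))).
  apply: eq_ev => s _; rewrite f2E.
  have := rad_rec p K0 0 s; rewrite addn0 expr0 mul1r -/n -/m => h.
  have := rad_rec p K0 1 s; rewrite addn2 expr1 -/n -/n2 => h'.
  have -> : s * (kk * m s ^+ k.+1 * n2 s + kk * (kk - 1) * m s ^+ k * n s ^+ 2) =
     kk * m s ^+ k.+1 * (s * n2 s) + kk * (kk - 1) * m s ^+ k * n s * (s * n s) by ring.
  rewrite h h' !exprS; ring.
rewrite evB; [|by btest|by btest].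
rewrite evD; [|by btest|by btest].
rewrite (evZ G _ tmn) (evZ G _ tme) (evZ G _ tmen); ring.
Qed.


Let tf1 : bounded_test nneg (fun s => ev mix (fun u => u ^+ 1 * expR (- u * s / 2))).
Proof. by have -> := funext f1E; btest. Qed.

Let tf2 : bounded_test nneg (fun s => ev mix (fun u => u ^+ 2 * expR (- u * s / 2))).
Proof. by have -> := funext f2E; btest. Qed.

(** With [t = B d / (d + 2)], both ratios [n2 / n] and [n / m] are at most [t], and the two terms of
    the second moment then add up to [kk t] times the first moment. *)
Let T2_le : T2 <= kk * B * d / (d + 2) * T.
Proof.
rewrite /T2 /T -!ev_gauss_pow_law -evZ.
  apply: le_ev.
  - exact: tf2.
  - exact: bounded_testZ.
  - move=> s /= s0; rewrite f1E f2E.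
    have d0 : 0 < d :> R by rewrite ltr0n.
    have h1 := radS_le_sharp p K0 1 s0; rewrite addn2 -/n -/n2 in h1.
    have h0 := radS_le_sharp p K0 0 s0; rewrite !addn0 -/n -/m in h0.
    rewrite addn2 (_ : p.+3.+2%:R = d + 2 :> R) in h1; last by rewrite -[p.+3.+2]addn2 natrD.
    have m0 : 0 <= m s by exact: rad_ge0.
    have n0 : 0 <= n s by exact: rad_ge0.
    pose t := B * d / (d + 2).
    have d2 : 0 < d + 2 :> R by rewrite addr_gt0.
    have h1' : n2 s <= t * n s.
      by rewrite /t mulrAC ler_pdivlMr// mulrC (le_trans h1)// mulrA.
    have h0' : n s <= t * m s.
      rewrite /t mulrAC ler_pdivlMr// mulrC.
      (* The sharp ratio is [(d - 2) / d], and it is below [d / (d + 2)] since [d^2 - 4 <= d^2]. *)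
      have h2 : d * ((d + 2) * n s) <= d * (B * d * m s).
        have : (d + 2) * (d * n s) <= (d + 2) * (B * (p.+1%:R * m s)) by rewrite ler_pM2l.
        have -> : (p.+1%:R : R) = d - 2 by rewrite -[p.+3]addn2 natrD addrK.
        have : 0 <= B * m s by rewrite mulr_ge0.
        nra.
      by rewrite ler_pM2l in h2.
    have -> : kk * B * d / (d + 2) * (kk * m s ^+ k.+1 * n s) =
       kk * m s ^+ k.+1 * (t * n s) + kk * (kk - 1) * m s ^+ k * n s * (t * m s).
      by rewrite [m s ^+ k.+1]exprS /t; ring.
    have mk : 0 <= m s ^+ k by rewrite exprn_ge0.
    have mk1 : 0 <= m s ^+ k.+1 by rewrite exprn_ge0.
    have k1 : 0 <= kk - 1 :> R by rewrite subr_ge0 ler1n.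
    rewrite [n s ^+ 2]expr2 [X in _ + X <= _]mulrA.
    by apply: lerD; rewrite ler_wpM2l ?mulr_ge0.
exact: tf1.
Qed.

(** The convex map [u |-> 1 / (1 + sg u)] lies above its tangent at [q]; multiplied by [u] and
    averaged, the bound closes by [T2 <= q T]. *)
Let F1_ge : T <= (1 + sg * (kk * B * d / (d + 2))) * F1.
Proof.
set q := kk * B * d / (d + 2).
have q0 : 0 <= q by exact: divr_ge0 (mulr_ge0 b0 (ler0n _ _)) (addr_ge0 (ler0n _ _) (ler0n _ 2)).
have z1 : 0 < 1 + sg * q by rewrite ltr_pwDl// mulr_ge0.
have T0 : 0 <= T.
  by apply: ev_ge0 => u /= /andP[u0 _]; rewrite mulr_ge0 ?gauss_kernel_ge0 ?exprn_ge0.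
have h : (1 + 2 * (sg * q)) * T - sg * T2 <= (1 + sg * q) ^+ 2 * F1.
  rewrite /T /T2 /F1 /mixF1 -!evZ; try by btest.
  rewrite -evB; [|by btest|by btest].
  apply: le_ev; [by btest|by btest|].
  move=> u /= /andP[u0 _]; have G0 := gauss_kernel_ge0 p.+3 c r u.
  rewrite (_ : _ - _ = Gk u * ((1 + 2 * (sg * q)) * u - sg * u ^+ 2)); last by ring.
  rewrite [leRHS]mulrCA; apply: ler_wpM2l => //.
  rewrite /damped [leRHS]mulrA ler_pdivlMr; last first.
    by rewrite (lt_le_trans ltr01)// kernel_den_ge1.
  (* The tangent defect, with the denominator cleared, is an explicit square. *)
  rewrite -subr_ge0 (_ : _ - _ = u * (sg * (u - q)) ^+ 2); last by ring.
  by rewrite mulr_ge0 ?sqr_ge0.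
have : sg * T2 <= sg * (q * T) by rewrite ler_wpM2l.
move=> h'; rewrite -(ler_pM2l z1); nra.
Qed.

Lemma mixF_ge0 : 0 <= F.
Proof. by apply: ev_ge0 => u _; exact: gauss_kernel_ge0. Qed.

(* The superharmonicity of [F ^ (1 / (2 k))], where [F] is the heat flow of
   [rad 0 ^ k]: [mixL] is the Laplacian of [F], and [- mixF1 x] its gradient. *)
Lemma mix_superharmonic : sg * (kk * B * d / (d + 2)) * (2 * (kk - 1)) <= 1 ->
  2 * (F * L) <= (2 * kk - 1) / kk * (r * F1 ^+ 2).
Proof.
move=> small.
have kk2 : 2 <= kk :> R by rewrite ler_nat.
have F0 := mixF_ge0.
have kk0 : 0 < kk :> R by rewrite ltr0n.
have T0 : 0 <= T.
  by apply: ev_ge0 => u /= /andP[u0 _]; rewrite mulr_ge0 ?gauss_kernel_ge0 ?exprn_ge0.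
have m0 s : 0 <= m s by exact: rad_ge0.
have n0 s : 0 <= n s by exact: rad_ge0.
have e0 s : 0 <= edge s by exact/ltW/edge_gt0.
have E2E : E2 <= B * E.
  rewrite /E2 /E -evZ; last by btest.
  apply: le_ev; [by btest|by btest|move=> s _].
  rewrite [m s ^+ k.+1]exprS (_ : B * _ = m s ^+ k * (edge s * (B * m s))); last by ring.
  by rewrite !ler_wpM2l ?exprn_ge0//; exact: radS_le.
have cheb : E * T <= kk * (F * E2).
  by rewrite TE mixFE mulrCA ler_pM2l//; exact: ev_rad_chebyshev.
apply: (superharmonic_algebra kk2 r0 sg0 F0 _ T0 _ E2E cheb LE GR1 F1_ge small).
- by apply: ev_ge0 => u /= /andP[u0 _]; rewrite mulr_ge0 ?gauss_kernel_ge0 ?damped_ge0.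
- by apply: ev_ge0 => s _; rewrite mulr_ge0 ?exprn_ge0.
Qed.

End superharmonic.

(** * Elementary inequalities and one-step kernel bounds *)

Section elementary.
Variable R : realType.
Implicit Types x y z q : R.

Lemma expR_le_quad y c : `|y| <= c -> expR y <= 1 + y + c ^+ 2 * expR c.
Proof.
move=> yc; have c0 : 0 <= c by exact: le_trans yc.
have e1 z : expR z <= 1 + z * expR z.
  have := expR_ge1Dx (- z); rewrite -(ler_pM2r (expR_gt0 z)) -expRD addNr expR0; lra.
have [y0|y0] := leP 0 y.
  have yc' : y <= c by rewrite -(ger0_norm y0).
  have h1 := e1 y.
  have h2 : y * expR y <= y * (1 + y * expR y) by apply: ler_wpM2l.
  have h3 : y ^+ 2 * expR y <= c ^+ 2 * expR c.
    by apply: ler_pM; rewrite ?sqr_ge0 ?expR_ge0 ?ler_expR// lerXn2r ?nnegrE.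
  lra.
have yc' : - y <= c by rewrite -(ltr0_norm y0).
have h1 := e1 y.
have h2 : y * expR y <= y * (1 + y) by apply: ler_wnM2l; [exact: ltW|exact: expR_ge1Dx].
have h3 : y ^+ 2 * 1 <= c ^+ 2 * expR c.
  apply: ler_pM; rewrite ?sqr_ge0//; last by rewrite -expR0 ler_expR.
  by rewrite -sqrrN lerXn2r ?nnegrE// oppr_ge0 ltW.
lra.
Qed.

(** The convex function [y^(-q)] lies above its tangent at [z]; the proof only uses [1 + t <= exp t]
    and [ln t <= t - 1]. *)
Lemma powRN_tangent q y z : 0 < y -> 0 < z -> 0 <= q ->
  (1 + q) * z `^ (- q) <= y `^ (- q) + q * (z `^ (- q) / z) * y.
Proof.
move=> y0 z0 q0.
have zq : 0 < z `^ (- q) by exact: powR_gt0.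
have -> : y `^ (- q) = z `^ (- q) * expR (- q * ln (y / z)).
  rewrite /powR !gt_eqF// -expRD ln_div ?posrE//; congr expR; ring.
have h1 := expR_ge1Dx (- q * ln (y / z)).
have h2 : ln (y / z) <= y / z - 1.
  have yz0 : 0 < y / z by exact: divr_gt0.
  have := expR_ge1Dx (ln (y / z)); rewrite lnK ?posrE//; lra.
have h3 : q * ln (y / z) <= q * (y / z - 1) by apply: ler_wpM2l.
have -> : q * (z `^ (- q) / z) * y = z `^ (- q) * (q * (y / z)) by ring.
rewrite -mulrDr mulrC ler_pM2l//; lra.
Qed.

(** This is [ln (1 + z) >= z / (1 + z) >= z - z^2], halved. *)
Lemma inv_sqrt1D_le z : 0 <= z -> (Num.sqrt (1 + z))^-1 <= expR ((- z + z ^+ 2) / 2).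
Proof.
move=> z0; have z1 : 0 < 1 + z by lra.
rewrite -(@ler_pXn2r _ 2) ?nnegrE ?expR_ge0 ?invr_ge0 ?sqrtr_ge0//.
rewrite exprVn sqr_sqrtr ?(ltW z1)// expr2 -expRD -mulrDr.
rewrite (_ : (- z + z ^+ 2) * _ = - z + z ^+ 2); last by field.
apply: (@le_trans _ _ (expR (- (z / (1 + z))))).
  have := expR_ge1Dx (- (z / (1 + z))).
  by rewrite (_ : 1 + _ = (1 + z)^-1)//; field; rewrite gt_eqF.
rewrite ler_expR lerNl opprD opprK ler_pdivlMr//.
have : 0 <= z ^+ 2 * z by rewrite mulr_ge0 ?sqr_ge0.
lra.
Qed.

Lemma le1D_expR (e t : R) : 0 < e -> 1 + t <= e^-1 * expR (e * (1 + t)).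
Proof.
move=> e0; rewrite ler_pdivlMl//.
by apply: le_trans (expR_ge1Dx _); rewrite lerDr.
Qed.

End elementary.

(** The exponent is at most [de C (1 + r)] in absolute value, so its quadratic remainder carries
    [(1 + r)^2]. Each factor [1 + r] is traded for [exp(e (1 + r)) / e], and the exponential
    remainder costs one more, whence [3 e]. In [C], the 5 is 1 + 2 + 2 from the three terms of [el]
    containing [r]. *)
Lemma step_arith (R : realType) (M d a b r de e : R) : 0 <= M -> 0 <= d ->
  0 <= a <= M -> 0 <= b <= 2 * M -> 0 <= r -> 0 <= de <= 1 -> 0 < e ->
  let C := 5 * M ^+ 2 + d * M + (2 * d * M ^+ 2 + 4 * M ^+ 3) in
  let el := r * a ^+ 2 - d * a - b * r * a + b ^+ 2 * r / 2 in
  de * C <= e ->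
  expR (de * el + de ^+ 2 * (2 * d * a ^+ 2 + 2 * r * b * a ^+ 2)) <=
  1 + de * el + de ^+ 2 * ((C / e + (C / e) ^+ 2) * expR (3 * e * (1 + r))).
Proof.
move=> M0 d0 /andP[a0 aM] /andP[b0 bM] r0 /andP[de0 de1] e0 C el deC.
pose C1 : R := 2 * d * M ^+ 2 + 4 * M ^+ 3.
have CE : C = 5 * M ^+ 2 + d * M + C1 by [].
have M2 : 0 <= M ^+ 2 by rewrite exprn_ge0.
have M3 : 0 <= M ^+ 3 by rewrite exprn_ge0.
have dMM : 0 <= d * M ^+ 2 by rewrite mulr_ge0.
have dM0 : 0 <= d * M by rewrite mulr_ge0.
have C10 : 0 <= C1 by rewrite /C1; lra.
have Cge : C1 <= C by rewrite CE; lra.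
have C0 : 0 <= C by exact: le_trans Cge.
set y := _ + _.
have yE : y = de * el + de ^+ 2 * (2 * d * a ^+ 2 + 2 * r * b * a ^+ 2) by [].
have a2 : a ^+ 2 <= M ^+ 2 by rewrite lerXn2r ?nnegrE.
have b2 : b ^+ 2 <= 4 * M ^+ 2.
  by rewrite (_ : 4 * _ = (2 * M) ^+ 2); [rewrite lerXn2r ?nnegrE// mulr_ge0|ring].
have ba : b * a <= 2 * M * M by apply: ler_pM.
have ba0 : 0 <= b * a by rewrite mulr_ge0.
have da : d * a <= d * M by rewrite ler_wpM2l.
have da0 : 0 <= d * a by rewrite mulr_ge0.
have ra2 : r * a ^+ 2 <= r * M ^+ 2 by rewrite ler_wpM2l.
have ra20 : 0 <= r * a ^+ 2 by rewrite mulr_ge0 ?sqr_ge0.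
have rb2 : r * b ^+ 2 <= r * (4 * M ^+ 2) by rewrite ler_wpM2l.
have rb20 : 0 <= r * b ^+ 2 by rewrite mulr_ge0 ?sqr_ge0.
have rba : r * (b * a) <= r * (2 * M * M) by rewrite ler_wpM2l.
have rba0 : 0 <= r * (b * a) by rewrite mulr_ge0.
have rdM : 0 <= r * (d * M) by rewrite !mulr_ge0.
have el_le : `|el| <= (5 * M ^+ 2 + d * M) * (1 + r).
  by rewrite ler_norml /el; apply/andP; split; nra.
have s2 : 0 <= 2 * d * a ^+ 2 + 2 * r * b * a ^+ 2 <= C1 * (1 + r).
  apply/andP; split; first by rewrite addr_ge0// !mulr_ge0// ?sqr_ge0.
  have h1 : 2 * d * a ^+ 2 <= 2 * d * M ^+ 2 by apply: ler_wpM2l => //; exact: mulr_ge0.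
  have h2 : b * a ^+ 2 <= 2 * M * M ^+ 2 by apply: ler_pM; rewrite ?sqr_ge0.
  have h3 : r * (b * a ^+ 2) <= r * (2 * M * M ^+ 2) by rewrite ler_wpM2l.
  have h4 : 0 <= 2 * d * M ^+ 2 * r by rewrite !mulr_ge0.
  have h5 : 0 <= M * M ^+ 2 by rewrite mulr_ge0.
  have h6 : M ^+ 3 = M * M ^+ 2 by rewrite exprS.
  rewrite /C1 h6; nra.
have /andP[s20 s2C] := s2.
have r1 : 0 <= 1 + r by rewrite addr_ge0.
have de2 : de ^+ 2 <= de by rewrite expr2 ler_piMl.
have yC : `|y| <= de * C * (1 + r).
  rewrite yE (le_trans (ler_normD _ _))//.
  rewrite [X in X + _]normrM (ger0_norm de0) (ger0_norm (mulr_ge0 (sqr_ge0 de) s20)).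
  have h1 : de * `|el| <= de * ((5 * M ^+ 2 + d * M) * (1 + r)) by rewrite ler_wpM2l.
  have h2 : de ^+ 2 * (2 * d * a ^+ 2 + 2 * r * b * a ^+ 2) <= de * (C1 * (1 + r)).
    by apply: ler_pM => //; rewrite sqr_ge0.
  rewrite CE; lra.
have qd := expR_le_quad yC.
have e3 : expR (de * C * (1 + r)) <= expR (e * (1 + r)) by rewrite ler_expR ler_wpM2r.
pose X := expR (e * (1 + r)).
have X0 : 0 <= X by exact: expR_ge0.
have X1 : 1 <= X by rewrite -expR0 ler_expR mulr_ge0// ltW.
have X3 : expR (3 * e * (1 + r)) = X ^+ 3.
  by rewrite /X -expRM_natl; congr expR; ring.
have r1X : 1 + r <= e^-1 * X by exact: le1D_expR.
have t1 : (de * C * (1 + r)) ^+ 2 * expR (de * C * (1 + r)) <=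
    de ^+ 2 * ((C / e) ^+ 2 * X ^+ 3).
  have h1 : C * (1 + r) <= C / e * X.
    by rewrite -mulrA ler_wpM2l.
  have Cr0 : 0 <= C * (1 + r) by rewrite mulr_ge0.
  have h2 : (C * (1 + r)) ^+ 2 <= (C / e * X) ^+ 2.
    by rewrite lerXn2r ?nnegrE// (le_trans Cr0).
  rewrite (_ : (de * C * (1 + r)) ^+ 2 = de ^+ 2 * (C * (1 + r)) ^+ 2); last by ring.
  rewrite -mulrA ler_wpM2l ?sqr_ge0//.
  rewrite (_ : (C / e) ^+ 2 * X ^+ 3 = (C / e * X) ^+ 2 * X); last by ring.
  by apply: ler_pM; rewrite ?sqr_ge0 ?expR_ge0.
have t2 : de ^+ 2 * (2 * d * a ^+ 2 + 2 * r * b * a ^+ 2) <= de ^+ 2 * (C / e * X ^+ 3).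
  rewrite ler_wpM2l ?sqr_ge0// (le_trans s2C)//.
  have h1 : C1 * (1 + r) <= C * (1 + r) by rewrite ler_wpM2r.
  have h2 : C * (1 + r) <= C / e * X by rewrite -mulrA ler_wpM2l.
  have Ce0 : 0 <= C / e by rewrite divr_ge0 ?(ltW e0).
  have XX : X <= X ^+ 3 by rewrite exprS ler_peMr// exprn_ege1.
  have h3 : C / e * X <= C / e * X ^+ 3 by rewrite ler_wpM2l.
  lra.
apply: (le_trans qd); rewrite X3; lra.
Qed.

Section kernel_step.
Variables (R : realType) (n : nat) (c r de b : R).
Hypotheses (r0 : 0 <= r) (de0 : 0 <= de) (b0 : 0 <= b).
Notation a := (damped c).

(** Time advances by [2 de]: once because the flow itself moves to [sg + de], once because it is
    then averaged over time [de]. The dilation [1 + b de] is the one produced by [heat_tilt]. *)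
Lemma gauss_kernel_step (c' u : R) : 0 <= u -> c' ^+ 2 = c ^+ 2 + 2 * de ->
  gauss_kernel n u c' ((1 + b * de) ^+ 2 * r) <= gauss_kernel n u c r *
   expR (de * (r * a u ^+ 2 - n%:R * a u - b * r * a u) +
         de ^+ 2 * (2 * n%:R * a u ^+ 2 + 2 * r * b * a u ^+ 2)).
Proof.
move=> u0 c'E; rewrite /gauss_kernel c'E.
have k1 := kernel_den_ge1 c u0; set k := 1 + c ^+ 2 * u in k1 *.
have k0 : 0 < k by exact: lt_le_trans ltr01 k1.
have aE : a u = u / k by [].
have a0 : 0 <= a u by exact: damped_ge0.
set A := a u in aE a0 *.
clearbody A.
have z0 : 0 <= 2 * de * A by rewrite !mulr_ge0.
have z1 : 0 < 1 + 2 * de * A by lra.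
have -> : 1 + (c ^+ 2 + 2 * de) * u = k * (1 + 2 * de * A).
  by rewrite aE /k; field; rewrite -/k gt_eqF.
clearbody k; have uE : u = A * k by rewrite aE divfK// gt_eqF.
rewrite sqrtrM ?(ltW k0)// exprMn (invfM (Num.sqrt k ^+ n)).
rewrite -[leLHS]mulrA -[leRHS]mulrA; apply: ler_wpM2l.
  by rewrite invr_ge0 exprn_ge0// sqrtr_ge0.
have h1 : (Num.sqrt (1 + 2 * de * A) ^+ n)^-1 <=
    expR (n%:R * ((- (2 * de * A) + (2 * de * A) ^+ 2) / 2)).
  rewrite -exprVn expRM_natl lerXn2r ?nnegrE ?expR_ge0 ?invr_ge0 ?sqrtr_ge0//.
  exact: inv_sqrt1D_le.
apply: (le_trans (ler_wpM2r (expR_ge0 _) h1)).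
rewrite -!expRD ler_expR.
have -> : - (u * ((1 + b * de) ^+ 2 * r)) / (2 * (k * (1 + 2 * de * A))) =
   - (r / 2) * (A * (1 + b * de) ^+ 2 / (1 + 2 * de * A)).
  by rewrite uE; field; rewrite !gt_eqF.
have -> : - (u * r) / (2 * k) = - (r / 2) * A by rewrite uE; field; rewrite gt_eqF.
(* A first-order expansion in [de] with a correction that makes the remaining terms, once the
   denominator is cleared, all nonnegative. *)
have h2 : A + 2 * de * A * (b - A) - 4 * de ^+ 2 * A ^+ 2 * b <=
    A * (1 + b * de) ^+ 2 / (1 + 2 * de * A).
  rewrite ler_pdivlMr// -subr_ge0.
  rewrite (_ : _ - _ = A * (b * de) ^+ 2 + 4 * de ^+ 2 * A ^+ 3 + 8 * de ^+ 3 * A ^+ 3 * b); last by ring.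
  by rewrite !addr_ge0// !mulr_ge0 ?exprn_ge0// mulr_ge0.
have h3 : (r / 2) * (A + 2 * de * A * (b - A) - 4 * de ^+ 2 * A ^+ 2 * b) <=
    (r / 2) * (A * (1 + b * de) ^+ 2 / (1 + 2 * de * A)).
  by apply: ler_wpM2l => //; rewrite divr_ge0.
lra.
Qed.

End kernel_step.

(** * Monotonicity of the average along the heat flow *)

Section heat_flow.
Variables (R : realType) (p k : nat) (K : R).
Hypothesis K0 : 0 < K.
Notation B := (K ^+ 2).
Notation d := (p.+3%:R).
Notation kk := (k.+2%:R).
Notation seg b := [set u : R | 0 <= u <= b].
Notation rad := (radmom p K0).
Notation l := (radial_law p K0).
Notation mix := (pow_law l k.+2).
Notation V := 'rV[R]_p.+3.
Let M : R := kk * B.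
Let q : R := (kk - 1) / kk.

(** The function [F_sg] of the overview, indexed by the time [sg] rather than by the standard
    deviation. *)
Definition flow (sg : R) (x : V) : R := mixF k (Num.sqrt sg) x K0.

Let M0 : 0 <= M. Proof. by rewrite mulr_ge0// sqr_ge0. Qed.
Let kk0 : 0 < kk :> R. Proof. by rewrite ltr0n. Qed.
Let q0 : 0 <= q. Proof. by rewrite divr_ge0// subr_ge0 ler1n. Qed.
Let q1 : q <= 1. Proof. by rewrite ler_pdivrMr// mul1r gerBl. Qed.

Lemma test_rad_pow : bounded_test [set r : R | 0 <= r] (fun s => rad 0 s ^+ k.+2).
Proof. by apply: bounded_testX; exact: test_rad. Qed.

Lemma heat_flowE sg x :
  heat (Num.sqrt sg) (fun y => (rad 0 (sqnorm y) ^+ k.+2)%:E) x = (flow sg x)%:E.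
Proof. by rewrite (heat_ev _ _ test_rad_pow) /flow mixFE. Qed.

Lemma measurable_rad_sqnorm : measurable_fun setT
  (fun y : V => (rad 0 (sqnorm y) ^+ k.+2)%:E).
Proof.
apply/measurable_EFinP; have [m _] := test_rad_pow.
by apply: (measurableT_comp m); exact: measurable_sqnorm.
Qed.

Lemma rad_sqnorm_ge0 (y : V) : (0 <= (rad 0 (sqnorm y) ^+ k.+2)%:E)%E.
Proof. by rewrite lee_fin exprn_ge0// rad_ge0. Qed.

Lemma measurable_flow sg : measurable_fun setT (flow sg).
Proof.
apply/measurable_EFinP; rewrite (_ : _ \o _ = heat (Num.sqrt sg) (fun y => (rad 0 (sqnorm y) ^+ k.+2)%:E)).
  exact: measurable_heat measurable_rad_sqnorm rad_sqnorm_ge0.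
by apply/funext => x; rewrite heat_flowE.
Qed.

(** The total mass of the mixture, which is not normalised. *)
Let mass : R := rad 0 0 ^+ k.+2.

Let mass_gt0 : 0 < mass. Proof. by rewrite exprn_gt0// rad0_gt0. Qed.

Let massE : ev mix (fun=> 1) = mass.
Proof.
rewrite /mass /radmom -(ev_pow_law0 (sqr_ge0 K)); apply: eq_ev => u _.
by rewrite mulr0 mul0r expR0 expr0 mulr1.
Qed.

(** Each kernel is minorised using [u <= M] and [sg <= s]. A lower bound of [flow] is an upper bound
    of its negative power, so it limits the growth of [wflow]. *)
Lemma flow_ge s sg x : 0 <= sg <= s ->
  mass * Num.sqrt (1 + s * M) ^- p.+3 * expR (- M * sqnorm x / 2) <= flow sg x.
Proof.
move=> /andP[sg0 sgs]; rewrite -massE -mulrA mulrC -evZ; last exact: bounded_test_cst.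
have r0 := sqnorm_ge0 x; have s0 : 0 <= s by exact: le_trans sgs.
have sM : 0 < 1 + s * M by rewrite ltr_pwDl// mulr_ge0.
apply: le_ev; [exact/bounded_testZ/bounded_test_cst|exact: test_gauss_kernel|].
move=> u /= /andP[u0 uM]; rewrite mulr1 /gauss_kernel sqr_sqrtr//.
have k1 : 1 <= 1 + sg * u by rewrite lerDl mulr_ge0.
have k0 : 0 < 1 + sg * u by exact: lt_le_trans ltr01 k1.
apply: ler_pM; rewrite ?expR_ge0 ?invr_ge0 ?exprn_ge0 ?sqrtr_ge0//.
  rewrite lef_pV2 ?posrE ?exprn_gt0 ?sqrtr_gt0// lerXn2r ?nnegrE ?sqrtr_ge0//.
  by rewrite ler_wsqrtr// lerD2l ler_pM.
rewrite ler_expR !mulNr lerN2 ler_pdivrMr ?mulr_gt0//.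
have h : u * sqnorm x <= M * sqnorm x by rewrite ler_wpM2r.
have Mr : 0 <= M * sqnorm x by rewrite mulr_ge0.
have : M * sqnorm x * 1 <= M * sqnorm x * (1 + sg * u) by rewrite ler_wpM2l.
lra.
Qed.

Lemma flow_gt0 sg x : 0 <= sg -> 0 < flow sg x.
Proof.
move=> sg0; have h : 0 <= sg <= sg by rewrite sg0 lexx.
apply: lt_le_trans (flow_ge x h).
apply: mulr_gt0 (mulr_gt0 mass_gt0 _) (expR_gt0 _).
by rewrite invr_gt0 exprn_gt0// sqrtr_gt0 ltr_pwDl//; exact: mulr_ge0.
Qed.

Definition wflow sg x := flow sg x `^ (- q).

Lemma wflow_ge0 sg x : (0 <= (wflow sg x)%:E)%E.
Proof. by rewrite lee_fin powR_ge0. Qed.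

Lemma measurable_wflow sg : measurable_fun setT (fun x => (wflow sg x)%:E).
Proof.
apply/measurable_EFinP; apply: (measurableT_comp (measurable_powR _)).
exact: measurable_flow.
Qed.

Lemma heat_flow de sg x : 0 < de -> 0 <= sg ->
  heat (Num.sqrt de) (fun y => (flow sg y)%:E) x = (flow (sg + de) x)%:E.
Proof.
move=> de0 sg0.
have -> : (fun y => (flow sg y)%:E) =
    heat (Num.sqrt sg) (fun y => (rad 0 (sqnorm y) ^+ k.+2)%:E).
  by apply/funext => y; exact: esym (heat_flowE sg y).
(* Time 0 is separate because [heat_heat] needs a positive inner deviation. *)
rewrite -[RHS]heat_flowE; have [->|sgn0] := eqVneq sg 0.
  have -> : heat (Num.sqrt (0 : R)) (fun y : V => (rad 0 (sqnorm y) ^+ k.+2)%:E) =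
      (fun y : V => (rad 0 (sqnorm y) ^+ k.+2)%:E).
    by apply/funext => y; rewrite sqrtr0; apply: heat0; exact: rad_sqnorm_ge0.
  by rewrite add0r.
rewrite heat_heat; [|by rewrite sqrtr_gt0 lt0r sgn0|exact: measurable_rad_sqnorm|exact: rad_sqnorm_ge0].
by rewrite (sqr_sqrtr (ltW de0)) (sqr_sqrtr sg0) addrC.
Qed.

(* A uniform second-order expansion of the flow along the space-time path
   [(sg + 2 de, (1 + b de) x)]. *)
Lemma flow_step_bound : exists2 C : R, 0 <= C & forall e : R, 0 < e ->
  forall (sg de t : R) x, 0 <= sg -> 0 <= de -> de <= 1 -> de * C <= e -> 0 <= t <= M ->
  expR (((1 + q) * t) ^+ 2 * de * sqnorm x / 2) *
    flow (sg + 2 * de) ((1 + (1 + q) * t * de) *: x) <=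
  flow sg x * (1 + de * (((1 + q) * t) ^+ 2 * sqnorm x / 2)
    + de ^+ 2 * (C / e + (C / e) ^+ 2) * expR (3 * e * (1 + sqnorm x)))
  + de * (mixL k (Num.sqrt sg) x K0
    - (1 + q) * t * sqnorm x * mixF1 k (Num.sqrt sg) x K0).
Proof.
pose C1 : R := 2 * d * M ^+ 2 + 4 * M ^+ 3.
pose C : R := 5 * M ^+ 2 + d * M + C1.
have M2 : 0 <= M ^+ 2 by exact: exprn_ge0.
have M3 : 0 <= M ^+ 3 by exact: exprn_ge0.
have C10 : 0 <= C1.
  by apply: addr_ge0; apply: mulr_ge0 => //; exact: mulr_ge0.
have C0' : 0 <= 5 * M ^+ 2 + d * M by apply: addr_ge0; exact: mulr_ge0.
exists C => [|e e0 sg de t x sg0 de0 de1 deC /andP[t0 tM]]; first exact: addr_ge0.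
set r := sqnorm x; set b := (1 + q) * t; set c := Num.sqrt sg.
have r0 : 0 <= r by exact: sqnorm_ge0.
have b0 : 0 <= b by rewrite mulr_ge0// addr_ge0.
have bM : b <= 2 * M.
  by apply: ler_pM => //; [exact: addr_ge0|exact: (lerD (lexx 1) q1)].
have c2 : c ^+ 2 = sg by rewrite sqr_sqrtr.
pose Q := (C / e + (C / e) ^+ 2) * expR (3 * e * (1 + r)).
have tG : bounded_test (seg M) (fun u => gauss_kernel p.+3 u c r) by exact: test_gauss_kernel.
have ta : bounded_test (seg M) (damped c) by exact: test_damped.
(* Gathered into one average over the mixture, the claim reduces to an inequality for each [u]. *)
have -> : flow sg x * (1 + de * (b ^+ 2 * r / 2) + de ^+ 2 * (C / e + (C / e) ^+ 2) * expR (3 * e * (1 + r)))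
    + de * (mixL k c x K0 - b * r * mixF1 k c x K0) =
    ev mix (fun u => (1 + de * (b ^+ 2 * r / 2) + de ^+ 2 * Q) * gauss_kernel p.+3 u c r +
       de * (gauss_kernel p.+3 u c r * (r * damped c u ^+ 2 - d * damped c u)
         - b * r * (gauss_kernel p.+3 u c r * damped c u))).
  rewrite evD; [|by btest|by btest].
  rewrite (evZ mix _ tG) evZ; last by btest.
  rewrite evB; [|by btest|by btest].
  rewrite (evZ mix (b * r)); last by btest.
  rewrite /flow /mixF /mixL /mixF1 -/c -/r /Q; ring.
rewrite /flow /mixF sqnormZ -/r -evZ; last first.
  by apply: test_gauss_kernel; exact: mulr_ge0 (sqr_ge0 _) r0.
apply: le_ev.
- by apply: bounded_testZ; apply: test_gauss_kernel; rewrite mulr_ge0 ?sqr_ge0.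
- by btest.
move=> u /= /andP[u0 uM].
have cE : Num.sqrt (sg + 2 * de) ^+ 2 = c ^+ 2 + 2 * de.
  by rewrite c2 sqr_sqrtr// addr_ge0// mulr_ge0.
have h := @gauss_kernel_step R p.+3 c r de b r0 de0 b0 _ u u0 cE.
set G := gauss_kernel p.+3 u c r in h *.
have G0 : 0 <= G by exact: gauss_kernel_ge0.
have a0 : 0 <= damped c u by exact: damped_ge0.
have aM : damped c u <= M by exact: le_trans (damped_le c u0) uM.
set a := damped c u in h a0 aM *.
apply: (le_trans (ler_wpM2l (expR_ge0 _) h)); rewrite mulrCA -expRD.
set y := _ + _.
pose el := r * a ^+ 2 - d * a - b * r * a + b ^+ 2 * r / 2.
have yE : y = de * el + de ^+ 2 * (2 * d * a ^+ 2 + 2 * r * b * a ^+ 2).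
  by rewrite /y /el; field.
have fin : expR y <= 1 + de * el + de ^+ 2 * Q.
  rewrite yE /Q; apply: (@step_arith R M d a b r de e) => //.
  - by rewrite a0.
  - by rewrite b0.
  - by rewrite de0.
have := ler_wpM2l G0 fin; rewrite /el => h'.
apply: (le_trans h'); rewrite le_eqVlt; apply/orP; left; apply/eqP; ring.
Qed.

Let cond (sg : R) := sg * (kk * B * d / (d + 2)) * (2 * (kk - 1)) <= 1.

Lemma mixF1_bounds sg x :
  0 <= mixF1 k (Num.sqrt sg) x K0 <= M * flow sg x.
Proof.
have r0 : 0 <= sqnorm x by exact: sqnorm_ge0.
have tG : bounded_test (seg M) (fun u => gauss_kernel p.+3 u (Num.sqrt sg) (sqnorm x)).
  exact: test_gauss_kernel.
have ta : bounded_test (seg M) (damped (Num.sqrt sg)) by exact: test_damped.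
apply/andP; split.
  apply: ev_ge0 => u /= /andP[u0 _].
  by apply: mulr_ge0; [exact: gauss_kernel_ge0|exact: damped_ge0].
rewrite /flow /mixF -(evZ mix M tG); apply: le_ev; [by btest|by btest|].
move=> u /= /andP[u0 uM]; rewrite mulrC.
apply: ler_wpM2r; first exact: gauss_kernel_ge0.
exact: le_trans (damped_le _ u0) uM.
Qed.

(* The tangent of [y ^ (- q)] is taken at [flow sg x * expR (- t x.(y - x))],
   the exponential interpolation of the flow at [x]; the first-order terms of
   the Gaussian average then cancel against superharmonicity. *)
Lemma wflow_step : exists2 C : R, 0 <= C & forall e : R, 0 < e ->
  forall (sg de : R) x, 0 <= sg -> cond sg -> 0 < de -> de <= 1 -> de * C <= e ->
  ((wflow sg x)%:E <= heat (Num.sqrt de) (fun y => (wflow (sg + de) y)%:E) x +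
    (de ^+ 2 * ((C / e + (C / e) ^+ 2) * expR (3 * e * (1 + sqnorm x))) * wflow sg x)%:E)%E.
Proof.
have [C C0 hC] := flow_step_bound; exists C => // e e0 sg de x sg0 csg de0 de1 deC.
have F0 := flow_gt0 x sg0.
have /andP[F10 F1M] := mixF1_bounds sg x.
have sup : 2 * (flow sg x * mixL k (Num.sqrt sg) x K0) <=
    (2 * kk - 1) / kk * (sqnorm x * mixF1 k (Num.sqrt sg) x K0 ^+ 2).
  by apply: mix_superharmonic; rewrite sqr_sqrtr.
(* The gradient of [ln flow] at [x] is [- t x]. *)
pose t := mixF1 k (Num.sqrt sg) x K0 / flow sg x.
have t0 : 0 <= t by rewrite divr_ge0// ltW.
have tM : t <= M by rewrite ler_pdivrMr.
have tF : mixF1 k (Num.sqrt sg) x K0 = t * flow sg x by rewrite /t divfK// gt_eqF.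
have tt : 0 <= t <= M by rewrite t0.
have r0 : 0 <= sqnorm x by exact: sqnorm_ge0.
have step := hC e e0 sg de t x sg0 (ltW de0) de1 deC tt.
rewrite tF in sup step.
set W := wflow sg x; set F := flow sg x in F0 sup step F1M *.
set r := sqnorm x in r0 sup step *.
set L := mixL _ _ _ _ in sup step.
set E := de ^+ 2 * (_ * expR (3 * e * (1 + r))).
have E0 : 0 <= E.
  apply: mulr_ge0 (sqr_ge0 _) (mulr_ge0 (addr_ge0 _ (sqr_ge0 _)) (expR_ge0 _)).
  exact: divr_ge0 C0 (ltW e0).
have W0 : 0 < W by exact: powR_gt0.
pose b := (1 + q) * t.
have h1q : 0 <= 1 + q by exact: addr_ge0.
have LF : L <= (1 + q) * r * t ^+ 2 * F / 2.
  have kE : (2 * kk - 1) / kk = 1 + q by rewrite /q; field; rewrite -natr1 -natr1 gt_eqF// ltr_wpDl.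
  rewrite kE in sup; rewrite -(ler_pM2l F0).
  have : F * ((1 + q) * r * t ^+ 2 * F / 2) = (1 + q) * (r * (t * F) ^+ 2) / 2 by ring.
  move=> ->; rewrite ler_pdivlMr// mulrC; exact: sup.
pose D1 := expR (b ^+ 2 * de * r / 2) * flow (sg + 2 * de) ((1 + b * de) *: x).
have D1_le : D1 <= F * (1 + de * ((1 + q) * q * (r * t ^+ 2) / 2) + E).
  apply: (le_trans step); rewrite -/b.
  have dL : de * L <= de * ((1 + q) * r * t ^+ 2 * F / 2) by apply: ler_wpM2l => //; exact: ltW.
  have -> : de ^+ 2 * (C / e + (C / e) ^+ 2) * expR (3 * e * (1 + r)) = E by rewrite /E mulrA.
  (* With [b = (1 + q) t] the coefficient of [r t^2] is [(1+q)^2 / 2 - (1+q) + (1+q) / 2 = (1+q) q /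
     2]. *)
  have id : F * (1 + de * (b ^+ 2 * r / 2) + E) + de * ((1 + q) * r * t ^+ 2 * F / 2 - b * r * (t * F))
    = F * (1 + de * ((1 + q) * q * (r * t ^+ 2) / 2) + E) by rewrite /b; field.
  rewrite -id lerD2l; apply: ler_wpM2l; first exact: ltW.
  by rewrite lerD2r.
have m_dot a : measurable_fun setT (fun y : V => (expR (a * dotr x (y - x)))%:E).
  apply/measurable_EFinP; apply: measurableT_comp => //.
  apply: measurable_funM => //; apply: measurable_dotr.
  exact: measurable_rowD.
have tangent (y : V) : (((1 + q) * W)%:E * (expR (q * t * dotr x (y - x)))%:E <=
   ((wflow (sg + de) y)%:E + (q * (W / F))%:E * ((expR (b * dotr x (y - x)))%:E * (flow (sg + de) y)%:E)))%E.
  rewrite -!EFinM -EFinD lee_fin.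
  set D := dotr _ _.
  have y0 : 0 < flow (sg + de) y by apply: flow_gt0; exact: addr_ge0 sg0 (ltW de0).
  pose z := F * expR (- t * D).
  have z0 : 0 < z by exact: mulr_gt0 F0 (expR_gt0 _).
  have zq : z `^ (- q) = W * expR (q * t * D).
    rewrite /z powRM ?expR_ge0 ?(ltW F0)// /W /wflow; congr (_ * _).
    by rewrite -expRM; congr expR; ring.
  have := powRN_tangent y0 z0 q0; rewrite zq /wflow => h.
  have zi : z^-1 = F^-1 * expR (t * D) by rewrite /z invfM -expRN; congr (_ * expR _); ring.
  have bE : expR (b * D) = expR (q * t * D) * expR (t * D).
    by rewrite -expRD; congr expR; rewrite /b; ring.
  have eq1 : q * (W * expR (q * t * D) / z) * flow (sg + de) y =
      q * (W / F) * (expR (b * D) * flow (sg + de) y) by rewrite zi bE; ring.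
  by rewrite eq1 mulrA in h; exact: h.
have wm := measurable_wflow (sg + de); have w0 := wflow_ge0 (sg + de).
have fm : measurable_fun setT (fun y : V => (flow (sg + de) y)%:E).
  by apply/measurable_EFinP; exact: measurable_flow.
have f0 (y : V) : (0 <= (flow (sg + de) y)%:E)%E.
  by rewrite lee_fin; apply: ltW; apply: flow_gt0; exact: addr_ge0 sg0 (ltW de0).
have expE0 (a : R) : (0 <= (expR a)%:E)%E by rewrite lee_fin expR_ge0.
have bfm : measurable_fun setT (fun y : V => (expR (b * dotr x (y - x)))%:E * (flow (sg + de) y)%:E)%E.
  exact: emeasurable_funM.
have bf0 (y : V) : (0 <= (expR (b * dotr x (y - x)))%:E * (flow (sg + de) y)%:E)%E.
  exact: mule_ge0 (expE0 _) (f0 y).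
have qWF0 : (0 <= (q * (W / F))%:E)%E.
  by rewrite lee_fin; apply: mulr_ge0 q0 (divr_ge0 (ltW W0) (ltW F0)).
have cm : measurable_fun setT (fun y : V => (q * (W / F))%:E * ((expR (b * dotr x (y - x)))%:E * (flow (sg + de) y)%:E))%E.
  exact: emeasurable_funM.
have c0 (y : V) : (0 <= (q * (W / F))%:E * ((expR (b * dotr x (y - x)))%:E * (flow (sg + de) y)%:E))%E.
  exact: mule_ge0 qWF0 (bf0 y).
have qW0 : (0 <= ((1 + q) * W)%:E)%E by rewrite lee_fin; exact: mulr_ge0 h1q (ltW W0).
have e_ge0 (y : V) : (0 <= (expR (q * t * dotr x (y - x)))%:E)%E by rewrite lee_fin expR_ge0.
have lm : measurable_fun setT (fun y : V => ((1 + q) * W)%:E * (expR (q * t * dotr x (y - x)))%:E)%E.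
  exact: emeasurable_funM.
have l0 (y : V) : (0 <= ((1 + q) * W)%:E * (expR (q * t * dotr x (y - x)))%:E)%E by exact: mule_ge0 qW0 (e_ge0 y).
have rm : measurable_fun setT (fun y : V => (wflow (sg + de) y)%:E + (q * (W / F))%:E * ((expR (b * dotr x (y - x)))%:E * (flow (sg + de) y)%:E))%E.
  exact: emeasurable_funD.
have main := @le_heat _ _ (Num.sqrt de) _ _ x lm rm l0 tangent.
rewrite (heatD _ _ wm cm w0 c0) (heatZ _ _ bfm bf0 qWF0) (heat_tilt _ _ _ fm f0) in main.
rewrite (heatZ _ _ (m_dot _) e_ge0 qW0) in main.
have tilt1 : heat (Num.sqrt de) (fun y => (expR (q * t * dotr x (y - x)))%:E) x =
    (expR ((q * t) ^+ 2 * de * r / 2))%:E.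
  have h1 := @heat_tilt _ _ (q * t) (Num.sqrt de) (fun=> 1%E) x (measurable_cst _) (fun=> lee01).
  rewrite heat_cst ?lee01// mule1 sqr_sqrtr ?(ltW de0)// in h1.
  by rewrite -h1; congr heat; apply/funext => y; rewrite mule1.
rewrite tilt1 sqr_sqrtr ?(ltW de0)// (heat_flow _ de0) ?addr_ge0 ?(ltW de0)// in main.
have sE : sg + de + de = sg + 2 * de by ring.
rewrite sE -!EFinM -/r -/D1 in main.
have low : (1 + q) * W * (1 + (q * t) ^+ 2 * de * r / 2) <=
    (1 + q) * W * expR ((q * t) ^+ 2 * de * r / 2).
  by apply: ler_wpM2l (expR_ge1Dx _); exact: mulr_ge0 h1q (ltW W0).
have high : q * (W / F) * D1 <= q * W * (1 + de * ((1 + q) * q * (r * t ^+ 2) / 2) + E).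
  have -> : q * W * (1 + de * ((1 + q) * q * (r * t ^+ 2) / 2) + E) =
     q * (W / F) * (F * (1 + de * ((1 + q) * q * (r * t ^+ 2) / 2) + E)).
    by field; rewrite gt_eqF.
  by apply: ler_wpM2l D1_le; rewrite -lee_fin.
have WE : q * W * E <= W * E.
  by rewrite -mulrA; apply: ler_piMl q1; exact: mulr_ge0 (ltW W0) E0.
(* The terms of order [de] on both sides are [(1 + q) q^2 t^2 r W de / 2] and cancel exactly; only
   the error [E] survives. *)
have gap : W + q * (W / F) * D1 <= (1 + q) * W * expR ((q * t) ^+ 2 * de * r / 2) + E * W.
  have id : (1 + q) * W * (1 + (q * t) ^+ 2 * de * r / 2) + q * W * E =
    W + q * W * (1 + de * ((1 + q) * q * (r * t ^+ 2) / 2) + E) by field.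
  move: low high WE id; clear; set X1 := (1 + q) * W * _; set X2 := (1 + q) * W * _.
  set X3 := q * W * (_ + _); set X4 := q * _ * D1; set X5 := q * W * E; rewrite (mulrC E); set X6 := W * E.
  by clearbody X1 X2 X3 X4 X5 X6 W; lra.
(* The heat average is not known to be finite, so a finite term is added on both sides and cancelled
   instead of subtracted. *)
have : (W%:E + (q * (W / F) * D1)%:E <=
   heat (Num.sqrt de) (fun y => (wflow (sg + de) y)%:E) x + (E * W)%:E + (q * (W / F) * D1)%:E)%E.
  rewrite -EFinD; apply: (@le_trans _ _ ((1 + q) * W * expR ((q * t) ^+ 2 * de * r / 2) + E * W)%:E).
    by rewrite lee_fin.
  by rewrite EFinD addeAC; apply: leeD2r.
by rewrite leeD2rE.
Qed.

Lemma wflow_le s sg x : 0 <= sg <= s ->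
  wflow sg x <= (mass * Num.sqrt (1 + s * M) ^- p.+3) `^ (- q) * expR (q * M * sqnorm x / 2).
Proof.
move=> sgs; have := flow_ge x sgs.
set m := mass * _; set E := expR _ => h.
have s0 : 0 <= s by case/andP: sgs => /le_trans h1 /h1.
have m0 : 0 < m.
  apply: mulr_gt0 mass_gt0 _; rewrite invr_gt0 exprn_gt0// sqrtr_gt0.
  by apply: ltr_pwDl => //; exact: mulr_ge0.
have mE : 0 < m * E by exact: mulr_gt0 m0 (expR_gt0 _).
have -> : m `^ (- q) * expR (q * M * sqnorm x / 2) = (m * E) `^ (- q).
  rewrite powRM ?expR_ge0 ?(ltW m0)//; congr (_ * _).
  by rewrite /E -expRM; congr expR; ring.
rewrite /wflow !powRN lef_pV2 ?posrE ?powR_gt0//; last exact: lt_le_trans h.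
by apply: ge0_ler_powR => //; rewrite nnegrE ltW//; exact: lt_le_trans h.
Qed.

(** The average is a Gaussian kernel with parameter [- A], whose denominator [1 - sg A] stays above
    1/3 uniformly in [sg]. *)
Lemma heat_exp_le (s sg A : R) (w : V) : 0 <= sg <= s -> 0 <= A -> 3^-1 <= 1 - s * A ->
  (heat (Num.sqrt sg) (fun y => (expR (A * sqnorm y / 2))%:E) w <=
   (Num.sqrt 3^-1 ^- p.+3 * expR (3 / 2 * A * sqnorm w))%:E)%E.
Proof.
move=> /andP[sg0 sgs] A0 sA.
have r0 : 0 <= sqnorm w by exact: sqnorm_ge0.
have den : 3^-1 <= 1 + Num.sqrt sg ^+ 2 * - A.
  rewrite sqr_sqrtr// mulrN; apply: le_trans sA _.
  by rewrite lerD2l lerN2; exact: ler_wpM2r.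
have den0 : 0 < 1 + Num.sqrt sg ^+ 2 * - A by apply: lt_le_trans den; rewrite invr_gt0.
have -> : heat (Num.sqrt sg) (fun y => (expR (A * sqnorm y / 2))%:E) w =
    (gauss_kernel p.+3 (- A) (Num.sqrt sg) (sqnorm w))%:E.
  rewrite -(integral_gaussN w den0); apply: eq_integral => z _.
  by rewrite opprK EFinM.
rewrite lee_fin /gauss_kernel.
set k0 := 1 + _ in den den0 *.
apply: ler_pM; rewrite ?expR_ge0 ?invr_ge0 ?exprn_ge0 ?sqrtr_ge0//.
  rewrite lef_pV2 ?posrE ?exprn_gt0 ?sqrtr_gt0 ?invr_gt0//.
  by rewrite lerXn2r ?nnegrE ?sqrtr_ge0// ler_wsqrtr.
rewrite ler_expR (mulNr A) opprK.
rewrite ler_pdivrMr ?mulr_gt0//.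
have Ar : 0 <= A * sqnorm w by exact: mulr_ge0.
have : A * sqnorm w * 3^-1 <= A * sqnorm w * k0 by exact: ler_wpM2l.
by move: Ar; rewrite -!(mulrA _ A); set X := A * _; clearbody X k0; lra.
Qed.

Section iteration.
Variables (s : R) (w : V).
Hypotheses (s0 : 0 < s) (cs : cond s).

Let cond_le sg : sg <= s -> cond sg.
Proof.
move=> sgs; apply: le_trans cs; apply: ler_wpM2r.
  by apply: mulr_ge0 => //; rewrite subr_ge0 ler1n.
apply: ler_wpM2r => //; apply: divr_ge0; last by rewrite addr_ge0.
exact: mulr_ge0.
Qed.

(** As [q M = (kk - 1) B], the condition reads [s q M * 2 kk d / (d + 2) <= 1], and [kk >= 2],
    [d >= 3] make the last factor at least [2 * 2 * 3/5 = 12/5]. *)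
Let sqM : s * (q * M) <= 5 / 12.
Proof.
have qM : q * M = (kk - 1) * B by rewrite /q /M; field; rewrite -natr1 -natr1 gt_eqF// ltr_wpDl.
set X := s * (q * M).
have X0 : 0 <= X by exact: mulr_ge0 (ltW s0) (mulr_ge0 q0 M0).
pose g : R := d / (d + 2).
have d3 : 3 <= d :> R by rewrite ler_nat.
have g0 : 3 / 5 <= g by rewrite ler_pdivlMr; lra.
have : X * (2 * kk * g) <= 1.
  by move: cs; rewrite /cond /X qM /g; apply: le_trans; rewrite le_eqVlt; apply/orP; left; apply/eqP; ring.
have : X * (2 * 2 * (3 / 5)) <= X * (2 * kk * g).
  by apply: ler_wpM2l => //; apply: ler_pM => //; rewrite ?ler_pM2l ?ler_nat//; lra.
by clearbody X g; lra.
Qed.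

Let Phi sg := heat (Num.sqrt sg) (fun y => (wflow sg y)%:E) w.

(** Averaging [wflow_step] over time [sg] turns its main term into [Phi (sg + de)] by the semigroup
    property; the error needs a finite exponential moment, uniform in [sg]. *)
Lemma Phi_step : exists2 C : R, 0 <= C & exists2 de1 : R, 0 < de1 &
  forall sg de : R, 0 <= sg -> 0 < de -> de <= de1 -> sg + de <= s ->
  (Phi sg <= Phi (sg + de) + (C * de ^+ 2)%:E)%E.
Proof.
have [C C0 hC] := wflow_step.
(* Chosen so that [6 e s = 1/4]: together with 5/12 this gives [s A <= 2/3]. *)
pose e : R := (24 * s)^-1.
have e0 : 0 < e by rewrite invr_gt0 mulr_gt0.
(* The growth rate of [wflow] plus that of [exp(3 e |x|^2) = exp(6 e |x|^2 / 2)]. *)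
pose A := q * M + 6 * e.
have A0 : 0 <= A by apply: addr_ge0; apply: mulr_ge0 => //; exact: ltW.
have sA : 3^-1 <= 1 - s * A.
  rewrite /A mulrDr (_ : s * (6 * e) = 4^-1); last by rewrite /e; field; rewrite gt_eqF.
  by move: sqM; set X := s * _; clearbody X; lra.
pose C4 := (C / e + (C / e) ^+ 2).
have C40 : 0 <= C4 by apply: addr_ge0 (sqr_ge0 _); exact: divr_ge0 C0 (ltW e0).
pose C5 := (mass * Num.sqrt (1 + s * M) ^- p.+3) `^ (- q).
have C50 : 0 <= C5 by exact: powR_ge0.
pose C6 := C4 * (expR (3 * e) * C5).
have C60 : 0 <= C6 by apply: mulr_ge0 C40 (mulr_ge0 (expR_ge0 _) C50).
pose C7 := Num.sqrt 3^-1 ^- p.+3 * expR (3 / 2 * A * sqnorm w).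
have C70 : 0 <= C7 by apply: mulr_ge0 (expR_ge0 _); rewrite invr_ge0 exprn_ge0// sqrtr_ge0.
have den0 : 0 < e / (C + 1) by apply: divr_gt0 => //; apply: ltr_wpDl.
exists (C6 * C7); first exact: mulr_ge0.
exists (Num.min 1 (e / (C + 1))); first by rewrite lt_min ltr01.
move=> sg de sg0 de0; rewrite le_min => /andP[de1 de2] sgs.
have sgs' : sg <= s by apply: le_trans sgs; rewrite lerDl ltW.
have deC : de * C <= e.
  have C1 : 0 < C + 1 by apply: ltr_wpDl.
  move: de2; rewrite ler_pdivlMr//; apply: le_trans.
  by apply: ler_wpM2l; [exact: ltW|rewrite lerDl].
have step y : ((wflow sg y)%:E <= heat (Num.sqrt de) (fun y => (wflow (sg + de) y)%:E) y +
    (C6 * de ^+ 2)%:E * (expR (A * sqnorm y / 2))%:E)%E.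
  apply: (le_trans (hC e e0 sg de y sg0 (cond_le sgs') de0 de1 deC)).
  apply: leeD2l; rewrite -EFinM lee_fin.
  have sg0s : 0 <= sg <= s by rewrite sg0.
  have h := wflow_le y sg0s.
  have E4 : 0 <= de ^+ 2 * (C4 * expR (3 * e * (1 + sqnorm y))).
    exact: mulr_ge0 (sqr_ge0 _) (mulr_ge0 C40 (expR_ge0 _)).
  apply: (le_trans (ler_wpM2l E4 h)); rewrite -/C5 le_eqVlt; apply/orP; left; apply/eqP.
  have -> : expR (3 * e * (1 + sqnorm y)) = expR (3 * e) * expR (3 * e * sqnorm y).
    by rewrite -expRD; congr expR; ring.
  have -> : expR (A * sqnorm y / 2) = expR (3 * e * sqnorm y) * expR (q * M * sqnorm y / 2).
    by rewrite -expRD; congr expR; rewrite /A; field.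
  by rewrite /C6; ring.
have wm := measurable_wflow (sg + de); have w0 := wflow_ge0 (sg + de).
have hm := measurable_heat (Num.sqrt de) wm w0.
have h0 := fun y => heat_ge0 (Num.sqrt de) y w0.
have em : measurable_fun setT (fun y : V => (expR (A * sqnorm y / 2))%:E).
  apply/measurable_EFinP; apply: measurableT_comp => //.
  by apply: measurable_funM => //; apply: measurable_funM => //; exact: measurable_sqnorm.
have e_ge0 (y : V) : (0 <= (expR (A * sqnorm y / 2))%:E)%E by rewrite lee_fin expR_ge0.
have k0 : (0 <= (C6 * de ^+ 2)%:E)%E by rewrite lee_fin; exact: mulr_ge0 C60 (sqr_ge0 _).
have kem : measurable_fun setT (fun y : V => (C6 * de ^+ 2)%:E * (expR (A * sqnorm y / 2))%:E)%E.
  exact: emeasurable_funM.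
have ke0 (y : V) : (0 <= (C6 * de ^+ 2)%:E * (expR (A * sqnorm y / 2))%:E)%E by exact: mule_ge0 k0 (e_ge0 y).
have main := @le_heat _ _ (Num.sqrt sg) _ _ w (measurable_wflow sg) (emeasurable_funD hm kem)
  (wflow_ge0 sg) step.
rewrite (heatD _ _ hm kem h0 ke0) (heatZ _ _ em e_ge0 k0) in main.
rewrite (heat_heat _ _ _ wm w0) ?sqrtr_gt0// !sqr_sqrtr ?(ltW de0)// in main.
apply: (le_trans main); apply: leeD2l.
have sg0s : 0 <= sg <= s by rewrite sg0.
have h := heat_exp_le w sg0s A0 sA.
rewrite (_ : C6 * C7 * _ = C6 * de ^+ 2 * C7); last by ring.
by rewrite [leRHS]EFinM; apply: lee_wpmul2l; [exact: k0|exact: h].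
Qed.

Lemma Phi_iter (C de : R) (n j : nat) : 0 <= C -> 0 < de -> n%:R * de = s ->
  (forall sg : R, 0 <= sg -> sg + de <= s -> (Phi sg <= Phi (sg + de) + (C * de ^+ 2)%:E)%E) ->
  (j <= n)%N -> (Phi 0 <= Phi (j%:R * de) + (j%:R * (C * de ^+ 2))%:E)%E.
Proof.
move=> C0 de0 nde step; elim: j => [|j IH] jn; first by rewrite !mul0r adde0.
apply: (le_trans (IH (ltnW jn))).
have jde : j%:R * de + de = j.+1%:R * de by rewrite -natr1; ring.
have h : (Phi (j%:R * de) <= Phi (j.+1%:R * de) + (C * de ^+ 2)%:E)%E.
  rewrite -jde; apply: step; first by apply: mulr_ge0 => //; exact: ltW.
  by rewrite jde -nde; apply: ler_wpM2r; [exact: ltW|rewrite ler_nat].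
apply: (le_trans (leeD2r _ h)); rewrite -addeA -EFinD.
rewrite (_ : C * de ^+ 2 + _ = j.+1%:R * (C * de ^+ 2))//.
by rewrite -natr1; ring.
Qed.

Lemma Phi0_le : (Phi 0 <= Phi s)%E.
Proof.
have [C C0 [de1 de10 step]] := Phi_step.
apply/lee_addgt0Pr => eps eps0.
(* Large enough for the step [s / N] to be admissible and for the accumulated error [C s^2 / N] to
   be at most [eps]. *)
pose N := (Num.truncn (s / de1 + C * s ^+ 2 / eps)).+1.
have sd0 : 0 <= s / de1 by apply: divr_ge0; exact: ltW.
have Cs0 : 0 <= C * s ^+ 2 / eps by apply: divr_ge0 (ltW eps0); exact: mulr_ge0 C0 (sqr_ge0 _).
have NN : s / de1 + C * s ^+ 2 / eps < N%:R by exact: truncnS_gt.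
have N0 : 0 < N%:R :> R by rewrite ltr0n.
have h1 : s / de1 <= N%:R by apply: le_trans (ltW NN); rewrite lerDl.
have h2 : C * s ^+ 2 / eps <= N%:R by apply: le_trans (ltW NN); rewrite lerDr.
pose de := s / N%:R.
have de0 : 0 < de by exact: divr_gt0.
have nde : N%:R * de = s by rewrite /de mulrC divfK// gt_eqF.
have dede : de <= de1 by move: h1; rewrite /de !ler_pdivrMr// mulrC.
have := Phi_iter C0 de0 nde (fun sg a b => step sg de a de0 dede b) (leqnn N).
rewrite nde => /le_trans; apply; apply: leeD2l; rewrite lee_fin.
rewrite (_ : N%:R * _ = C * s ^+ 2 / N%:R); last by rewrite /de; field; rewrite gt_eqF.
by move: h2; rewrite !ler_pdivrMr// [eps * _]mulrC.
Qed.

End iteration.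

Lemma heat_flow_pow_ge (s : R) (w : V) : 0 < s ->
  s * (kk * B * d / (d + 2)) * (2 * (kk - 1)) <= 1 ->
  (((rad 0 (sqnorm w) ^+ k.+2) `^ (- ((kk - 1) / kk)))%:E <=
   heat (Num.sqrt s) (fun y => (flow s y `^ (- ((kk - 1) / kk)))%:E) w)%E.
Proof.
move=> s0 cs; have := Phi0_le w s0 cs; apply: le_trans.
rewrite sqrtr0 heat0; last exact: wflow_ge0.
rewrite lee_fin /wflow; have : (flow 0 w)%:E = (rad 0 (sqnorm w) ^+ k.+2)%:E.
  by have := heat_flowE 0 w; rewrite sqrtr0 heat0; [move=> ->|exact: rad_sqnorm_ge0].
by move=> [->].
Qed.

End heat_flow.

(** * The harmonic marginal as a radial Laplace mixture *)

Section radial_substitution.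
Variables (R : realType) (p : nat) (s : R).
Hypothesis s0 : 0 < s.
Notation leb := (@lebesgue_measure R).

Let S (x : R) : R := Num.sqrt (1 + s ^+ 2 * x ^+ 2).

Let den_gt0 (x : R) : 0 < 1 + s ^+ 2 * x ^+ 2.
Proof. by apply: ltr_pwDl => //; exact: mulr_ge0 (sqr_ge0 _) (sqr_ge0 _). Qed.

Let S_gt0 x : 0 < S x. Proof. by rewrite sqrtr_gt0. Qed.

Let Ssq x : S x ^+ 2 = 1 + s ^+ 2 * x ^+ 2.
Proof. by rewrite sqr_sqrtr// ltW. Qed.

Let F (x : R) := x / S x.

Let is_derive_F (x : R) : is_derive x 1 F ((S x ^+ 3)^-1).
Proof.
have d2 : is_derive x 1 (fun x : R => 1 + s ^+ 2 * x ^+ 2) (s ^+ 2 * (2 * x)).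
  have e : is_derive x 1 (cst 1 + (s ^+ 2) \*: (fun x : R => x ^+ 2)) (0 + (s ^+ 2) *: (2 * x)).
    apply: is_deriveD; apply: is_deriveZ.
    have := @is_deriveX _ _ (@id R) 2 x 1 1 (@is_derive_id _ _ _ _).
    by rewrite exprfctE /GRing.scale/= mulr1 expr1.
  by rewrite add0r in e.
have dS : is_derive x 1 S ((2 * S x)^-1 * (s ^+ 2 * (2 * x))).
  exact: (@is_derive1_comp R Num.sqrt (fun x : R => 1 + s ^+ 2 * x ^+ 2) x _ _ (is_derive1_sqrt (den_gt0 x)) d2).
have dV := is_deriveV (lt0r_neq0 (S_gt0 x)) dS.
have dM := is_deriveM (@is_derive_id _ _ x 1) dV.
apply: (is_derive_eq dM); rewrite /GRing.scale/=.
have Sn0 := lt0r_neq0 (S_gt0 x).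
have e : s ^+ 2 * x ^+ 2 = S x ^+ 2 - 1 by rewrite Ssq addrC addKr.
rewrite (_ : x * _ = - ((s ^+ 2 * x ^+ 2) / S x ^+ 3)); last by field; exact: Sn0.
by rewrite e; field; exact: Sn0.
Qed.

Let cont_S : continuous S.
Proof.
move=> x; apply: (@continuous_comp _ _ _ (fun x : R => 1 + s ^+ 2 * x ^+ 2) Num.sqrt); last exact: sqrt_continuous.
apply: cvgD; first exact: cvg_cst.
by apply: cvgM; [exact: cvg_cst|exact: exprn_continuous].
Qed.

Let cont_F : continuous F.
Proof.
move=> x; apply: cvgM; first exact: cvg_id.
by apply: cvgV; [exact: lt0r_neq0|exact: cont_S].
Qed.

Let dF : F^`()%classic = fun x => (S x ^+ 3)^-1.
Proof. by apply/funext => x; rewrite derive1E; exact: (@derive_val _ _ _ _ _ _ _ (is_derive_F x)). Qed.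

Let cont_dF : continuous F^`()%classic.
Proof.
rewrite dF => x; apply: cvgV; first by rewrite expf_neq0// lt0r_neq0.
apply: (@continuous_comp _ _ _ S (fun y => y ^+ 3)); first exact: cont_S.
exact: exprn_continuous.
Qed.

Let incr x y : 0 <= x -> x < y -> F x < F y.
Proof.
move=> x0 xy; have y0 : 0 <= y by exact: le_trans (ltW xy).
rewrite /F ltr_pdivrMr// mulrAC ltr_pdivlMr//.
rewrite -(@ltr_pXn2r _ 2) ?nnegrE ?mulr_ge0 ?(ltW (S_gt0 _))// !exprMn !Ssq.
have : x ^+ 2 < y ^+ 2 by rewrite ltr_pXn2r ?nnegrE.
lra.
Qed.

Hypothesis K0 : 0 < s^-1.

Let F_lt x : 0 <= x -> F x < s^-1.
Proof.
move=> x0; rewrite /F ltr_pdivrMr// ltr_pdivlMl//.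
rewrite -(@ltr_pXn2r _ 2) ?nnegrE ?mulr_ge0 ?(ltW (S_gt0 _)) ?(ltW s0)// !exprMn Ssq.
by rewrite ltrDr.
Qed.

(** [x <= F n] means [n^2 >= x^2 / (1 - s^2 x^2)]; an [n >= 1] above this bound suffices, since
    [n^2 >= n]. *)
Let F_cofinal x : 0 <= x -> x < s^-1 -> exists n : nat, x <= F n%:R.
Proof.
move=> x0 xs.
have sx : s * x < 1 by rewrite -ltr_pdivlMl// mulr1.
have h : 0 < 1 - s ^+ 2 * x ^+ 2.
  by rewrite subr_gt0 -exprMn exprn_ilt1// mulr_ge0// ltW.
pose z := x ^+ 2 / (1 - s ^+ 2 * x ^+ 2).
exists (Num.truncn z).+1; set n := (_.+1)%:R.
have nz : z < n by exact: truncnS_gt.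
have n1 : 1 <= n by rewrite /n ler1n.
have n0 : 0 <= n by exact: le_trans n1.
rewrite /F ler_pdivlMr// -(@ler_pXn2r _ 2) ?nnegrE ?mulr_ge0 ?(ltW (S_gt0 _))// exprMn Ssq.
have h1 : x ^+ 2 <= n * (1 - s ^+ 2 * x ^+ 2) by rewrite -ler_pdivrMr// ltW.
have h2 : n * (1 - s ^+ 2 * x ^+ 2) <= n ^+ 2 * (1 - s ^+ 2 * x ^+ 2).
  by rewrite ler_wpM2r ?(ltW h)// expr2 ler_peMl.
lra.
Qed.

(** Substitute [eta = x / S(x)] with [S(x) = sqrt(1 + s^2 x^2)], which maps the half-line onto
    [[0, 1/s)]. The Jacobian takes [S^(-3)] out of the prefactor [S^(-(p+3))], and the rest turns
    [x^p] into [eta^p]. This fixes the cut-off [K = 1/s]. *)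
Lemma radial_substitution r :
  (\int[leb]_(x in `[0%R, +oo[) (x ^+ p * gauss_kernel p.+3 (x ^+ 2) s r)%:E)%E =
  (radmom p K0 0 r)%:E.
Proof.
pose G (x : R) := x ^+ p * expR (- x ^+ 2 * r / 2).
pose f (x : R) := x ^+ p * gauss_kernel p.+3 (x ^+ 2) s r.
have step (n : nat) : (\int[leb]_(x in `[0%R, F n%:R]) (G x)%:E = \int[leb]_(x in `[0%R, n%:R]) (f x)%:E)%E.
  have F0 : F 0 = 0 by rewrite /F mul0r.
  rewrite -[in LHS]F0 (@integration_by_substitution_increasing R F G 0 n%:R).
  - apply: eq_integral => x _; rewrite fctE /= dF; congr EFin.
    have e3 : S x ^- p.+3 = (S x ^+ 3)^-1 * (S x ^+ p)^-1 by rewrite -invfM -exprD.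
    rewrite /G /f /gauss_kernel -/(S x) e3 -Ssq.
    rewrite [F x ^+ p]expr_div_n [F x ^+ 2]expr_div_n.
    have -> : - (x ^+ 2 / S x ^+ 2) * r / 2 = - (x ^+ 2 * r) / (2 * S x ^+ 2).
      by field; exact: lt0r_neq0.
    by ring.
  - exact: ler0n.
  - by move=> x y; rewrite !in_itv/= => /andP[x0 _] _; exact: incr.
  - by move=> x _; exact: cont_dF.
  - by apply: (cvgP (F^`()%classic 0)); apply: cvg_at_right_filter; exact: cont_dF.
  - by apply: (cvgP (F^`()%classic n%:R)); apply: cvg_at_left_filter; exact: cont_dF.
  - split.
    + by move=> x _; have [] := is_derive_F x.
    + by apply: cvg_at_right_filter; exact: cont_F.
    + by apply: cvg_at_left_filter; exact: cont_F.
  - by apply: continuous_subspaceT; exact: cont_pow_exp.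
have mf : measurable_fun setT (fun x => (f x)%:E).
  apply/measurable_EFinP; apply: measurable_funM => //.
  by apply: (measurableT_comp (measurable_gauss_kernel p.+3 s r)).
have mG : measurable_fun setT (fun x => (G x)%:E).
  by apply/measurable_EFinP; apply: continuous_measurable_fun; exact: cont_pow_exp.
have cf : (\int[leb]_(x in `[0%R, n%:R]) (f x)%:E)%E @[n --> \oo] -->
    (\int[leb]_(x in `[0%R, +oo[) (f x)%:E)%E.
  rewrite (_ : `[0%R, +oo[%classic = \bigcup_n (`[0%R, n%:R]%classic : set R)); last first.
    apply/seteqP; split => x /=.
      rewrite in_itv/= andbT => x0; exists (Num.truncn x).+1 => //=.
      by rewrite in_itv/= x0 ltW// truncnS_gt.
    by move=> [n _ /=]; rewrite !in_itv/= andbT => /andP[].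
  apply: ge0_nondecreasing_set_cvg_integral => //.
  - move=> m n mn; apply/subsetPset => x /=; rewrite !in_itv/= => /andP[-> xm]/=.
    by rewrite (le_trans xm)// ler_nat.
  - by move=> n; exact: measurable_funTS.
  - move=> n x /=; rewrite in_itv/= => /andP[x0 _]; rewrite lee_fin mulr_ge0 ?exprn_ge0//.
    exact: gauss_kernel_ge0.
have cG : (\int[leb]_(x in `[0%R, F n%:R]) (G x)%:E)%E @[n --> \oo] -->
    (\int[leb]_(x in `[0%R, (s^-1)%R]) (G x)%:E)%E.
  rewrite -integral_itv_bndo_bndc; last exact: measurable_funTS.
  rewrite (_ : [set` Interval _ _] = \bigcup_n (`[0%R, F n%:R]%classic : set R)); last first.
    apply/seteqP; split => x /=.
      rewrite in_itv/= => /andP[x0 /(F_cofinal x0)[n xn]]; exists n => //=.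
      by rewrite in_itv/= x0.
    move=> [n _ /=]; rewrite !in_itv/= => /andP[-> xn]/=.
    by apply: le_lt_trans xn _; exact: F_lt.
  apply: ge0_nondecreasing_set_cvg_integral => //.
  - move=> m n; rewrite leq_eqVlt => /predU1P[->//|mn]; apply/subsetPset => x /=; rewrite !in_itv/= => /andP[-> xm]/=.
    by apply: (le_trans xm); apply: ltW; apply: incr => //; rewrite ltr_nat.
  - by move=> n; exact: measurable_funTS.
  - move=> n x /=; rewrite in_itv/= => /andP[x0 _].
    by rewrite lee_fin mulr_ge0 ?exprn_ge0 ?expR_ge0.
have -> : (radmom p K0 0 r)%:E = (\int[leb]_(x in `[0%R, (s^-1)%R]) (G x)%:E)%E.
  rewrite radE /Rintegral fineK; last first.
    by rewrite addn0; apply: integrable_fin_num => //; exact: itv_integrable.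
  by rewrite addn0.
transitivity (\int[leb]_(x in `[0%R, +oo[) (f x)%:E)%E => //.
rewrite -(cvg_lim (@ereal_hausdorff R) cf) -(cvg_lim (@ereal_hausdorff R) cG).
by congr (lim (_ @ \oo)); apply/funext => n; rewrite step.
Qed.

End radial_substitution.

Section half_gaussian.
Variables (R : realType) (p : nat).
Notation leb := (@lebesgue_measure R).
Notation half := (\1_(`[0, +oo[%classic : set R) : R -> R).

Lemma half_scale (a x : R) : 0 < a -> half (a * x) = half x.
Proof.
move=> a0; rewrite !indicE; congr ((nat_of_bool _)%:R).
by apply/idP/idP => /set_mem/=; rewrite in_itv/= andbT => h; apply/mem_set;
   rewrite /= in_itv/= andbT; move: h; rewrite pmulr_rge0.
Qed.

Lemma half_pow_ge0 (x : R) : 0 <= half x * x ^+ p.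
Proof.
rewrite indicE; have [/set_mem/=|] := boolP (_ \in _); last by rewrite mul0r.
by rewrite in_itv/= andbT mul1r => /exprn_ge0; exact.
Qed.

Lemma measurable_half : measurable_fun setT half.
Proof. exact: measurable_indic. Qed.

Lemma integral_half (f : R -> R) :
  (\int[leb]_x (half x * f x)%:E = \int[leb]_(x in `[0%R, +oo[) (f x)%:E)%E.
Proof.
rewrite [RHS]integral_mkcond; apply: eq_integral => x _.
by rewrite patchE indicE; case: ifP => _; rewrite ?mul1r ?mul0r.
Qed.

(** The half-line enters as an indicator factor so that scaling and Tonelli can be used over the
    whole line. *)
Definition half_gauss (r : R) : \bar R :=
  (\int[leb]_x (half x * x ^+ p * expR (- x ^+ 2 * r / 2))%:E)%E.

Lemma measurable_half_gauss_integrand (r : R) :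
  measurable_fun setT (fun x : R => (half x * x ^+ p * expR (- x ^+ 2 * r / 2))%:E).
Proof.
apply/measurable_EFinP; apply: measurable_funM.
  by apply: measurable_funM; [exact: measurable_half|].
by apply: continuous_measurable_fun => x; have := @cont_pow_exp R 0 r x;
  under eq_fun do rewrite expr0 mul1r.
Qed.

Lemma half_gauss_integrand_ge0 (r x : R) :
  (0 <= (half x * x ^+ p * expR (- x ^+ 2 * r / 2))%:E)%E.
Proof. by rewrite lee_fin; exact: mulr_ge0 (half_pow_ge0 x) (expR_ge0 _). Qed.

(** At [r = |x|^2] this represents [|x|^(-(p+1)) = |x|^(-(d-2))], the harmonic prior, as a mixture
    of Gaussian functions. *)
Lemma half_gauss_scale r : 0 < r ->
  half_gauss r = ((Num.sqrt r ^- p.+1)%:E * half_gauss 1)%E.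
Proof.
move=> r0; have s0 : 0 < (Num.sqrt r)^-1 by rewrite invr_gt0 sqrtr_gt0.
set a := (Num.sqrt r)^-1 in s0 *.
rewrite /half_gauss (@ge0_integral_affine _ _ a 0 (lt0r_neq0 s0)
  (measurable_half_gauss_integrand r) (half_gauss_integrand_ge0 r)).
have h (x : R) : (half (0 + a * x) * (0 + a * x) ^+ p * expR (- (0 + a * x) ^+ 2 * r / 2))%:E =
    ((a ^+ p)%:E * (half x * x ^+ p * expR (- x ^+ 2 * 1 / 2))%:E)%E.
  rewrite add0r half_scale// exprMn -EFinM; congr EFin.
  have -> : - (a * x) ^+ 2 * r / 2 = - x ^+ 2 * 1 / 2.
    rewrite exprMn /a exprVn sqr_sqrtr ?(ltW r0)//; field; exact: lt0r_neq0.
  by ring.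
under eq_integral do rewrite h.
rewrite ge0_integralZl//; last 3 first.
- exact: measurable_half_gauss_integrand.
- by move=> x _; exact: half_gauss_integrand_ge0.
- by rewrite lee_fin exprn_ge0// ltW.
by rewrite muleA -EFinM gtr0_norm// -exprVn exprS.
Qed.

(** The value is irrelevant, since the constant cancels in the predictive density; positivity and
    finiteness are what matters. *)
Lemma half_gauss1 : exists2 c : R, 0 < c & half_gauss 1 = c%:E.
Proof.
have ge0 : (0 <= half_gauss 1)%E.
  by apply: integral_ge0 => x _; exact: half_gauss_integrand_ge0.
have pos : (0 < half_gauss 1)%E.
  have h1 : 0 < (1 : R) by [].
  apply: (@lt_le_trans _ _ (radmom p h1 0 1)%:E); first by rewrite lte_fin rad0_gt0.
  rewrite radE /Rintegral fineK; last first.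
    by rewrite addn0; apply: integrable_fin_num => //; exact: itv_integrable.
  rewrite addn0 /half_gauss.
  under [leRHS]eq_integral do rewrite -mulrA.
  rewrite integral_half.
  apply: ge0_subset_integral => //=.
  - by apply: measurable_funTS; apply/measurable_EFinP; apply: continuous_measurable_fun; exact: cont_pow_exp.
  - by move=> x; rewrite in_itv/= andbT => x0; rewrite lee_fin mulr_ge0 ?exprn_ge0 ?expR_ge0.
  - by move=> x /=; rewrite !in_itv/= andbT => /andP[].
have fin : (half_gauss 1 < +oo)%E.
  (* From [x^p <= (p+1)^p exp(x)] and [x - x^2 / 2 <= 1 - x^2 / 4]; the last factor undoes the
     normalisation in [integral_gauss1], used with [A = -1/2]. *)
  pose D : R := p.+1%:R ^+ p * expR 1 * Num.sqrt (2 * pi).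
  have pi0 : 0 < Num.sqrt (2 * pi) :> R by rewrite sqrtr_gt0 mulr_gt0 ?pi_gt0.
  have A0 : 0 < 1 + 1 ^+ 2 * (- 2^-1) :> R by rewrite expr1n mul1r subr_gt0 invf_lt1// ltr1n.
  have bound (x : R) : ((half x * x ^+ p * expR (- x ^+ 2 * 1 / 2))%:E <=
      D%:E * ((Num.sqrt (2 * pi))^-1 * expR (- x ^+ 2 / 2) * expR (- - 2^-1 * (0 + 1 * x) ^+ 2 / 2))%:E)%E.
    rewrite -EFinM lee_fin.
    have -> : D * ((Num.sqrt (2 * pi))^-1 * expR (- x ^+ 2 / 2) * expR (- - 2^-1 * (0 + 1 * x) ^+ 2 / 2)) =
        p.+1%:R ^+ p * expR (1 + - x ^+ 2 / 4).
      have -> : expR (1 + - x ^+ 2 / 4) = expR 1 * (expR (- x ^+ 2 / 2) * expR (- - 2^-1 * (0 + 1 * x) ^+ 2 / 2)) :> R.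
        by rewrite -!expRD; congr expR; field.
      by rewrite /D; field; exact: lt0r_neq0.
    rewrite indicE; have [/set_mem/=|_] := boolP (_ \in _); last first.
      by rewrite !mul0r mulr_ge0 ?exprn_ge0 ?expR_ge0.
    rewrite in_itv/= andbT mul1r => x0.
    have xp : x <= p.+1%:R * expR (x / p.+1%:R).
      rewrite -ler_pdivrMl// mulrC; apply: le_trans (expR_ge1Dx _).
      by rewrite lerDr.
    have xpp : x ^+ p <= p.+1%:R ^+ p * expR x.
      apply: (@le_trans _ _ ((p.+1%:R * expR (x / p.+1%:R)) ^+ p)).
        by rewrite lerXn2r ?nnegrE// mulr_ge0 ?expR_ge0.
      rewrite exprMn -expRM_natl ler_wpM2l ?exprn_ge0// ler_expR.
      rewrite mulrCA ler_piMr// ler_pdivrMr// mul1r ler_nat//.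
    have /le_trans := ler_wpM2r (expR_ge0 (- x ^+ 2 * 1 / 2)) xpp; apply.
    rewrite -[leLHS]mulrA -expRD.
    rewrite ler_wpM2l ?exprn_ge0// ler_expR.
    have : 0 <= (x / 2 - 1) ^+ 2 by exact: sqr_ge0.
    by lra.
  have mb : measurable_fun setT (fun x : R => ((Num.sqrt (2 * pi))^-1 * expR (- x ^+ 2 / 2) * expR (- - 2^-1 * (0 + 1 * x) ^+ 2 / 2))%:E).
    apply/measurable_EFinP; apply: measurable_funM.
      apply: measurable_funM => //; apply: measurableT_comp => //.
      by apply: measurable_funM => //; apply: measurableT_comp.
    apply: measurableT_comp => //; apply: measurable_funM => //; apply: measurable_funM => //.
    by apply: measurable_funX; apply: measurable_funD => //; apply: measurable_funM.
  have b0 (x : R) : (0 <= ((Num.sqrt (2 * pi))^-1 * expR (- x ^+ 2 / 2) * expR (- - 2^-1 * (0 + 1 * x) ^+ 2 / 2))%:E)%E.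
    by rewrite lee_fin; apply: mulr_ge0 (mulr_ge0 _ (expR_ge0 _)) (expR_ge0 _); rewrite invr_ge0 ltW.
  have D0 : (0 <= D%:E)%E.
    by rewrite lee_fin; apply: mulr_ge0 (mulr_ge0 (exprn_ge0 _ _) (expR_ge0 _)) (ltW pi0).
  apply: (@le_lt_trans _ _ (\int[leb]_x (D%:E * ((Num.sqrt (2 * pi))^-1 * expR (- x ^+ 2 / 2) * expR (- - 2^-1 * (0 + 1 * x) ^+ 2 / 2))%:E))%E).
    apply: ge0_le_integral => //.
    - by move=> x _; exact: half_gauss_integrand_ge0.
    - exact: measurable_half_gauss_integrand.
    - exact: emeasurable_funM.
  by rewrite ge0_integralZl// integral_gauss1// -EFinM ltry.
have finn : half_gauss 1 \is a fin_num by rewrite ge0_fin_numE.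
by exists (fine (half_gauss 1)); [rewrite fine_gt0// pos fin|rewrite fineK].
Qed.

End half_gaussian.

Section harmonic_marginal.
Variables (R : realType) (p : nat) (v : R).
Hypotheses (v0 : 0 < v) (K0 : 0 < (Num.sqrt v)^-1).
Notation V := 'rV[R]_p.+3.
Notation leb := (@lebesgue_measure R).
Notation vol := (row_lebesgue R p.+3).
Notation half := (\1_(`[0, +oo[%classic : set R) : R -> R).

Let origin : set V := [set x | sqnorm x = 0].

Let measurable_origin : measurable origin.
Proof.
have -> : origin = setT `&` (@sqnorm R p.+3) @^-1` [set 0] by rewrite setTI.
by apply: measurable_sqnorm => //; exact: measurable_set1.
Qed.

(* Scaling by 2 multiplies the volume of the origin by [2 ^ (p + 3)] while
   fixing the set, and comparison with a Gaussian shows it to be finite. *)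
Lemma negligible_origin : vol origin = 0%E.
Proof.
have mi : measurable_fun setT (fun x : V => (\1_origin x : R)%:E).
  by apply/measurable_EFinP; exact: measurable_indic.
have i0 (x : V) : (0 <= (\1_origin x : R)%:E)%E by rewrite lee_fin indicE.
have E : (\int[vol]_x (\1_origin x : R)%:E = vol origin)%E.
  by have := integral_indic vol measurableT measurable_origin; rewrite setIT.
have n2 : (2 : R) != 0 by [].
have h := ge0_row_lebesgue_affine 0 n2 mi i0.
have h2 : (\int[vol]_x (\1_origin (0 + 2 *: x) : R)%:E = vol origin)%E.
  rewrite -E; apply: eq_integral => x _; rewrite add0r !indicE; congr ((nat_of_bool _)%:R)%:E.
  apply/idP/idP => /set_mem z; apply/mem_set; move: z; rewrite /origin /= sqnormZ.
    by move/eqP; rewrite mulf_eq0 expf_eq0/= pnatr_eq0/= => /eqP.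
  by move=> ->; rewrite mulr0.
rewrite E h2 in h.
have fin : (vol origin < +oo)%E.
  rewrite -E; pose c : R := phi 1 (0 : V).
  have c0 : 0 < c by exact: phi_gt0.
  apply: (@le_lt_trans _ _ (\int[vol]_x ((c^-1)%:E * (phi 1 x)%:E))%E).
    apply: ge0_le_integral => //.
    - by apply: emeasurable_funM => //; exact: measurable_phiE.
    - move=> x _; rewrite -EFinM lee_fin indicE.
      have [/set_mem/= x0|_] := boolP (_ \in _); last first.
        by rewrite mulr_ge0 ?invr_ge0 ?phi_ge0// ltW.
      have -> : phi 1 x = c.
        have x0' : sqnorm x = 0 by exact: x0.
        have z0 : sqnorm (0 : V) = 0 by rewrite /sqnorm big1// => i _; rewrite mxE expr0n.
        by rewrite /c /phi x0' z0.
      by rewrite mulVf// lt0r_neq0.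
  rewrite ge0_integralZl//; last 3 first.
  - exact: measurable_phiE.
  - by move=> x _; exact: phiE_ge0.
  - by rewrite lee_fin invr_ge0 ltW.
  by rewrite integral_phi1 mule1 ltry.
have fn : vol origin \is a fin_num by rewrite ge0_fin_numE.
rewrite -(fineK fn) -EFinM in h; case: h => h.
have g1 : 1 < `|2 : R| ^+ p.+3 by rewrite ger0_norm// exprn_egt1// ltr1n.
apply/eqP; rewrite -(fineK fn) eqe; apply/eqP.
move: h g1; set z := fine _; set g := _ ^+ _ => h g1.
have : (g - 1) * z = 0 by rewrite mulrBl mul1r -h subrr.
by move/eqP; rewrite mulf_eq0 subr_eq0 gt_eqF//= => /eqP.
Qed.

(** The prior is written as a Gaussian mixture, the [mu]-integral is taken first and gives a kernel,
    and [radial_substitution] performs the remaining one. *)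
Lemma mH_radial : exists2 c : R, 0 < c &
  forall w : V, mH w v = (c * radmom p K0 0 (sqnorm w))%:E.
Proof.
have [c c0 hc] := half_gauss1 R p.
exists c^-1; first by rewrite invr_gt0.
move=> w.
have s0 : 0 < Num.sqrt v by rewrite sqrtr_gt0.
pose f (x : V) := (phi v (w - x) * enorm x ^- p.+1)%:E.
have mphi : measurable_fun setT (fun x : V => (phi v (w - x))%:E).
  apply: measurable_phiE; rewrite (_ : (fun x : V => w - x) = (fun x => w + (- 1) *: x)).
    exact: measurable_rowDZ.
  by apply/funext => x; rewrite scaleN1r.
have mf : measurable_fun setT f.
  rewrite (_ : f = fun x : V => ((phi v (w - x))%:E * (enorm x ^- p.+1)%:E)%E).
    apply: emeasurable_funM => //; apply/measurable_EFinP.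
    apply: (measurableT_comp (@measurable_invr R)); apply: measurable_funX.
    by apply: (measurableT_comp (@measurable_sqrtr R)); exact: measurable_sqnorm.
  by apply/funext => x; rewrite -EFinM.
have f0 x : (0 <= f x)%E.
  by rewrite lee_fin mulr_ge0 ?phi_ge0// invr_ge0 exprn_ge0// sqrtr_ge0.
have -> : mH w v = (\int[vol]_x f x)%E by exact: intRdE.
pose k (q : V * R) : \bar R := ((phi v (w - q.1))%:E *
   (half q.2 * q.2 ^+ p * expR (- q.2 ^+ 2 * sqnorm q.1 / 2))%:E)%E.
have mk : measurable_fun setT (k : V * measurableTypeR R -> \bar R).
  apply: emeasurable_funM; first by apply: (measurableT_comp mphi).
  apply/measurable_EFinP; apply: measurable_funM.
    apply: measurable_funM; last exact: measurable_funX.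
    by apply: (measurableT_comp (@measurable_half R)).
  apply: measurableT_comp => //; apply: measurable_funM => //; apply: measurable_funM.
    by apply: measurableT_comp => //; exact: measurable_funX.
  exact: measurable_sqnorm.
have k0 q : (0 <= k q)%E.
  by apply: mule_ge0; [exact: phiE_ge0|exact: half_gauss_integrand_ge0].
have main : (c%:E * \int[vol]_x f x = (radmom p K0 0 (sqnorm w))%:E)%E.
  rewrite -ge0_integralZl//; last by rewrite lee_fin ltW.
  have inner (x : V) : (\int[leb]_y k (x, y) = (phi v (w - x))%:E * half_gauss p (sqnorm x))%E.
    rewrite /k /= ge0_integralZl//.
    - exact: measurable_half_gauss_integrand.
    - by move=> y _; exact: half_gauss_integrand_ge0.
    - exact: phiE_ge0.
  transitivity (\int[vol]_x \int[leb]_y k (x, y))%E.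
    (* Equality holds only almost everywhere: at the origin the inverse norm is 0 by convention
       while the mixture integral diverges. *)
    apply: ge0_ae_eq_integral => //.
    - exact: emeasurable_funM.
    - exact: (@measurable_fun_fubini_tonelli_F _ _ _ _ _ leb _ mk).
    - by move=> x _; apply: mule_ge0 => //; rewrite lee_fin ltW.
    - by move=> x _; apply: integral_ge0 => y _; exact: k0.
    exists origin; split; [exact: measurable_origin|exact: negligible_origin|].
    move=> x /=; apply: contra_notP => xn _; rewrite inner.
    have r0 : 0 < sqnorm x by rewrite lt0r sqnorm_ge0 andbT; apply/eqP.
    by rewrite half_gauss_scale// hc /f -!EFinM; congr EFin; rewrite /enorm; ring.
  rewrite (fubini_tonelli (m2 := leb) k mk k0) -(radial_substitution p s0 K0) -integral_half.
  apply: eq_integral => y _.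
  have g0 (x : V) : (0 <= (expR (- y ^+ 2 * sqnorm x / 2))%:E)%E by rewrite lee_fin expR_ge0.
  have mg : measurable_fun setT (fun x : V => (expR (- y ^+ 2 * sqnorm x / 2))%:E).
    apply/measurable_EFinP; apply: measurableT_comp => //.
    by apply: measurable_funM => //; apply: measurable_funM => //; exact: measurable_sqnorm.
  have yp : (0 <= (half y * y ^+ p)%:E)%E by rewrite lee_fin half_pow_ge0.
  transitivity ((half y * y ^+ p)%:E * \int[vol]_x ((phi (Num.sqrt v ^+ 2) (x - w))%:E * (expR (- y ^+ 2 * sqnorm (0 + x) / 2))%:E))%E.
    have mm : measurable_fun setT (fun x : V => (phi (Num.sqrt v ^+ 2) (x - w))%:E * (expR (- y ^+ 2 * sqnorm (0 + x) / 2))%:E)%E.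
      apply: emeasurable_funM; first by apply: measurable_phiE; exact: measurable_rowD.
      by under eq_fun do rewrite add0r.
    have mm0 (x : V) : (0 <= (phi (Num.sqrt v ^+ 2) (x - w))%:E * (expR (- y ^+ 2 * sqnorm (0 + x) / 2))%:E)%E.
      by apply: mule_ge0; [exact: phiE_ge0|rewrite lee_fin expR_ge0].
    rewrite -(ge0_integralZl _ measurableT mm (fun x _ => mm0 x) yp).
    apply: eq_integral => x _; rewrite /k /= [X in (_ * X)%E]EFinM muleCA add0r sqr_sqrtr ?(ltW v0)//.
    have -> // : phi v (w - x) = phi v (x - w).
    have -> : w - x = -1 *: (x - w) by rewrite scaleN1r opprB.
    by rewrite /phi sqnormZ sqrrN expr1n mul1r.
  rewrite (@heat_densityE _ _ (Num.sqrt v) _ 0 w s0 mg g0) add0r.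
  have den : 0 < 1 + Num.sqrt v ^+ 2 * y ^+ 2.
    by apply: ltr_pwDl => //; exact: mulr_ge0 (sqr_ge0 _) (sqr_ge0 _).
  rewrite (mulrA (half y)) [RHS]EFinM -(integral_gaussN w den); congr (_ * _)%E.
rewrite EFinM -main muleA -EFinM mulVf ?mul1e//.
exact: lt0r_neq0.
Qed.

End harmonic_marginal.

(** * Powers, Young's inequality and Gaussian domination *)

Section powers.
Variable R : realType.
Implicit Types a b q : R.

Lemma powR_gt0E a q : 0 < a -> a `^ q = expR (q * ln a).
Proof. by move=> a0; rewrite /powR gt_eqF. Qed.

Lemma powR_div a b q : 0 < a -> 0 < b -> (a / b) `^ q = a `^ q * b `^ (- q).
Proof.
move=> a0 b0; rewrite !powR_gt0E ?divr_gt0// ln_div ?posrE// -expRD.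
by congr expR; ring.
Qed.

Lemma powR_div_mul a b q : 0 < a -> 0 < b -> (a / b) `^ q * b = a `^ q * b `^ (1 - q).
Proof.
move=> a0 b0; rewrite powR_div// -mulrA; congr (_ * _).
rewrite !powR_gt0E//; have := lnK (x := b); rewrite posrE => /(_ b0) h.
by rewrite -[X in _ * X = _]h -expRD; congr expR; ring.
Qed.

Lemma ln_le_tangent a b : 0 < a -> 0 < b -> ln a <= ln b + a / b - 1.
Proof.
move=> a0 b0; have ab : 0 < a / b by exact: divr_gt0.
have := expR_ge1Dx (ln (a / b)); rewrite lnK ?posrE// ln_div ?posrE//.
lra.
Qed.

(** Concavity of [ln]: the tangents at the weighted mean [m], evaluated at [a] and [b], average to
    [ln m]. *)
Lemma young_powR a b q : 0 < a -> 0 < b -> 0 < q -> q < 1 ->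
  a `^ q * b `^ (1 - q) <= q * a + (1 - q) * b.
Proof.
move=> a0 b0 q0 q1; pose m := q * a + (1 - q) * b; rewrite -/m.
have q'0 : 0 < 1 - q by rewrite subr_gt0.
have m0 : 0 < m by exact: addr_gt0 (mulr_gt0 q0 a0) (mulr_gt0 q'0 b0).
rewrite !powR_gt0E// -expRD.
have mE : expR (ln m) = m by rewrite lnK ?posrE.
rewrite -[leRHS]mE ler_expR.
have h1 := ler_wpM2l (ltW q0) (ln_le_tangent a0 m0).
have h2 := ler_wpM2l (ltW q'0) (ln_le_tangent b0 m0).
have e : q * (a / m) + (1 - q) * (b / m) = 1.
  by rewrite !mulrA -mulrDl -/m divff// gt_eqF.
lra.
Qed.

End powers.

Section gaussian_bounds.
Variables (R : realType) (n : nat).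
Notation V := 'rV[R]_n.

Lemma phi_dominated (s2 eps : R) (y m : V) : 0 < s2 -> 0 < eps -> eps * (4 * s2) <= 1 ->
  phi s2 (y - m) <=
  Num.sqrt (2 * pi * s2) ^- n * expR (sqnorm m / (2 * s2)) * expR (- eps * sqnorm y).
Proof.
move=> s0 e0 es; rewrite /phi -[leRHS]mulrA -expRD.
apply: ler_wpM2l; first by rewrite invr_ge0 exprn_ge0// sqrtr_ge0.
rewrite ler_expR.
have h : sqnorm y <= 2 * sqnorm (y - m) + 2 * sqnorm m.
  have h1 := sqnormD (y - m) m; rewrite subrK in h1.
  have h2 := sqnormD (y - m) (-1 *: m).
  have h3 := sqnorm_ge0 (y - m + -1 *: m).
  rewrite h2 dotrZr sqnormZ in h3; rewrite h1; lra.
have y0 := sqnorm_ge0 y.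
have h4 : eps * (4 * s2) * sqnorm y <= sqnorm y by rewrite ler_piMl.
have h5 : (eps * sqnorm y) * (2 * s2) <= sqnorm (y - m) + sqnorm m by lra.
have h6 : eps * sqnorm y <= (sqnorm (y - m) + sqnorm m) / (2 * s2).
  by rewrite ler_pdivlMr// mulr_gt0.
rewrite !mulNr; move: h6; rewrite mulrDl; lra.
Qed.

Lemma phiN s2 (z : V) : phi s2 (- z) = phi s2 z.
Proof.
have -> : - z = -1 *: z by rewrite scaleN1r.
by rewrite /phi sqnormZ sqrrN expr1n mul1r.
Qed.

Lemma heat_opp (c : R) (g : V -> \bar R) x : measurable_fun setT g ->
  (forall y, (0 <= g y)%E) -> heat (- c) g x = heat c g x.
Proof.
move=> mg g0.
have mi := measurable_heat_section (- c) x mg.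
have i0 (z : V) : (0 <= (phi 1 z)%:E * g (x + - c *: z)%R)%E by exact: mule_ge0 (phiE_ge0 _ _) (g0 _).
have n1 : (- 1 : R) != 0 by rewrite oppr_eq0 oner_eq0.
rewrite [LHS](ge0_row_lebesgue_affine 0 n1 mi i0) normrN normr1 expr1n mul1e.
apply: eq_integral => z _; rewrite add0r scaleN1r phiN.
by rewrite scalerN scaleNr opprK.
Qed.

End gaussian_bounds.

(** * Risk of mixture-type predictive densities *)

Section mixture_risk.
Variables (R : realType) (n k : nat) (alpha vx vy : R) (mu : 'rV[R]_n).
Notation V := 'rV[R]_n.
Notation kk := (k.+2%:R : R).
Notation vol := (row_lebesgue R n).
Hypotheses (vx0 : 0 < vx) (vy0 : 0 < vy) (alphaE : alpha = 1 - 2 / kk).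

Let q : R := (kk - 1) / kk.
Let b : R := kk^-1.
Let g := gamma alpha vx vy.
Let u := vy / g.
Let v := vx * g.
Let ze := Num.sqrt u.
Let h := xi alpha vx vy.
Let c : R := 4 / (1 - alpha ^+ 2).

Let kk2 : 2 <= kk. Proof. by rewrite ler_nat. Qed.
Let kk0 : 0 < kk. Proof. by rewrite ltr0n. Qed.
Let b0 : 0 < b. Proof. by rewrite invr_gt0. Qed.
Let b12 : b <= 1 / 2. Proof. by rewrite /b div1r lef_pV2 ?posrE. Qed.
Let qE : q = 1 - b.
Proof. by rewrite /q /b mulrBl mul1r divff// gt_eqF. Qed.
Let q0 : 0 < q. Proof. by rewrite qE; move: b12; lra. Qed.
Let q1 : q < 1. Proof. by rewrite qE; move: b0; lra. Qed.
Let bE : 1 - q = b. Proof. by rewrite qE; ring. Qed.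

Lemma beta_kk : beta alpha = b.
Proof. by rewrite /beta alphaE /b; field; rewrite gt_eqF. Qed.

Let powE : (1 + alpha) / 2 = q.
Proof. by rewrite alphaE qE /b; field; rewrite gt_eqF. Qed.

Let c0 : 0 < c.
Proof.
have aE : alpha = 1 - 2 * b by rewrite alphaE.
apply: divr_gt0 => //; rewrite aE; have := mulr_gt0 b0 b0; move: b0 b12.
by set z := b; clearbody z => z0 z1 z2; nra.
Qed.

Lemma gammaE : g = vy / (vy + b * vx).
Proof.
rewrite /g /gamma beta_kk; field.
rewrite !gt_eqF//=.
by rewrite addr_gt0// mulr_gt0.
Qed.

Let bvx : 0 < b * vx. Proof. exact: mulr_gt0. Qed.
Let g0 : 0 < g. Proof. by rewrite gammaE divr_gt0// addr_gt0. Qed.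
Let g1 : g < 1. Proof. by rewrite gammaE ltr_pdivrMr ?addr_gt0// mul1r ltrDl. Qed.
Let u0 : 0 < u. Proof. exact: divr_gt0. Qed.
Let v0 : 0 < v. Proof. exact: mulr_gt0. Qed.
Let ze0 : 0 < ze. Proof. by rewrite sqrtr_gt0. Qed.
Let zeu : ze ^+ 2 = u. Proof. by rewrite sqr_sqrtr ?(ltW u0). Qed.
Let hE : h = (1 - g) * ze. Proof. by []. Qed.
Let W (x y : V) := g *: x + (1 - g) *: y.

Let Z (s2 : R) : R := Num.sqrt (2 * pi * s2) ^- n.
Let Z_gt0 s2 : 0 < s2 -> 0 < Z s2.
Proof. by move=> s0; rewrite invr_gt0 exprn_gt0// sqrtr_gt0 !mulr_gt0// pi_gt0. Qed.

(** The ratio of normalising constants left over once the Gaussian exponents have been matched. *)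
Let C0 : R := Z u `^ q * Z vy `^ b * Z vx / (Z u * Z v).

Let C00 : 0 < C0.
Proof.
apply: divr_gt0; last by apply: mulr_gt0; exact: Z_gt0.
by apply: mulr_gt0; [apply: mulr_gt0; apply: powR_gt0|]; exact: Z_gt0.
Qed.

(* Completing the square in [y] and [x]. *)
Lemma gauss_product (x y : V) :
  phi u (y - x) `^ q * phi vy (y - mu) `^ b * phi vx (x - mu) =
  C0 * (phi u (y - x) * phi v (W x y - mu)).
Proof.
have powphi (s2 : R) (z : V) (t : R) : 0 < s2 ->
    phi s2 z `^ t = Z s2 `^ t * expR (t * (- sqnorm z / (2 * s2))) :> R.
  move=> s0; rewrite /phi powRM ?expR_ge0 ?(ltW (Z_gt0 s0))//.
  by congr (_ * _); rewrite -expRM; congr expR; rewrite mulrC.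
rewrite !powphi// /phi -!/(Z _).
pose X := x - mu; pose Y := y - mu.
have yx : y - x = Y + -1 *: X by rewrite /X /Y scaleN1r opprB addrA subrK.
have wE : W x y - mu = g *: X + (1 - g) *: Y.
  by rewrite /W /X /Y; apply/rowP => i; rewrite !mxE; ring.
rewrite -/X -/Y wE yx.
have e1 : sqnorm (Y + -1 *: X) = sqnorm Y - 2 * dotr Y X + sqnorm X.
  by rewrite sqnormD dotrZr sqnormZ; ring.
have dC : dotr X Y = dotr Y X by apply: eq_bigr => i _; rewrite mulrC.
have e2 : sqnorm (g *: X + (1 - g) *: Y) =
    g ^+ 2 * sqnorm X + 2 * (g * (1 - g)) * dotr Y X + (1 - g) ^+ 2 * sqnorm Y.
  by rewrite sqnormD dotrZr dotrZl !sqnormZ dC; ring.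
rewrite e1 e2; set a1 := sqnorm X; set a2 := sqnorm Y; set a3 := dotr Y X.
set E1 := expR _; set E2 := expR _; set E3 := expR _; set E4 := expR _; set E5 := expR _.
have -> : Z u `^ q * E1 * (Z vy `^ b * E2) * (Z vx * E3) =
    (Z u `^ q * Z vy `^ b * Z vx) * (E1 * E2 * E3) by ring.
have -> : C0 * (Z u * E4 * (Z v * E5)) = (Z u `^ q * Z vy `^ b * Z vx) * (E4 * E5).
  by rewrite /C0; field; rewrite !lt0r_neq0// Z_gt0.
congr (_ * _); rewrite /E1 /E2 /E3 /E4 /E5 -!expRD; congr expR.
have vv : 0 < vy + b * vx by rewrite addr_gt0.
rewrite /u /v gammaE qE.
field; by rewrite !lt0r_neq0.
Qed.

(** If [y = x + ze Z] then [W x y = x + (1 - g) ze Z]; this is where [xi] comes from. *)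
Lemma shear (G : V -> \bar R) x : measurable_fun setT G -> (forall y, (0 <= G y)%E) ->
  (\int[vol]_y ((phi u (y - x))%:E * G (W x y)) = heat h G x)%E.
Proof.
move=> mG G0.
have mW : measurable_fun setT (fun y : V => W x y).
  exact: measurable_rowDZ.
have mGW : measurable_fun setT (fun y : V => G (W x y)) by exact: measurableT_comp mG mW.
have := @heat_densityE _ _ ze (fun y => G (W x y)) 0 x ze0 mGW (fun y => G0 _).
rewrite add0r zeu => e.
transitivity (\int[vol]_y ((phi u (y - x))%:E * G (W x (0 + y))))%E.
  by apply: eq_integral => y _; rewrite add0r.
rewrite e; apply: eq_integral => z _; congr (_ * G _)%E.
by rewrite hE /W; apply/rowP => i; rewrite !mxE /ze; ring.
Qed.

Section mixture.
Variables (f N : V -> R) (Cf : R).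
Hypotheses (mf : measurable_fun setT f) (mN : measurable_fun setT N).
Hypotheses (f0 : forall x, 0 < f x) (N0 : forall x, 0 < N x) (fC : forall x, f x <= Cf).
Hypothesis hN : forall x, heat h (fun y => (f y)%:E) x = (N x)%:E.

(** This form covers both competitors: [f = m^kk] with [N] its heat flow gives the harmonic density,
    [f = N = 1] the invariant one. *)
Let ph (x y : V) : R := f (W x y) / N x * phi u (y - x).
Let A (t : V * V) : R := ph t.1 t.2 `^ q * phi vy (t.2 - mu) `^ b.
Let a (x : V) : \bar R := (\int[vol]_y (A (x, y))%:E)%E.

Let ph0 x y : 0 < ph x y.
Proof. by apply: mulr_gt0; [exact: divr_gt0|exact: phi_gt0]. Qed.

Let A_ge0 t : (0 <= (A t)%:E)%E.
Proof. by rewrite lee_fin; exact: mulr_ge0 (powR_ge0 _ _) (powR_ge0 _ _). Qed.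

Let msub : measurable_fun setT (fun t : V * V => t.2 - t.1).
Proof.
rewrite (_ : (fun t : V * V => _) = (fun t => t.2 + -1 *: t.1)); first exact: measurable_rowDZ.
by apply/funext => t; rewrite scaleN1r.
Qed.

Let mW2 : measurable_fun setT (fun t : V * V => W t.1 t.2).
Proof.
apply: measurable_rowDZ => //.
by apply: measurable_rowZ => //; exact: measurable_cst.
Qed.

Let mN1 : measurable_fun setT (fun t : V * V => N t.1).
Proof. exact: measurableT_comp mN (measurable_fst). Qed.

Let mph : measurable_fun setT (fun t : V * V => ph t.1 t.2).
Proof.
apply: measurable_funM; last exact: measurable_phi.
apply: measurable_funM; first exact: (measurableT_comp mf).
exact: (measurableT_comp (@measurable_invr R)).
Qed.

Let mA : measurable_fun setT A.
Proof.
apply: measurable_funM; apply: (measurableT_comp (measurable_powR _)) => //.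
by apply: measurable_phi; exact: measurable_rowD.
Qed.

Let mAx x : measurable_fun setT (fun y => (A (x, y))%:E).
Proof. by apply/measurable_EFinP; exact: (measurable_section x mA). Qed.

Let ma : measurable_fun setT a.
Proof.
apply: (@measurable_fun_fubini_tonelli_F _ _ _ _ _ vol (fun t => (A t)%:E)).
  by apply/measurable_EFinP; exact: mA.
by move=> t; exact: A_ge0.
Qed.

Let A_le x y : A (x, y) <= q * ph x y + (1 - q) * phi vy (y - mu).
Proof.
rewrite /A /= -bE; apply: young_powR => //.
exact: phi_gt0.
Qed.

Let mphi_mu s2 : measurable_fun setT (fun y : V => (phi s2 (y - mu))%:E).
Proof. by apply: measurable_phiE; exact: measurable_rowD. Qed.

Lemma integral_ph x : (\int[vol]_y (ph x y)%:E = 1)%E.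
Proof.
have mfE : measurable_fun setT (fun y => (f y)%:E) by apply/measurable_EFinP.
have fE0 y : (0 <= (f y)%:E)%E by rewrite lee_fin ltW.
have N0' : (0 <= ((N x)^-1)%:E)%E by rewrite lee_fin invr_ge0 ltW.
have mi : measurable_fun setT (fun y : V => (phi u (y - x))%:E * (f (W x y))%:E)%E.
  apply: emeasurable_funM; first by apply: measurable_phiE; exact: measurable_rowD.
  by apply: (measurableT_comp mfE); exact: measurable_rowDZ.
have i0 (y : V) : (0 <= (phi u (y - x))%:E * (f (W x y))%:E)%E.
  exact: mule_ge0 (phiE_ge0 _ _) (fE0 _).
transitivity (((N x)^-1)%:E * \int[vol]_y ((phi u (y - x))%:E * (f (W x y))%:E))%E.
  rewrite -(ge0_integralZl _ measurableT mi (fun y _ => i0 y) N0').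
  by apply: eq_integral => y _; rewrite -!EFinM; congr EFin; rewrite /ph; ring.
rewrite (shear x mfE fE0) hN -EFinM mulVf//.
exact: lt0r_neq0.
Qed.

(** The overlap of two probability densities with exponents [q] and [1 - q], bounded by Young's
    inequality. Its finiteness legitimates the subtractions in the extended reals. *)
Let a_le1 x : (a x <= 1)%E.
Proof.
have mphx : measurable_fun setT (fun y => (ph x y)%:E).
  by apply/measurable_EFinP; exact: (measurable_section x mph).
have q0' : (0 <= q%:E)%E by rewrite lee_fin ltW.
have b0' : (0 <= (1 - q)%:E)%E by rewrite bE lee_fin ltW.
have phE0 y : (0 <= (ph x y)%:E)%E by rewrite lee_fin ltW.
have pm0 (y : V) : (0 <= (phi vy (y - mu))%:E)%E by exact: phiE_ge0.
have m1 : measurable_fun setT (fun y => q%:E * (ph x y)%:E)%E by exact: emeasurable_funM.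
have m2 : measurable_fun setT (fun y : V => (1 - q)%:E * (phi vy (y - mu))%:E)%E by exact: emeasurable_funM.
have z1 y : (0 <= q%:E * (ph x y)%:E)%E by exact: mule_ge0.
have z2 (y : V) : (0 <= (1 - q)%:E * (phi vy (y - mu))%:E)%E by exact: mule_ge0.
have -> : 1%E = (\int[vol]_y (q%:E * (ph x y)%:E + (1 - q)%:E * (phi vy (y - mu))%:E))%E.
  rewrite (ge0_integralD _ measurableT (fun y _ => z1 y) m1 (fun y _ => z2 y) m2).
  rewrite (ge0_integralZl _ measurableT mphx (fun y _ => phE0 y) q0').
  rewrite (ge0_integralZl _ measurableT (mphi_mu vy) (fun y _ => pm0 y) b0').
  by rewrite integral_ph integral_phi// !mule1 -EFinD addrC subrK.
rewrite /a; apply: ge0_le_integral; [exact: measurableT|by move=> y _; exact: A_ge0|exact: mAx| |].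
  exact: emeasurable_funD.
by move=> y _; rewrite -!EFinM -EFinD lee_fin; exact: A_le.
Qed.

Let a_ge0 x : (0 <= a x)%E.
Proof. by apply: integral_ge0 => y _; exact: A_ge0. Qed.

Let a_fin x : a x \is a fin_num.
Proof. by rewrite ge0_fin_numE//; apply: le_lt_trans (a_le1 x) _; exact: ltry. Qed.

Let A_dominated x : exists C, exists2 eps : R, 0 < eps &
  forall y, phi vy (y - mu) + ph x y <= C * expR (- eps * sqnorm y).
Proof.
pose eps := (4 * (vy + u))^-1.
have vu : 0 < vy + u by exact: addr_gt0.
have e0 : 0 < eps by rewrite invr_gt0 mulr_gt0.
have small s2 : 0 < s2 -> s2 <= vy + u -> eps * (4 * s2) <= 1.
  by move=> s0 sl; rewrite /eps mulrC ler_pdivrMr ?mulr_gt0// mul1r ler_pM2l.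
have h1 := fun y => phi_dominated y mu vy0 e0 (small _ vy0 (ltW (ltr_pwDr u0 (lexx vy)))).
have h2 := fun y => phi_dominated y x u0 e0 (small _ u0 (ltW (ltr_pwDl vy0 (lexx u)))).
eexists; exists eps => // y.
have CN : 0 <= Cf / N x by apply: divr_ge0 (ltW (N0 x)); exact: le_trans (ltW (f0 x)) (fC x).
have h3 : ph x y <= Cf / N x * phi u (y - x).
  by apply: ler_wpM2r; [exact: phi_ge0|apply: ler_wpM2r => //; rewrite invr_ge0 ltW].
have h4 := le_trans h3 (ler_wpM2l CN (h2 y)).
apply: (le_trans (lerD (h1 y) h4)); rewrite mulrA -mulrDl; exact: lexx.
Qed.

(** Since [(ph / phi)^q phi = ph^q phi^(1-q)], the loss is [c] times one minus the overlap. The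
    integrand is signed, hence the appeal to Gaussian domination, which the bound [Cf] on [f]
    provides. *)
Lemma D_mixture x : D_alpha alpha vy mu ph x = (c%:E - c%:E * a x)%E.
Proof.
have [C [eps e0 dom]] := A_dominated x.
have phim y : 0 < phi vy (y - mu) by exact: phi_gt0.
have A0 y : 0 <= A (x, y) by rewrite -lee_fin.
have AC y : A (x, y) <= C * expR (- eps * sqnorm y).
  apply: (le_trans (A_le x y)); apply: le_trans (dom y).
  rewrite addrC; apply: lerD; apply: ler_piMl; rewrite ?ltW//.
  by rewrite ltrBlDr ltrDl.
have PC y : phi vy (y - mu) <= C * expR (- eps * sqnorm y).
  by apply: le_trans (dom y); rewrite lerDl ltW.
have FE y : f_alpha alpha (ph x y / phi vy (y - mu)) * phi vy (y - mu) =
    c * phi vy (y - mu) - c * A (x, y).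
  rewrite /f_alpha powE -/c -mulrA mulrBl mul1r powR_div_mul// bE /A /=.
  by rewrite mulrBr.
have mA' : measurable_fun setT (fun y => A (x, y)) by exact: (measurable_section x mA).
have mP : measurable_fun setT (fun y : V => phi vy (y - mu)).
  by apply: measurable_phi; exact: measurable_rowD.
have -> : D_alpha alpha vy mu ph x = (\int[vol]_y (c * phi vy (y - mu) - c * A (x, y))%:E)%E.
  apply: (@iter_int_gaussian_dominated R n _ (fun y => c * phi vy (y - mu) - c * A (x, y)) (2 * c * C) eps e0).
  - by apply: measurable_funB; apply: measurable_funM.
  - move=> y; have := PC y; have := AC y; set E := expR _ => h1 h2.
    have h3 := ler_wpM2l (ltW c0) h1; have h4 := ler_wpM2l (ltW c0) h2.
    have h5 := mulr_ge0 (ltW c0) (A0 y); have h6 := mulr_ge0 (ltW c0) (ltW (phim y)).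
    move: h3 h4 h5 h6; rewrite -(mulrA (2 * c)) -(mulrA 2).
    set z1 := c * (C * E); set z2 := c * A _; set z3 := c * phi _ _.
    by clearbody z1 z2 z3 => h3 h4 h5 h6; rewrite ler_norml; apply/andP; split; lra.
  - by move=> s; rewrite FE.
have iP : vol.-integrable setT (EFin \o (fun y : V => c * phi vy (y - mu))).
  apply: (integrable_gaussian_dominated (C := c * C) e0); first by apply: measurable_funM.
  move=> y; have := ler_wpM2l (ltW c0) (PC y); rewrite [leRHS]mulrA ger0_norm//.
  exact: mulr_ge0 (ltW c0) (ltW (phim y)).
have iA : vol.-integrable setT (EFin \o (fun y : V => c * A (x, y))).
  apply: (integrable_gaussian_dominated (C := c * C) e0); first by apply: measurable_funM.
  move=> y; have := ler_wpM2l (ltW c0) (AC y); rewrite [leRHS]mulrA ger0_norm//.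
  exact: mulr_ge0 (ltW c0) (A0 y).
have c0' : (0 <= c%:E)%E by rewrite lee_fin ltW.
have pm0 (y : V) : (0 <= (phi vy (y - mu))%:E)%E by exact: phiE_ge0.
transitivity (\int[vol]_y (c * phi vy (y - mu))%:E - \int[vol]_y (c * A (x, y))%:E)%E.
  by rewrite -(integralB_EFin measurableT iP iA); apply: eq_integral => y _; rewrite EFinB.
congr (_ - _)%E.
  rewrite -[RHS]mule1 -(integral_phi mu vy0).
  by rewrite -(ge0_integralZl _ measurableT (mphi_mu vy) (fun y _ => pm0 y) c0').
by rewrite /a -(ge0_integralZl _ measurableT (mAx x) (fun y _ => A_ge0 (x, y)) c0').
Qed.

Let T : \bar R := (\int[vol]_x (a x * (phi vx (x - mu))%:E))%E.

Lemma risk_overlap : risk_alpha alpha vx vy mu ph = (c%:E - c%:E * T)%E.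
Proof.
have c0' : (0 <= c%:E)%E by rewrite lee_fin ltW.
have px0 (x : V) : (0 <= (phi vx (x - mu))%:E)%E by exact: phiE_ge0.
have DE : D_alpha alpha vy mu ph = fun x => (c%:E - c%:E * a x)%E.
  by apply/funext => x; exact: D_mixture.
have D0 x : (0 <= c%:E - c%:E * a x)%E.
  rewrite -(fineK (a_fin x)) -EFinM -EFinB lee_fin subr_ge0.
  apply: ler_piMr; first exact: ltW.
  by rewrite -lee_fin fineK; [exact: a_le1|exact: a_fin].
have mD : measurable_fun setT (fun x => c%:E - c%:E * a x)%E.
  apply: emeasurable_funB; first exact: measurable_cst.
  exact: emeasurable_funM.
have m1 : measurable_fun setT (fun x => (c%:E - c%:E * a x) * (phi vx (x - mu))%:E)%E.
  exact: emeasurable_funM.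
have i1 x : (0 <= (c%:E - c%:E * a x) * (phi vx (x - mu))%:E)%E by exact: mule_ge0.
have m2 : measurable_fun setT (fun x => a x * (phi vx (x - mu))%:E)%E by exact: emeasurable_funM.
have i2 x : (0 <= a x * (phi vx (x - mu))%:E)%E by exact: mule_ge0.
have m3 : measurable_fun setT (fun x => c%:E * (a x * (phi vx (x - mu))%:E))%E.
  exact: emeasurable_funM.
have i3 x : (0 <= c%:E * (a x * (phi vx (x - mu))%:E))%E by exact: mule_ge0.
have -> : risk_alpha alpha vx vy mu ph =
    (\int[vol]_x ((c%:E - c%:E * a x) * (phi vx (x - mu))%:E))%E.
  by rewrite /risk_alpha DE; exact: intRdE.
(* Adding [c T] keeps all integrands nonnegative, so additivity applies; the finite term is removed
   at the end. *)
have tot : (\int[vol]_x ((c%:E - c%:E * a x) * (phi vx (x - mu))%:E) + c%:E * T = c%:E)%E.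
  rewrite /T -(ge0_integralZl _ measurableT m2 (fun x _ => i2 x) c0').
  rewrite -(ge0_integralD _ measurableT (fun x _ => i1 x) m1 (fun x _ => i3 x) m3).
  transitivity (\int[vol]_x (c%:E * (phi vx (x - mu))%:E))%E.
    apply: eq_integral => x _; rewrite -(fineK (a_fin x)); set r := fine _; set P := phi _ _.
    rewrite -[LHS]/(((c - c * r) * P + c * (r * P))%:E) -EFinM; congr EFin; ring.
  rewrite (ge0_integralZl _ measurableT (mphi_mu vx) (fun y _ => px0 y) c0').
  by rewrite integral_phi// mule1.
have I0 : (0 <= \int[vol]_x ((c%:E - c%:E * a x) * (phi vx (x - mu))%:E))%E.
  by apply: integral_ge0 => x _; exact: i1.
have T0 : (0 <= c%:E * T)%E by apply: mule_ge0 => //; apply: integral_ge0 => x _; exact: i2.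
have Tf : (c%:E * T)%E \is a fin_num.
  rewrite ge0_fin_numE//; apply: (@le_lt_trans _ _ c%:E); last exact: ltry.
  by rewrite -[leRHS]tot leeDr.
by rewrite -[X in _ = (X - _)%E]tot addeK.
Qed.

(** After [gauss_product] and [shear], the integrand evaluates [f] at [x + h z] and [N] at [x].
    Swapping the integrals and translating [x] by [- h z] moves [f] to [x] and [N] to [x - h z];
    symmetry of [Z] restores the sign. *)
Lemma overlapE : T = (C0%:E * \int[vol]_x ((phi v (x - mu))%:E *
  ((f x `^ q)%:E * heat h (fun y => (N y `^ (- q))%:E) x)))%E.
Proof.
pose F x (w : V) : \bar R := (f w `^ q * N x `^ (- q) * phi v (w - mu))%:E.
have F0 x w : (0 <= F x w)%E.
  rewrite lee_fin; apply: mulr_ge0 (phi_ge0 _ _).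
  exact: mulr_ge0 (powR_ge0 _ _) (powR_ge0 _ _).
have mpf : measurable_fun setT (fun w => f w `^ q) by exact: (measurableT_comp (measurable_powR _)).
have mpN : measurable_fun setT (fun w => N w `^ (- q)) by exact: (measurableT_comp (measurable_powR _)).
have mpm : measurable_fun setT (fun w : V => phi v (w - mu)).
  by apply: measurable_phi; exact: measurable_rowD.
have mF2 d (X : measurableType d) (s t : X -> V) : measurable_fun setT s -> measurable_fun setT t ->
    measurable_fun setT (fun r => F (s r) (t r)).
  move=> ms mt; apply/measurable_EFinP; apply: measurable_funM; last exact: (measurableT_comp mpm).
  by apply: measurable_funM; [exact: (measurableT_comp mpf)|exact: (measurableT_comp mpN)].
have mF x : measurable_fun setT (F x) by apply: mF2.
have C0' : (0 <= C0%:E)%E by rewrite lee_fin ltW.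
have inner x : (a x * (phi vx (x - mu))%:E = C0%:E * heat h (F x) x)%E.
  have px0 : (0 <= (phi vx (x - mu))%:E)%E by exact: phiE_ge0.
  have mi : measurable_fun setT (fun y : V => (phi u (y - x))%:E * F x (W x y))%E.
    apply: emeasurable_funM; first by apply: measurable_phiE; exact: measurable_rowD.
    by apply: (measurableT_comp (mF x)); exact: measurable_rowDZ.
  have i0 (y : V) : (0 <= (phi u (y - x))%:E * F x (W x y))%E by exact: mule_ge0 (phiE_ge0 _ _) (F0 _ _).
  rewrite -(shear x (mF x) (F0 x)) -(ge0_integralZl _ measurableT mi (fun y _ => i0 y) C0').
  rewrite muleC /a -(ge0_integralZl _ measurableT (mAx x) (fun y _ => A_ge0 (x, y)) px0).
  apply: eq_integral => y _; rewrite /F -!EFinM; congr EFin.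
  have e1 : ph x y `^ q = f (W x y) `^ q * N x `^ (- q) * phi u (y - x) `^ q.
    rewrite /ph powRM ?phi_ge0//; last by apply: divr_ge0; exact: ltW.
    by rewrite powR_div.
  have e2 := gauss_product x y.
  rewrite /A /= e1.
  have -> : C0 * (phi u (y - x) * (f (W x y) `^ q * N x `^ (- q) * phi v (W x y - mu))) =
     f (W x y) `^ q * N x `^ (- q) * (C0 * (phi u (y - x) * phi v (W x y - mu))) by ring.
  rewrite -e2; ring.
have mheat : measurable_fun setT (fun x => heat h (F x) x).
  pose G (t : V * V) := ((phi 1 t.2)%:E * F t.1 (t.1 + h *: t.2)%R)%E.
  have mG : measurable_fun setT G.
    apply: emeasurable_funM; first exact: measurable_phiE.
    by apply: mF2 => //; exact: measurable_rowDZ.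
  apply: (@measurable_fun_fubini_tonelli_F _ _ _ _ _ vol G) => //.
  by move=> t; exact: mule_ge0 (phiE_ge0 _ _) (F0 _ _).
have heat0' x : (0 <= heat h (F x) x)%E by exact: heat_ge0.
rewrite /T; under eq_integral do rewrite inner.
rewrite (ge0_integralZl _ measurableT mheat (fun x _ => heat0' x) C0'); congr (_ * _)%E.
pose G (t : V * V) := ((phi 1 t.2)%:E * F t.1 (t.1 + h *: t.2)%R)%E.
have mG : measurable_fun setT G.
  apply: emeasurable_funM; first exact: measurable_phiE.
  by apply: mF2 => //; exact: measurable_rowDZ.
have G0 t : (0 <= G t)%E by exact: mule_ge0 (phiE_ge0 _ _) (F0 _ _).
pose H (t : V * V) := ((phi 1 t.1)%:E * F (t.2 + - h *: t.1)%R t.2)%E.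
have mH' : measurable_fun setT H.
  apply: emeasurable_funM; first exact: measurable_phiE.
  by apply: mF2 => //; exact: measurable_rowDZ.
have H0 t : (0 <= H t)%E by exact: mule_ge0 (phiE_ge0 _ _) (F0 _ _).
transitivity (\int[vol]_x \int[vol]_z G (x, z))%E => //.
rewrite (fubini_tonelli G mG G0).
transitivity (\int[vol]_z \int[vol]_x H (z, x))%E.
  apply: eq_integral => z _.
  have mGz : measurable_fun setT (fun x => G (x, z)).
    rewrite /G /=; apply: emeasurable_funM => //.
    by apply: mF2 => //; exact: measurable_rowDZ.
  rewrite (ge0_row_lebesgue_affine (- h *: z) (oner_neq0 R) mGz (fun x => G0 (x, z))).
  rewrite normr1 expr1n mul1e; apply: eq_integral => x _.
  rewrite /G /H /= scale1r; congr (_ * F _ _)%E; first by rewrite addrC.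
  by rewrite addrAC scaleNr addNr add0r.
rewrite (fubini_tonelli H mH' H0); apply: eq_integral => x _.
have mpNE : measurable_fun setT (fun y => (N y `^ (- q))%:E) by apply/measurable_EFinP.
have pN0 y : (0 <= (N y `^ (- q))%:E)%E by rewrite lee_fin powR_ge0.
rewrite -(heat_opp h x mpNE pN0) muleA -EFinM.
have k0 : (0 <= (phi v (x - mu) * f x `^ q)%:E)%E.
  by rewrite lee_fin; exact: mulr_ge0 (phi_ge0 _ _) (powR_ge0 _ _).
rewrite -(ge0_integralZl _ measurableT (measurable_heat_section (- h) x mpNE)
   (fun z _ => mule_ge0 (phiE_ge0 _ _) (pN0 _)) k0).
by apply: eq_integral => z _; rewrite /H /F /= -!EFinM; congr EFin; ring.
Qed.

Lemma risk_mixture_overlap : risk_alpha alpha vx vy mu ph =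
  (c%:E - c%:E * (C0%:E * \int[vol]_x ((phi v (x - mu))%:E *
  ((f x `^ q)%:E * heat h (fun y => (N y `^ (- q))%:E) x))))%E.
Proof. by rewrite risk_overlap overlapE. Qed.

End mixture.

(** Both constants are chosen before [f] and [N], so two risks can be compared through their overlap
    integrals alone. *)
Lemma risk_mixture : exists2 c : R, 0 <= c & exists2 C : R, 0 <= C &
  forall (f N : V -> R) (Cf : R), measurable_fun setT f -> measurable_fun setT N ->
  (forall x, 0 < f x) -> (forall x, 0 < N x) -> (forall x, f x <= Cf) ->
  (forall x, heat (xi alpha vx vy) (fun y => (f y)%:E) x = (N x)%:E) ->
  risk_alpha alpha vx vy mu (fun x y =>
    f (gamma alpha vx vy *: x + (1 - gamma alpha vx vy) *: y) / N x *
    phi (vy / gamma alpha vx vy) (y - x)) =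
  (c%:E - c%:E * (C%:E * \int[vol]_x ((phi (vx * gamma alpha vx vy) (x - mu))%:E *
    ((f x `^ ((kk - 1) / kk))%:E *
     heat (xi alpha vx vy) (fun y => (N y `^ (- ((kk - 1) / kk)))%:E) x))))%E.
Proof.
exists c; first exact: ltW.
exists C0; first exact: ltW.
move=> f N Cf mf mN f0 N0 fC hN.
exact: risk_mixture_overlap mf mN f0 N0 fC hN.
Qed.

End mixture_risk.

(** * The harmonic predictive density and the conclusion *)

Section harmonic_predictive.
Variables (R : realType) (p k : nat) (alpha vx vy : R).
Notation V := 'rV[R]_p.+3.
Notation kk := (k.+2%:R : R).
Notation vol := (row_lebesgue R p.+3).
Notation g := (gamma alpha vx vy).
Notation h := (xi alpha vx vy).
Notation v := (vx * g).
Hypotheses (vx0 : 0 < vx) (vy0 : 0 < vy) (alphaE : alpha = 1 - 2 / kk).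

Lemma gamma_gt0 : 0 < g.
Proof.
have gE : g = vy / (vy + kk^-1 * vx) := gammaE vx0 vy0 alphaE.
by rewrite gE; apply: divr_gt0 => //; apply: addr_gt0 => //; apply: mulr_gt0 => //; rewrite invr_gt0 ltr0n.
Qed.

Lemma xi_gt0 : 0 < h.
Proof.
have gE : g = vy / (vy + kk^-1 * vx) := gammaE vx0 vy0 alphaE.
have g0 := gamma_gt0.
have b0 : 0 < kk^-1 * vx by apply: mulr_gt0 => //; rewrite invr_gt0 ltr0n.
apply: mulr_gt0; last by rewrite sqrtr_gt0; exact: divr_gt0.
rewrite subr_gt0 gE ltr_pdivrMr; last exact: addr_gt0.
by rewrite mul1r ltrDl.
Qed.

Hypothesis K0 : 0 < (Num.sqrt v)^-1.
Let f (y : V) : R := radmom p K0 0 (sqnorm y) ^+ k.+2.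

Let mf : measurable_fun setT f.
Proof. by apply/measurable_EFinP; exact: measurable_rad_sqnorm. Qed.

Let f_gt0 y : 0 < f y.
Proof. by apply: exprn_gt0; apply: rad0_gt0; exact: sqnorm_ge0. Qed.

Let heat_f x : heat h (fun y => (f y)%:E) x = (flow k K0 (h ^+ 2) x)%:E.
Proof.
by have := heat_flowE k K0 (h ^+ 2) x; rewrite sqrtr_sqr (gtr0_norm xi_gt0).
Qed.

(** The unknown constant of [mH_radial], raised to the power [kk], occurs in both numerator and
    normaliser and cancels. *)
Lemma pH_flow : pH alpha vx vy = (fun x y : V =>
  f (g *: x + (1 - g) *: y) / flow k K0 (h ^+ 2) x * phi (vy / g) (y - x)).
Proof.
have v0 : 0 < v by exact: mulr_gt0 vx0 gamma_gt0.
have [C C_gt0 mHE] := mH_radial p v0 K0.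
have bE : 1 / beta alpha = kk.
  have -> : beta alpha = kk^-1 := beta_kk alphaE.
  by rewrite div1r invrK.
have powE (w : V) : mHpow alpha w v = C ^+ k.+2 * f w.
  rewrite /mHpow mHE /= bE powR_mulrn ?exprMn//.
  by apply: mulr_ge0 (ltW C_gt0) _; exact: rad_ge0.
have Ck : 0 < C ^+ k.+2 by exact: exprn_gt0.
have Ck' : (0 <= (C ^+ k.+2)%:E)%E by rewrite lee_fin ltW.
have mfE : measurable_fun setT (fun y => (f y)%:E) by apply/measurable_EFinP.
have fE0 y : (0 <= (f y)%:E)%E by rewrite lee_fin ltW.
have normE (x : V) : pH_normalizer alpha vx vy x = C ^+ k.+2 * flow k K0 (h ^+ 2) x.
  rewrite /pH_normalizer.
  have -> : (fun z : V => (phi 1 z * mHpow alpha (x + h *: z) v)%:E) =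
      (fun z => (C ^+ k.+2)%:E * ((phi 1 z)%:E * (f (x + h *: z))%:E))%E.
    by apply/funext => z; rewrite powE -!EFinM; congr EFin; rewrite mulrCA.
  have mi := measurable_heat_section h x mfE.
  have i0 (z : V) : (0 <= (phi 1 z)%:E * (f (x + h *: z))%:E)%E by exact: mule_ge0 (phiE_ge0 _ _) (fE0 _).
  rewrite intRdE; [|exact: emeasurable_funM|by move=> z; exact: mule_ge0].
  rewrite (ge0_integralZl _ measurableT mi (fun z _ => i0 z) Ck').
  by rewrite -/(heat h (fun y => (f y)%:E) x) heat_f -EFinM.
apply/funext => x; apply/funext => y; rewrite /pH powE normE.
have F0 : 0 < flow k K0 (h ^+ 2) x by apply: flow_gt0; exact: sqr_ge0.
by field; rewrite !lt0r_neq0.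
Qed.

Lemma pH_dominates (mu : V) :
  h ^+ 2 * (kk * (Num.sqrt v)^-1 ^+ 2 * p.+3%:R / (p.+3%:R + 2)) * (2 * (kk - 1)) <= 1 ->
  (risk_alpha alpha vx vy mu (pH alpha vx vy) <= risk_alpha alpha vx vy mu (pU alpha vx vy))%E.
Proof.
move=> small.
have [c c0 [C C0 riskE]] := risk_mixture mu vx0 vy0 alphaE.
have [_ [Cf fCf]] := test_rad_pow p k K0.
have N0 (x : V) : 0 < flow k K0 (h ^+ 2) x by apply: flow_gt0; exact: sqr_ge0.
have fC y : f y <= Cf.
  by apply: le_trans (ler_norm _) (fCf _ _) => /=; exact: sqnorm_ge0.
rewrite pH_flow (riskE f (flow k K0 (h ^+ 2)) Cf mf (measurable_flow _ _ _) f_gt0 N0 fC heat_f).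
have one (x : V) : (0 : R) < 1 by [].
have le1 (x : V) : 1 <= 1 :> R by [].
have heat1 (x : V) : heat h (fun=> 1%:E) x = 1%:E by rewrite heat_cst ?lee_fin.
(* Its overlap integrand is then just [phi v (x - mu)], so it is enough that [f^q] times the
   averaged power of [N] is pointwise at least 1. *)
have -> : pU alpha vx vy = (fun x y : V => 1 / 1 * phi (vy / g) (y - x)).
  by apply/funext => x; apply/funext => y; rewrite /pU divr1 mul1r.
rewrite (riskE (fun=> 1) (fun=> 1) 1 (measurable_cst _) (measurable_cst _) one one le1 heat1).
apply: leeB; first exact: lexx.
apply: lee_wpmul2l; first by rewrite lee_fin.
apply: lee_wpmul2l; first by rewrite lee_fin.
set q := (kk - 1) / kk.
have mN : measurable_fun setT (fun y : V => (flow k K0 (h ^+ 2) y `^ (- q))%:E).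
  apply/measurable_EFinP; apply: (measurableT_comp (measurable_powR _)).
  exact: measurable_flow.
have pN0 (y : V) : (0 <= (flow k K0 (h ^+ 2) y `^ (- q))%:E)%E by rewrite lee_fin powR_ge0.
have mp : measurable_fun setT (fun x : V => (phi v (x - mu))%:E).
  by apply: measurable_phiE; exact: measurable_rowD.
have p0 (x : V) : (0 <= (phi v (x - mu))%:E)%E by exact: phiE_ge0.
have lhsE (x : V) : ((phi v (x - mu))%:E * ((1 `^ q)%:E * heat h (fun=> (1 `^ (- q))%:E) x) =
    (phi v (x - mu))%:E)%E.
  by rewrite !powR1 heat1 !mule1.
under eq_integral do rewrite lhsE.
apply: ge0_le_integral; [exact: measurableT|by move=> x _; exact: p0|exact: mp| |].
  apply: emeasurable_funM => //; apply: emeasurable_funM.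
    by apply/measurable_EFinP; apply: (measurableT_comp (measurable_powR _)).
  exact: measurable_heat.
move=> x _; rewrite -[leLHS]mule1; apply: lee_wpmul2l; first exact: p0.
have := heat_flow_pow_ge K0 x (exprn_gt0 2 xi_gt0) small.
rewrite sqrtr_sqr (gtr0_norm xi_gt0) -/q -/(f x) => key.
have fq : 0 < f x `^ q by exact: powR_gt0.
apply: (@le_trans _ _ ((f x `^ q)%:E * (f x `^ (- q))%:E)%E).
  by rewrite -EFinM powRN mulfV ?lt0r_neq0.
by apply: lee_wpmul2l; [rewrite lee_fin ltW|exact: key].
Qed.

End harmonic_predictive.

Theorem theorem5 (R : realType) (d : nat) (alpha vx vy : R) :
  (3 <= d)%N ->
  -1 < alpha < 1 ->
  (exists k : nat, (0 < k)%N /\ 2 / (1 - alpha) = k%:R) ->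
  0 < vx -> 0 < vy ->
  vx / vy <= (d%:R + 2) / (d%:R * (1 + alpha)) ->
  forall mu : 'rV[R]_d,
    (risk_alpha alpha vx vy mu (pH alpha vx vy)
      <= risk_alpha alpha vx vy mu (pU alpha vx vy))%E.
Proof.
move=> d3; have [p ->] : exists p, d = p.+3 by exists (d - 3)%N; rewrite -addn3 subnK.
move=> /andP[a1 a2] [k0 [_ kE]] vx0 vy0 ratio mu.
have a1' : 0 < 1 - alpha by rewrite subr_gt0.
(* Since [alpha > -1], the integer [2 / (1 - alpha)] exceeds 1, which allows the indexing by
   [k.+2]. *)
have k1 : (1 < k0)%N by rewrite -(ltr_nat R) -kE ltr_pdivlMr//; lra.
have [k k0E] : exists k, k0 = k.+2 by exists (k0 - 2)%N; rewrite -addn2 subnK.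
rewrite k0E in kE.
have kk0 : 0 < k.+2%:R :> R by rewrite ltr0n.
have alphaE : alpha = 1 - 2 / k.+2%:R by rewrite -kE; field; rewrite lt0r_neq0.
have g0 := gamma_gt0 vx0 vy0 alphaE.
have v0 : 0 < vx * gamma alpha vx vy by exact: mulr_gt0.
have K0 : 0 < (Num.sqrt (vx * gamma alpha vx vy))^-1 by rewrite invr_gt0 sqrtr_gt0.
apply: (pH_dominates vx0 vy0 alphaE K0).
rewrite exprVn sqr_sqrtr ?(ltW v0)// /xi exprMn sqr_sqrtr; last by apply: divr_ge0; exact: ltW.
have gE : gamma alpha vx vy = vy / (vy + k.+2%:R^-1 * vx) := gammaE vx0 vy0 alphaE.
have d0 : 0 < p.+3%:R + 2 :> R by apply: addr_gt0 => //; rewrite ltr0n.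
have d1 : 0 < p.+3%:R :> R by rewrite ltr0n.
have al : 0 < 1 + alpha by lra.
have b0 : 0 < vy + k.+2%:R^-1 * vx by apply: addr_gt0 => //; apply: mulr_gt0 => //; rewrite invr_gt0.
have b1 : 0 < k.+2%:R * vy + vx by apply: addr_gt0 => //; exact: mulr_gt0.
(* By [(1 - gamma) / gamma = vx / (kk vy)] and [1 + alpha = 2 (kk - 1) / kk], the smallness
   condition becomes exactly the assumed bound on [vx / vy]. *)
have -> : (1 - gamma alpha vx vy) ^+ 2 * (vy / gamma alpha vx vy) *
   (k.+2%:R * (vx * gamma alpha vx vy)^-1 * p.+3%:R / (p.+3%:R + 2)) * (2 * (k.+2%:R - 1)) =
   vx / vy * (p.+3%:R * (1 + alpha)) / (p.+3%:R + 2).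
  rewrite gE alphaE; move: kk0 d0 b0 b1; set kk := k.+2%:R; set dd := p.+3%:R; clearbody kk dd.
  move=> kk0 d0 b0 b1.
  by field; do ?[apply/andP; split]; apply: lt0r_neq0; lra.
rewrite ler_pdivrMr// mul1r -ler_pdivlMr//.
exact: mulr_gt0.
Qed.
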